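(* Let two independent sequences of lengths $m$ and $n$ consist of i.i.d. letters from $\{0,1\}$, each letter being $0$ with probability $\frac12$. Let $X$ and $Y$ be the numbers of occurrences of $0$ in the first and second sequence, $D_2=XY+(m-X)(n-Y)$, and $$W=\frac{D_2-\mathbb{E}D_2}{\sqrt{\mathrm{Var}(D_2)}}=\Big(\frac{X-\frac m2}{\sqrt{m/4}}\Big)\Big(\frac{Y-\frac n2}{\sqrt{n/4}}\Big).$$ Let $Z\sim\mathrm{SVG}(1,1,0)$. Then $$d_{\mathrm W}(W,Z)\le20.11\Big(\frac1{\sqrt m}+\frac1{\sqrt n}\Big),\qquad d_{\mathrm K}(W,Z)\le\Big\{44.33+2.02\log\Big(\frac{mn}{m+n}\Big)\Big\}\Big(\frac1m+\frac1n\Big)^{1/3}.$$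
   Context: $\mathrm{SVG}(1,1,0)$ is the distribution with density $\frac1\pi K_0(|x|)$, $K_0$ the modified Bessel function of the second kind of order 0. $d_{\mathrm K}$ is the Kolmogorov distance and $d_{\mathrm W}$ the Wasserstein distance (sup over Lipschitz test functions with constant $\le1$). *)

(* Defs.v *)
From Stdlib Require Import Reals Lra ClassicalEpsilon.
Open Scope R_scope.

Definition improper_int_0_inf (f : R -> R) (l : R) : Prop :=
  forall eps, 0 < eps -> exists B, forall b, B <= b ->
    exists pr : Riemann_integrable f 0 b, Rabs (RiemannInt pr - l) < eps.

(* Modified Bessel function of the second kind of order 0, for x > 0:
   K_0(x) = \int_0^\infty exp(-x cosh t) dt.  (Value at x <= 0 irrelevant.) *)
Definition K0 (x : R) : R :=
  epsilon (inhabits 0) (fun l => improper_int_0_inf (fun t => exp (- (x * cosh t))) l).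

Definition svg_density (x : R) : R := K0 (Rabs x) / PI.

(* l is the improper integral of f over the real line, allowing a
   singularity at 0:  limit of \int_{-A1}^{-e1} f + \int_{e2}^{A2} f
   as e1, e2 -> 0+ and A1, A2 -> +oo independently. *)
Definition improper_int_R (f : R -> R) (l : R) : Prop :=
  forall eps, 0 < eps -> exists delta M, 0 < delta /\
    forall e1 e2 A1 A2, 0 < e1 < delta -> 0 < e2 < delta -> M <= A1 -> M <= A2 ->
      exists (pr1 : Riemann_integrable f (- A1) (- e1))
             (pr2 : Riemann_integrable f e2 A2),
        Rabs (RiemannInt pr1 + RiemannInt pr2 - l) < eps.

Definition Wval (m n i j : nat) : R :=
  ((INR i - INR m / 2) / sqrt (INR m / 4)) * ((INR j - INR n / 2) / sqrt (INR n / 4)).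

(* P(X = i, Y = j) for independent X ~ Bin(m,1/2), Y ~ Bin(n,1/2) *)
Definition pXY (m n i j : nat) : R :=
  C m i * C n j / 2 ^ (m + n).

Definition EW (m n : nat) (h : R -> R) : R :=
  sum_f_R0 (fun i => sum_f_R0 (fun j => pXY m n i j * h (Wval m n i j)) n) m.

Definition PW_le (m n : nat) (z : R) : R :=
  sum_f_R0 (fun i => sum_f_R0 (fun j =>
     pXY m n i j * (if Rle_dec (Wval m n i j) z then 1 else 0)) n) m.

Definition lipschitz1 (h : R -> R) : Prop :=
  forall x y, Rabs (h x - h y) <= Rabs (x - y).

(* Main.v *)
From Coquelicot Require Import Coquelicot.
From Stdlib Require Import Reals Factorial Lra Lia ClassicalEpsilon.
Require Import Defs.
Open Scope R_scope.

(** [SVG(1,1,0)] is the law of a product [N N'] of two independent standard normal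
    variables: substituting [y = sqrt u e^(t/2)] turns [K0 u] into the integral over
    [y > 0] of [e^(-y^2/2) e^(-(u/y)^2/2) / y], and exchanging the [u]- and [y]-integrals gives
    the expectation of [h (N N')].  Since [W] is the product of two independent standardized
    binomial variables, it suffices to compare each factor with a normal variable, uniformly
    over the functions [h (a .)].  This is done by Stein's method: if [f' - x f = h - E h(N)],
    then [E (f'(A) - A f(A))] is controlled by the mean value theorem and the size of [f] and
    [f'], with an error of order [1/sqrt m] both for Lipschitz [h] and for monotone [h] with
    values in [[0, 1]]; in the latter case the variation of [h] along the lattice is absorbed
    by the bound [1/sqrt m] on the binomial weights.  The indicator of a half-line is
    sandwiched between two such monotone functions.  The resulting bounds
    [17 (1/sqrt m + 1/sqrt n)] and [16.5 (1/sqrt m + 1/sqrt n)] imply the stated ones. *)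

(** The limit density has a logarithmic singularity at 0, so smoothing an indicator over a width e
    costs about e log(1/e); balanced against a bound that grows with 1/e, this would produce a
    logarithm and a smaller exponent. Here the estimate for monotone functions does not depend on
    their slope, so e tends to 0 with m and n fixed and smoothing costs nothing. Smoothing is still
    done because the mean value theorem wants the Stein solution differentiable everywhere, hence h
    continuous. The product structure demands a factor estimate that survives the scaling h(a .).
    For Lipschitz functions the constant becomes |a|, which averages to at most 1 over either
    factor; monotone functions with values in [0, 1] form a class stable under every scaling. The
    constants are 17 = 2*4 + 4*2 + 1 and 33/2 = 2*2 + 4*3 + 1/2: each is 2 B0 + 4 B1, with B0 and B1
    bounding the Stein solution and its derivative, plus the oscillation of h between neighbouring
    lattice points. *)

(* [ring] and [field] do not see through Coquelicot's canonical structures on [R]. *)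
Ltac as_R := lazymatch goal with |- @eq _ ?a ?b => change (@eq R a b) end.

(** * Expectations under the symmetric binomial distribution *)

(* [bexp m g] is the expectation of [g X] for [X ~ Bin(m, 1/2)], obtained by
   conditioning on one coin toss. *)
Fixpoint bexp (m : nat) (g : nat -> R) : R :=
  match m with
  | O => g O
  | S k => (bexp k g + bexp k (fun i => g (S i))) / 2
  end.

Lemma binom_sum_S (m : nat) (g : nat -> R) :
  sum_f_R0 (fun i => Binomial.C (S m) i * g i) (S m)
  = sum_f_R0 (fun i => Binomial.C m i * g i) m
    + sum_f_R0 (fun i => Binomial.C m i * g (S i)) m.
Proof.
  destruct m as [|k].
  - simpl.
    unfold Binomial.C; simpl; field.
  - rewrite (tech5 _ (S k)), (decomp_sum _ (S k)) by lia.
    rewrite (decomp_sum (fun i => Binomial.C (S k) i * g i) (S k)) by lia.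
    rewrite (tech5 (fun i => Binomial.C (S k) i * g (S i)) k).
    assert (Hn : forall q, Binomial.C q q = 1).
    { intro q. unfold Binomial.C. rewrite Nat.sub_diag. simpl. field. apply INR_fact_neq_0. }
    assert (H0 : forall q, Binomial.C q 0 = 1).
    { intro q. unfold Binomial.C. rewrite Nat.sub_0_r. simpl. field. apply INR_fact_neq_0. }
    rewrite !Hn, !H0. simpl pred.
    rewrite (sum_eq _ (fun i => Binomial.C (S k) (S i) * g (S i) + Binomial.C (S k) i * g (S i)) k).
    + rewrite sum_plus. ring.
    + intros i Hi. rewrite <- pascal by lia. ring.
Qed.

Lemma bexp_sum (m : nat) (g : nat -> R) :
  sum_f_R0 (fun i => Binomial.C m i / 2 ^ m * g i) m = bexp m g.
Proof.
  revert g; induction m as [|m IH]; intro g.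
  - simpl. unfold Binomial.C; simpl; field.
  - simpl bexp. rewrite <- !IH.
    rewrite (sum_eq _ (fun i => Binomial.C (S m) i * g i * / 2 ^ S m)) by (intros; unfold Rdiv; ring).
    rewrite <- scal_sum, binom_sum_S.
    rewrite (sum_eq (fun i => Binomial.C m i / 2 ^ m * g i) (fun i => Binomial.C m i * g i * / 2 ^ m))
      by (intros; unfold Rdiv; ring).
    rewrite (sum_eq (fun i => Binomial.C m i / 2 ^ m * g (S i)) (fun i => Binomial.C m i * g (S i) * / 2 ^ m))
      by (intros; unfold Rdiv; ring).
    rewrite <- !scal_sum. simpl. field. apply pow_nonzero; lra.
Qed.

Lemma bexp_ext (m : nat) (g k : nat -> R) :
  (forall i, g i = k i) -> bexp m g = bexp m k.
Proof.
  revert g k; induction m as [|m IH]; intros g k H; simpl; auto.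
  rewrite (IH g k), (IH (fun i => g (S i)) (fun i => k (S i))); auto.
Qed.

Lemma bexp_le (m : nat) (g k : nat -> R) :
  (forall i, g i <= k i) -> bexp m g <= bexp m k.
Proof.
  revert g k; induction m as [|m IH]; intros g k H; simpl; auto.
  assert (bexp m g <= bexp m k) by auto.
  assert (bexp m (fun i => g (S i)) <= bexp m (fun i => k (S i))) by auto.
  lra.
Qed.

Lemma bexp_lin (m : nat) (a b : R) (g k : nat -> R) :
  bexp m (fun i => a * g i + b * k i) = a * bexp m g + b * bexp m k.
Proof.
  revert g k; induction m as [|m IH]; intros g k; simpl; auto.
  rewrite IH, (IH (fun i => g (S i)) (fun i => k (S i))). field.
Qed.

Lemma bexp_const (m : nat) (c : R) : bexp m (fun _ => c) = c.
Proof. induction m as [|m IH]; simpl; auto. rewrite IH; field. Qed.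

Lemma bexp_minus (m : nat) (g k : nat -> R) :
  bexp m (fun i => g i - k i) = bexp m g - bexp m k.
Proof.
  rewrite (bexp_ext m _ (fun i => 1 * g i + (-1) * k i)) by (intro; ring).
  rewrite bexp_lin; ring.
Qed.

Lemma bexp_scal (m : nat) (a : R) (g : nat -> R) :
  bexp m (fun i => a * g i) = a * bexp m g.
Proof.
  rewrite (bexp_ext m _ (fun i => a * g i + 0 * g i)) by (intro; ring).
  rewrite bexp_lin; ring.
Qed.

Lemma bexp_abs_le (m : nat) (g k : nat -> R) :
  (forall i, Rabs (g i) <= k i) -> Rabs (bexp m g) <= bexp m k.
Proof.
  intro H. apply Rabs_le. split.
  - replace (- bexp m k) with (bexp m (fun i => (-1) * k i)) by (rewrite bexp_scal; ring).
    apply bexp_le. intro i. specialize (H i). apply Rabs_le_between in H. lra.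
  - apply bexp_le. intro i. specialize (H i). apply Rabs_le_between in H. lra.
Qed.

(** Binomial counterpart of Gaussian integration by parts. Here 2X - (m+1) is a sum of m+1 fair
    signs, and each sign xi satisfies E[xi phi(xi)] = (phi(1) - phi(-1))/2, which leaves the
    increment of g under the m other tosses. *)
Lemma bexp_stein (m : nat) (g : nat -> R) :
  bexp (S m) (fun i => (2 * INR i - INR (S m)) * g i)
  = INR (S m) / 2 * bexp m (fun i => g (S i) - g i).
Proof.
  revert g; induction m as [|m IH]; intro g.
  - simpl. field.
  - change (bexp (S (S m)) (fun i => (2 * INR i - INR (S (S m))) * g i))
      with ((bexp (S m) (fun i => (2 * INR i - INR (S (S m))) * g i)
             + bexp (S m) (fun i => (2 * INR (S i) - INR (S (S m))) * g (S i))) / 2).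
    rewrite (bexp_ext (S m) (fun i => (2 * INR i - INR (S (S m))) * g i)
       (fun i => 1 * ((2 * INR i - INR (S m)) * g i) + (-1) * g i))
      by (intro i; rewrite (S_INR (S m)); ring).
    rewrite (bexp_ext (S m) (fun i => (2 * INR (S i) - INR (S (S m))) * g (S i))
       (fun i => 1 * ((2 * INR i - INR (S m)) * g (S i)) + 1 * g (S i)))
      by (intro i; rewrite (S_INR (S m)), (S_INR i); ring).
    rewrite !bexp_lin, IH, (IH (fun i => g (S i))).
    change (bexp (S m) (fun i => g (S i) - g i))
      with ((bexp m (fun i => g (S i) - g i) + bexp m (fun i => g (S (S i)) - g (S i))) / 2).
    simpl bexp. rewrite !bexp_minus.
    rewrite (S_INR (S m)). field.
Qed.

Lemma fact_S_R (n : nat) : INR (fact (S n)) = (INR n + 1) * INR (fact n).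
Proof. rewrite fact_simpl, mult_INR, S_INR. ring. Qed.

(** Squaring keeps the induction free of square roots, and the factor 2a+1 makes it close: the step
    amounts to (2a+1)(2a+3) <= 4(a+1)^2. *)
Lemma choose_sq_le_diag (a : nat) :
  (INR (fact (a + a)) / (INR (fact a) * INR (fact a))) ^ 2 * INR (a + a + 1) <= 4 ^ (a + a).
Proof.
  induction a as [|a IH].
  - simpl. lra.
  - replace (S a + S a)%nat with (S (S (a + a))) by lia.
    replace (S (S (a + a)) + 1)%nat with (S (S (S (a + a)))) by lia.
    replace (a + a + 1)%nat with (S (a + a)) in IH by lia.
    rewrite !fact_S_R, !S_INR. rewrite S_INR in IH.
    rewrite plus_INR in *. pose proof (pos_INR a) as Ha.
    pose proof (INR_fact_neq_0 a) as Hf.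
    set (D := INR (fact (a + a)) / (INR (fact a) * INR (fact a))) in *.
    replace ((INR a + INR a + 1 + 1) * ((INR a + INR a + 1) * INR (fact (a + a))) /
      ((INR a + 1) * INR (fact a) * ((INR a + 1) * INR (fact a))))
      with (D * (2 * (2 * INR a + 1) / (INR a + 1))) by (unfold D; field; lra).
    assert (Hs : 4 ^ S (S (a + a)) = 16 * 4 ^ (a + a)) by (simpl; ring).
    rewrite Hs, Rpow_mult_distr.
    assert (Hq : (2 * (2 * INR a + 1) / (INR a + 1)) ^ 2 * (INR a + INR a + 1 + 1 + 1)
            <= 16 * (INR a + INR a + 1)).
    { replace ((2 * (2 * INR a + 1) / (INR a + 1)) ^ 2 * (INR a + INR a + 1 + 1 + 1))
        with (4 * (2 * INR a + 1) ^ 2 * (2 * INR a + 3) / (INR a + 1) ^ 2) by (field; lra).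
      apply Rle_div_l; [apply pow_lt; lra |].
      nra. }
    assert (0 <= D ^ 2) by apply pow2_ge_0.
    nra.
Qed.

(** Induction outwards from the central coefficient, k being the imbalance between the two block
    sizes. With m = 2b+k, the step amounts to (m+1)(m+2) <= 4(b+k+1)^2, true because 2(b+k+1) >=
    m+2. *)
Lemma choose_sq_le_up (b k : nat) :
  (INR (fact (b + k + b)) / (INR (fact (b + k)) * INR (fact b))) ^ 2 * INR (b + k + b + 1)
  <= 4 ^ (b + k + b).
Proof.
  induction k as [|k IH].
  - rewrite Nat.add_0_r. apply choose_sq_le_diag.
  - replace (b + S k + b)%nat with (S (b + k + b)) by lia.
    replace (S (b + k + b) + 1)%nat with (S (S (b + k + b))) by lia.
    replace (b + k + b + 1)%nat with (S (b + k + b)) in IH by lia.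
    replace (b + S k)%nat with (S (b + k)) by lia.
    rewrite !fact_S_R, !S_INR. rewrite S_INR in IH.
    set (D := INR (fact (b + k + b)) / (INR (fact (b + k)) * INR (fact b))) in *.
    pose proof (pos_INR b) as Hb. pose proof (pos_INR k) as Hk.
    rewrite !plus_INR in *.
    replace ((INR b + INR k + INR b + 1) * INR (fact (b + k + b)) /
       ((INR b + INR k + 1) * INR (fact (b + k)) * INR (fact b)))
      with (D * ((INR b + INR k + INR b + 1) / (INR b + INR k + 1)))
      by (unfold D; field; repeat split; try apply INR_fact_neq_0; lra).
    change (4 ^ S (b + k + b)) with (4 * 4 ^ (b + k + b)).
    rewrite Rpow_mult_distr.
    assert (Hq : ((INR b + INR k + INR b + 1) / (INR b + INR k + 1)) ^ 2 * (INR b + INR k + INR b + 1 + 1)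
            <= 4 * (INR b + INR k + INR b + 1)).
    { replace (((INR b + INR k + INR b + 1) / (INR b + INR k + 1)) ^ 2 * (INR b + INR k + INR b + 1 + 1))
        with ((INR b + INR k + INR b + 1) ^ 2 * (INR b + INR k + INR b + 2) / (INR b + INR k + 1) ^ 2)
        by (field; lra).
      apply Rle_div_l; [apply pow_lt; lra |].
      assert ((INR b + INR k + INR b + 1) * (INR b + INR k + INR b + 2) <= 4 * (INR b + INR k + 1) ^ 2) by nra.
      nra. }
    assert (0 <= D ^ 2) by apply pow2_ge_0.
    nra.
Qed.

Lemma choose_sq_le (m k : nat) :
  (k <= m)%nat -> (Binomial.C m k) ^ 2 * INR (m + 1) <= 4 ^ m.
Proof.
  intro Hk. unfold Binomial.C.
  destruct (Nat.le_ge_cases k (m - k)) as [H|H].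
  - pose proof (choose_sq_le_up k (m - k - k)) as P.
    replace (k + (m - k - k) + k)%nat with m in P by lia.
    replace (k + (m - k - k))%nat with (m - k)%nat in P by lia.
    now rewrite (Rmult_comm (INR (fact k))).
  - pose proof (choose_sq_le_up (m - k) (k - (m - k))) as P.
    replace (m - k + (k - (m - k)) + (m - k))%nat with m in P by lia.
    now replace (m - k + (k - (m - k)))%nat with k in P by lia.
Qed.

Lemma binom_pmf_le (m k : nat) :
  (k <= m)%nat -> Binomial.C m k / 2 ^ m <= / sqrt (INR (S m)).
Proof.
  intro Hk. pose proof (choose_sq_le m k Hk) as H.
  rewrite Nat.add_1_r in H.
  assert (Hm : 0 < INR (S m)) by (apply lt_0_INR; lia).
  assert (Hs : 0 < sqrt (INR (S m))) by (apply sqrt_lt_R0; auto).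
  assert (Ht : 0 < 2 ^ m) by (apply pow_lt; lra).
  apply Rsqr_incr_0_var; [|left; apply Rinv_0_lt_compat; auto].
  unfold Rsqr.
  replace (/ sqrt (INR (S m)) * / sqrt (INR (S m))) with (/ INR (S m))
    by (rewrite <- Rinv_mult, sqrt_sqrt; lra).
  replace (Binomial.C m k / 2 ^ m * (Binomial.C m k / 2 ^ m)) with ((Binomial.C m k) ^ 2 / 4 ^ m).
  2:{ replace 4 with (2 * 2) by ring. rewrite Rpow_mult_distr. field. lra. }
  assert (0 < 4 ^ m) by (apply pow_lt; lra).
  apply Rle_div_l; auto.
  replace (/ INR (S m) * 4 ^ m) with (4 ^ m / INR (S m)) by (unfold Rdiv; ring).
  apply (proj1 (Rle_div_r (Binomial.C m k ^ 2) (4 ^ m) (INR (S m)) Hm)); auto.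
Qed.

(** Every binomial weight is at most 1/sqrt(m+1), and the nonnegative decrements of g telescope to
    at most 1. *)
Lemma bexp_telescope_le (m : nat) (g : nat -> R) :
  (forall i, g (S i) <= g i) -> (forall i, 0 <= g i <= 1) ->
  bexp m (fun i => g i - g (S i)) <= / sqrt (INR (S m)).
Proof.
  intros Hd Hb. rewrite <- bexp_sum.
  assert (Hs : 0 < / sqrt (INR (S m)))
    by (apply Rinv_0_lt_compat, sqrt_lt_R0, lt_0_INR; lia).
  apply Rle_trans with (sum_f_R0 (fun i => (g i - g (S i)) * / sqrt (INR (S m))) m).
  - apply sum_Rle. intros i Hi. rewrite Rmult_comm.
    apply Rmult_le_compat_l; [specialize (Hd i); lra |].
    now apply binom_pmf_le.
  - rewrite <- scal_sum.
    assert (Ht : forall q, sum_f_R0 (fun i => g i - g (S i)) q = g O - g (S q)).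
    { induction q as [|q IH]; simpl; [ring|rewrite IH; ring]. }
    rewrite Ht. pose proof (Hb O). pose proof (Hb (S m)). nra.
Qed.

Definition std_point (m i : nat) : R := (2 * INR i - INR m) / sqrt (INR m).

Lemma std_point_eq (m i : nat) :
  (0 < m)%nat -> (INR i - INR m / 2) / sqrt (INR m / 4) = std_point m i.
Proof.
  intro Hm. assert (0 < INR m) by (apply lt_0_INR; auto).
  assert (0 < sqrt (INR m)) by (apply sqrt_lt_R0; auto).
  rewrite sqrt_div_alt by lra. replace (sqrt 4) with 2.
  - unfold std_point. field. lra.
  - replace 4 with (2 * 2) by ring. rewrite sqrt_square; lra.
Qed.

Lemma EW_bexp (m n : nat) (h : R -> R) : (0 < m)%nat -> (0 < n)%nat ->
  EW m n h = bexp m (fun i => bexp n (fun j => h (std_point m i * std_point n j))).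
Proof.
  intros Hm Hn. unfold EW. rewrite <- bexp_sum. apply sum_eq. intros i _.
  rewrite <- bexp_sum, scal_sum. apply sum_eq. intros j _.
  unfold pXY, Wval. rewrite !std_point_eq by auto.
  rewrite pow_add. field. split; apply pow_nonzero; lra.
Qed.

(** The variance comes from [bexp_stein] with g equal to the centred count itself, whose increments
    are constantly 2. *)
Lemma bexp_std_sq (m : nat) :
  bexp (S m) (fun i => std_point (S m) i * std_point (S m) i) = 1.
Proof.
  assert (H : 0 < INR (S m)) by (apply lt_0_INR; lia).
  assert (Hs : 0 < sqrt (INR (S m))) by (apply sqrt_lt_R0; auto).
  rewrite (bexp_ext _ _ (fun i => / INR (S m) * ((2 * INR i - INR (S m)) * (2 * INR i - INR (S m))))).
  - rewrite bexp_scal, bexp_stein.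
    rewrite (bexp_ext _ _ (fun _ => 2)) by (intro i; rewrite (S_INR i); ring).
    rewrite bexp_const. field. lra.
  - intro i. unfold std_point.
    replace (/ INR (S m)) with (/ (sqrt (INR (S m)) * sqrt (INR (S m)))) by (rewrite sqrt_sqrt; lra).
    field. lra.
Qed.

Lemma bexp_std_abs_le (m : nat) : (0 < m)%nat -> bexp m (fun i => Rabs (std_point m i)) <= 1.
Proof.
  intro Hm. destruct m as [|m]; [lia|].
  apply Rle_trans with (bexp (S m) (fun i => (1/2) * (std_point (S m) i * std_point (S m) i) + (1/2) * 1)).
  - apply bexp_le. intro i. set (x := std_point (S m) i).
    assert (x * x = Rabs x * Rabs x) by (rewrite <- Rabs_mult, Rabs_pos_eq; nra).
    pose proof (Rle_0_sqr (Rabs x - 1)) as P; unfold Rsqr in P. lra.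
  - rewrite bexp_lin, bexp_std_sq, bexp_const. lra.
Qed.

(** * Error in Stein's equation under the binomial distribution *)

Lemma is_derive_MVT (f df : R -> R) (a b : R) :
  (forall x, is_derive f x (df x)) -> a <= b ->
  exists c, a <= c <= b /\ f b - f a = df c * (b - a).
Proof.
  intros H Hab.
  destruct (MVT_gen f a b df) as [c [Hc Hf]].
  - intros; apply H.
  - intros x _. apply continuity_pt_filterlim.
    apply (ex_derive_continuous f x). exists (df x). apply H.
  - rewrite Rmin_left, Rmax_right in Hc by auto. now exists c.
Qed.

Section SteinError.

(** Stein's equation f' = x f + h - c is built into the hypotheses: f' is always written as the
    right-hand side, so [df_bound] is a bound on f'. *)
Variables (h f : R -> R) (c B0 B1 : R).
Hypothesis f_stein : forall x, is_derive f x (x * f x + h x - c).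
Hypothesis f_bound : forall x, Rabs (f x) <= B0.
Hypothesis df_bound : forall x, Rabs (x * f x + h x - c) <= B1.

Lemma stein_xf_diff (a d x y : R) : 0 <= d -> a - d <= x <= a + d -> a - d <= y <= a + d ->
  Rabs (x * f x - y * f y) <= 2 * d * (B0 + (Rabs a + d) * B1).
Proof.
  intros Hd.
  assert (key : forall x y, a - d <= x <= a + d -> a - d <= y <= a + d -> x <= y ->
     Rabs (x * f x - y * f y) <= 2 * d * (B0 + (Rabs a + d) * B1)).
  { clear x y. intros x y Hx Hy Hxy.
    destruct (is_derive_MVT (fun t => t * f t) (fun t => f t + t * (t * f t + h t - c)) x y)
      as [e [He Hf]]; auto.
    - intro t. evar_last.
      + apply (is_derive_mult (fun t => t) f t 1 (t * f t + h t - c)).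
        * apply (is_derive_id t).
        * apply f_stein.
        * intros; apply Rmult_comm.
      + unfold plus, mult; simpl. ring.
    - rewrite Rabs_minus_sym, Hf, Rabs_mult.
      assert (Hl : Rabs (f e + e * (e * f e + h e - c)) <= B0 + (Rabs a + d) * B1).
      { eapply Rle_trans; [apply Rabs_triang|]. apply Rplus_le_compat; [apply f_bound|].
        rewrite Rabs_mult. apply Rmult_le_compat; try apply Rabs_pos; auto.
        replace e with (a + (e - a)) by ring. eapply Rle_trans; [apply Rabs_triang|].
        apply Rplus_le_compat_l. apply Rabs_le. lra. }
      rewrite Rmult_comm. apply Rmult_le_compat; try apply Rabs_pos; auto.
      rewrite Rabs_pos_eq; lra. }
  intros Hx Hy. destruct (Rle_or_lt x y) as [H|H]; [now apply key|].
  rewrite Rabs_minus_sym. apply key; lra.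
Qed.

(** Since h is merely continuous there is no second derivative of f to expand with. The difference
    quotient is f'(e) for some e in the window, and Stein's equation turns f'(a-d) - f'(e) and
    f'(a+d) - f'(e) into increments of x f(x), bounded by [stein_xf_diff], plus increments of h,
    collected in [o]. *)
Lemma stein_point_error (a d o : R) : 0 < d ->
  (forall e, a - d <= e <= a + d -> Rabs ((h (a - d) + h (a + d)) / 2 - h e) <= o) ->
  Rabs (((a - d) * f (a - d) + h (a - d) - c + ((a + d) * f (a + d) + h (a + d) - c)) / 2
        - (f (a + d) - f (a - d)) / (2 * d))
  <= 2 * d * (B0 + (Rabs a + d) * B1) + o.
Proof.
  intros Hd Ho.
  destruct (is_derive_MVT f (fun x => x * f x + h x - c) (a - d) (a + d)) as [e [He Hf]]; auto; [lra|].
  rewrite Hf. specialize (Ho e He).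
  pose proof (stein_xf_diff a d (a - d) e) as H1.
  pose proof (stein_xf_diff a d (a + d) e) as H2.
  replace (((a - d) * f (a - d) + h (a - d) - c + ((a + d) * f (a + d) + h (a + d) - c)) / 2
        - (e * f e + h e - c) * (a + d - (a - d)) / (2 * d))
    with ((((a - d) * f (a - d) - e * f e) + ((a + d) * f (a + d) - e * f e)) / 2
          + ((h (a - d) + h (a + d)) / 2 - h e)) by (field; lra).
  apply Rabs_le_between in Ho.
  assert (Q1 := H1 ltac:(lra) ltac:(lra) He). apply Rabs_le_between in Q1.
  assert (Q2 := H2 ltac:(lra) ltac:(lra) He). apply Rabs_le_between in Q2.
  apply Rabs_le. lra.
Qed.

(** Summing the pointwise error 2d(B0 + (|a|+d) B1) + o over the midpoints a, with d = 1/sqrt(m+1)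
    <= 1 and E|a| <= 1, gives 2d(B0 + 2 B1) plus the mean of o. *)
Lemma stein_bexp_error (m : nat) (o : nat -> R) :
  (forall k e, std_point (S m) k <= e <= std_point (S m) (S k) ->
     Rabs ((h (std_point (S m) k) + h (std_point (S m) (S k))) / 2 - h e) <= o k) ->
  Rabs (bexp (S m) (fun i => h (std_point (S m) i)) - c)
  <= / sqrt (INR (S m)) * (2 * B0 + 4 * B1) + bexp m o.
Proof.
  intro Ho.
  assert (Hm : 0 < INR (S m)) by (apply lt_0_INR; lia).
  assert (Hm1 : 1 <= INR (S m)) by (rewrite S_INR; pose proof (pos_INR m); lra).
  assert (Hs : 0 < sqrt (INR (S m))) by (apply sqrt_lt_R0; auto).
  assert (Hss : sqrt (INR (S m)) * sqrt (INR (S m)) = INR (S m)) by (apply sqrt_sqrt; lra).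
  assert (Hs1 : 1 <= sqrt (INR (S m))) by (rewrite <- sqrt_1; apply sqrt_le_1_alt; auto).
  set (s := sqrt (INR (S m))) in *.
  set (d := / s).
  assert (Hd : 0 < d) by (apply Rinv_0_lt_compat; auto).
  assert (Hd1 : d <= 1) by (unfold d; rewrite <- Rinv_1; apply Rinv_le_contravar; lra).
  assert (HB0 : 0 <= B0) by (eapply Rle_trans; [apply Rabs_pos | apply (f_bound 0)]).
  assert (HB1 : 0 <= B1) by (eapply Rle_trans; [apply Rabs_pos | apply (df_bound 0)]).
  set (x := std_point (S m)) in *.
  (* Midpoints of consecutive lattice points, which lie at distance d on either side. *)
  set (a := fun k => (2 * INR k - INR m) / s).
  assert (Hx0 : forall k, x k = a k - d).
  { intro k. unfold x, a, d, std_point. fold s. rewrite (S_INR m). field. lra. }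
  assert (Hx1 : forall k, x (S k) = a k + d).
  { intro k. unfold x, a, d, std_point. fold s. rewrite (S_INR m), (S_INR k). field. lra. }
  (* E h(A) - c is E(f'(A) - A f(A)). Conditioning f'(A) on one toss averages it over the two ends
     of a window, and [bexp_stein] makes E[A f(A)] the mean difference quotient over the same
     windows. *)
  assert (E : bexp (S m) (fun i => h (x i)) - c
    = bexp m (fun k => (((a k - d) * f (a k - d) + h (a k - d) - c
         + ((a k + d) * f (a k + d) + h (a k + d) - c)) / 2
        - (f (a k + d) - f (a k - d)) / (2 * d)))).
  { rewrite bexp_minus.
    rewrite (bexp_ext m _ (fun k => (1/2) * (x k * f (x k) + h (x k) - c)
               + (1/2) * (x (S k) * f (x (S k)) + h (x (S k)) - c))).
    2:{ intro k. rewrite Hx1, Hx0. field. }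
    rewrite bexp_lin.
    rewrite (bexp_ext m (fun k => (f (a k + d) - f (a k - d)) / (2 * d))
               (fun k => / (2 * d) * (f (x (S k)) - f (x k)))).
    2:{ intro k. rewrite Hx1, Hx0. field. lra. }
    rewrite bexp_scal.
    pose proof (bexp_stein m (fun i => f (x i))) as St.
    assert (S1 : bexp (S m) (fun i => x i * f (x i))
       = / (2 * d) * bexp m (fun i => f (x (S i)) - f (x i))).
    { rewrite (bexp_ext (S m) _ (fun i => / s * ((2 * INR i - INR (S m)) * f (x i)))).
      - rewrite bexp_scal, St, <- Hss. unfold d. field. lra.
      - intro i. unfold x at 1, std_point. fold s. field. lra. }
    rewrite <- S1.
    assert (S2 : 1/2 * bexp m (fun k => x k * f (x k) + h (x k) - c)
      + 1/2 * bexp m (fun k => x (S k) * f (x (S k)) + h (x (S k)) - c)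
      = bexp (S m) (fun i => x i * f (x i) + h (x i) - c)) by (simpl; field).
    rewrite S2.
    rewrite (bexp_ext (S m) (fun i => x i * f (x i) + h (x i) - c)
       (fun i => 1 * (x i * f (x i)) + 1 * (h (x i) - c))) by (intro; ring).
    rewrite bexp_lin, bexp_minus, bexp_const. ring. }
  rewrite E.
  apply Rle_trans with (bexp m (fun k => 1 * (2 * d * (B0 + d * B1) + 2 * d * B1 * Rabs (a k)) + 1 * o k)).
  - apply bexp_abs_le. intro k.
    eapply Rle_trans; [apply (stein_point_error (a k) d (o k)); auto|].
    + intros e He. rewrite <- Hx1, <- Hx0. apply Ho. rewrite Hx1, Hx0. lra.
    + right. ring.
  - rewrite bexp_lin.
    rewrite (bexp_ext m (fun k => 2 * d * (B0 + d * B1) + 2 * d * B1 * Rabs (a k))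
      (fun k => (2 * d * (B0 + d * B1)) * 1 + (2 * d * B1) * Rabs (a k))) by (intro; ring).
    rewrite bexp_lin, bexp_const.
    (* The midpoints are the centred counts of m tosses divided by sqrt(m+1) rather than sqrt m,
       hence no larger in absolute value than [std_point m]. For m = 0 the only midpoint is 0. *)
    assert (Ha : bexp m (fun k => Rabs (a k)) <= 1).
    { destruct m as [|q].
      - simpl. unfold a. simpl. rewrite Rmult_0_r, Rminus_0_r. unfold Rdiv. rewrite Rmult_0_l, Rabs_R0. lra.
      - apply Rle_trans with (bexp (S q) (fun k => Rabs (std_point (S q) k))); [|apply bexp_std_abs_le; lia].
        apply bexp_le. intro k. unfold a, std_point, Rdiv. rewrite !Rabs_mult.
        apply Rmult_le_compat_l; [apply Rabs_pos|].
        assert (0 < sqrt (INR (S q))) by (apply sqrt_lt_R0, lt_0_INR; lia).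
        rewrite !Rabs_pos_eq by (left; apply Rinv_0_lt_compat; auto).
        apply Rinv_le_contravar; auto. apply sqrt_le_1_alt. rewrite (S_INR (S q)). lra. }
    assert (2 * d * B1 * bexp m (fun k => Rabs (a k)) <= 2 * d * B1 * 1).
    { apply Rmult_le_compat_l; auto. nra. }
    assert (d * B1 * d <= d * B1 * 1).
    { apply Rmult_le_compat_l; auto. nra. }
    nra.
Qed.

End SteinError.

(** * Improper integrals of exponentially dominated functions *)

Lemma exp_neg_le_inv (v : R) : 0 < v -> exp (- v) <= / v.
Proof.
  intro Hv. rewrite exp_Ropp. apply Rinv_le_contravar; auto.
  pose proof (exp_ineq1_le v). lra.
Qed.

Lemma RInt_abs_le_primitive (f G dG : R -> R) (a b : R) :
  a <= b -> ex_RInt f a b ->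
  (forall x, a <= x <= b -> is_derive G x (dG x)) ->
  (forall x, a <= x <= b -> continuous dG x) ->
  (forall x, a <= x <= b -> Rabs (f x) <= dG x) ->
  Rabs (RInt f a b) <= G b - G a.
Proof.
  intros Hab Hf HG HdG H.
  apply (norm_RInt_le f dG a b (RInt f a b) (G b - G a)); auto.
  - apply (RInt_correct (V := R_CompleteNormedModule) f a b); auto.
  - apply (is_RInt_derive G dG a b); intros x Hx;
      rewrite Rmin_left, Rmax_right in Hx by auto; auto.
Qed.

(** Only x > 0 is constrained, because the kernels below contain 1/y. One constant K controls both
    ends: the mass of (0, a) is at most K a and the mass beyond b at most K exp(-b). *)
Definition exp_dominated (K : R) (f : R -> R) : Prop :=
  forall x, 0 < x -> continuous f x /\ Rabs (f x) <= K * exp (- x).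

Definition cut_int (f : R -> R) (n : nat) : R := RInt f (/ (INR n + 1)) (INR n + 1).

(* The integral of [f] over [(0, +oo)], as the limit along [(1/(n+1), n+1)]. *)
Definition int_pos (f : R -> R) : R := real (Lim_seq (cut_int f)).

Lemma cut_bounds (n : nat) : 0 < / (INR n + 1) <= INR n + 1.
Proof.
  pose proof (pos_INR n). split.
  - apply Rinv_0_lt_compat; lra.
  - apply Rle_trans with 1; [|lra]. rewrite <- Rinv_1. apply Rinv_le_contravar; lra.
Qed.

Lemma cut_eventually (e : R) : 0 < e ->
  exists N, forall n, (N <= n)%nat -> / (INR n + 1) <= e /\ / e <= INR n + 1.
Proof.
  intro He. destruct (nfloor_ex (/ e)) as [N HN].
  - left; apply Rinv_0_lt_compat; auto.
  - exists N. intros n Hn. apply le_INR in Hn.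
    assert (0 < / e) by (apply Rinv_0_lt_compat; auto).
    split; [|lra].
    rewrite <- (Rinv_inv e). apply Rinv_le_contravar; lra.
Qed.

Lemma exp_dominated_K_pos (K : R) (f : R -> R) : exp_dominated K f -> 0 <= K.
Proof.
  intro H. destruct (H 1 Rlt_0_1) as [_ H1].
  pose proof (Rabs_pos (f 1)). pose proof (exp_pos (Ropp 1)).
  apply (Rmult_le_reg_r (exp (Ropp 1))); lra.
Qed.

Lemma exp_dominated_ex_RInt (K : R) (f : R -> R) (a b : R) :
  exp_dominated K f -> 0 < a -> 0 < b -> ex_RInt f a b.
Proof.
  intros H Ha Hb. apply (ex_RInt_continuous f). intros z Hz.
  apply H. assert (0 < Rmin a b) by (apply Rmin_glb_lt; auto). lra.
Qed.

Lemma exp_dominated_RInt_le (K : R) (f : R -> R) (a b : R) :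
  exp_dominated K f -> 0 < a <= b -> Rabs (RInt f a b) <= K * (exp (- a) - exp (- b)).
Proof.
  intros H Hab.
  replace (K * (exp (- a) - exp (- b))) with (- K * exp (- b) - - K * exp (- a)) by ring.
  apply (RInt_abs_le_primitive f (fun x => - K * exp (- x)) (fun x => K * exp (- x))); try lra.
  - apply (exp_dominated_ex_RInt K); auto; lra.
  - intros x Hx. auto_derive; auto. ring.
  - intros x Hx. apply (ex_derive_continuous (fun x => K * exp (- x))). auto_derive; auto.
  - intros x Hx. apply H. lra.
Qed.

Lemma exp_dominated_tail (K : R) (f : R -> R) (a b a' b' : R) :
  exp_dominated K f -> 0 < a' <= a -> a <= b -> b <= b' ->
  Rabs (RInt f a' b' - RInt f a b) <= K * (a + exp (- b)).
Proof.
  intros H Ha Hab Hb.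
  rewrite <- (RInt_Chasles f a' a b'), <- (RInt_Chasles f a b b');
    try (apply (exp_dominated_ex_RInt K); auto; lra).
  unfold plus; simpl.
  replace (RInt f a' a + (RInt f a b + RInt f b b') - RInt f a b)
    with (RInt f a' a + RInt f b b') by ring.
  eapply Rle_trans; [apply Rabs_triang|].
  assert (H1 := exp_dominated_RInt_le K f a' a H ltac:(lra)).
  assert (H2 := exp_dominated_RInt_le K f b b' H ltac:(lra)).
  pose proof (exp_dominated_K_pos K f H) as HK.
  pose proof (exp_ineq1_le (- a)). pose proof (exp_pos (- b')).
  assert (exp (- a') <= 1) by (rewrite <- exp_0; left; apply exp_increasing; lra).
  assert (K * (exp (- a') - exp (- a)) <= K * a) by (apply Rmult_le_compat_l; lra).
  assert (K * (exp (- b) - exp (- b')) <= K * exp (- b)) by (apply Rmult_le_compat_l; lra).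
  lra.
Qed.

Lemma cut_int_lim (K : R) (f : R -> R) :
  exp_dominated K f -> is_lim_seq (cut_int f) (int_pos f).
Proof.
  intro H. unfold int_pos.
  assert (E : ex_finite_lim_seq (cut_int f)).
  { apply ex_lim_seq_cauchy_corr. intro eps.
    pose proof (exp_dominated_K_pos K f H) as HK.
    assert (He : 0 < eps / (4 * (K + 1))).
    { apply Rdiv_lt_0_compat; [apply cond_pos | lra]. }
    destruct (cut_eventually _ He) as [N HN].
    assert (key : forall n m, (N <= n)%nat -> (n <= m)%nat -> Rabs (cut_int f m - cut_int f n) < eps).
    { intros n m Hn Hm. destruct (HN n Hn) as [H1 H2].
      destruct (cut_bounds n) as [B1 B2]. destruct (cut_bounds m) as [B3 B4].
      assert (INR n <= INR m) by (apply le_INR; auto).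
      pose proof (pos_INR n).
      eapply Rle_lt_trans.
      - apply (exp_dominated_tail K f); auto; try lra.
        split; auto. apply Rinv_le_contravar; lra.
      - assert (exp (- (INR n + 1)) <= / (INR n + 1)) by (apply exp_neg_le_inv; lra).
        apply Rle_lt_trans with (K * (2 * (eps / (4 * (K + 1))))).
        + apply Rmult_le_compat_l; lra.
        + pose proof (cond_pos eps).
          replace (K * (2 * (eps / (4 * (K + 1))))) with (eps * (K / (2 * (K + 1)))) by (field; lra).
          assert (K / (2 * (K + 1)) < 1) by (apply Rlt_div_l; lra). nra. }
    exists N. intros n m Hn Hm. destruct (Nat.le_ge_cases n m) as [L|L].
    - rewrite Rabs_minus_sym. apply key; auto.
    - apply key; auto. }
  apply Lim_seq_correct' in E. exact E.
Qed.

Lemma is_lim_seq_ext_unique (u v : nat -> R) (l l' : R) :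
  is_lim_seq u l -> is_lim_seq v l' -> (forall n, u n = v n) -> l = l'.
Proof.
  intros H1 H2 E. apply (is_lim_seq_ext u v) in H1; auto.
  apply is_lim_seq_unique in H1. apply is_lim_seq_unique in H2.
  rewrite H1 in H2. now injection H2.
Qed.

(** The error depends on f only through K. This uniformity justifies all later exchanges of
    limits. *)
Lemma int_pos_close (K : R) (f : R -> R) (a b : R) :
  exp_dominated K f -> 0 < a <= b -> Rabs (RInt f a b - int_pos f) <= K * (a + exp (- b)).
Proof.
  intros H Hab. apply le_epsilon. intros e He.
  pose proof (cut_int_lim K f H) as L. apply is_lim_seq_spec in L.
  destruct (L (mkposreal e He)) as [N HN]. simpl in HN.
  destruct (cut_eventually a (proj1 Hab)) as [N1 HN1].
  assert (Hb : 0 < / b) by (apply Rinv_0_lt_compat; lra).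
  destruct (cut_eventually (/ b) Hb) as [N2 HN2]. rewrite Rinv_inv in HN2.
  set (n := (N + N1 + N2)%nat).
  assert (P1 := HN n ltac:(lia)). assert (P2 := HN1 n ltac:(lia)). assert (P3 := HN2 n ltac:(lia)).
  pose proof (cut_bounds n) as B.
  assert (T := exp_dominated_tail K f a b (/ (INR n + 1)) (INR n + 1) H ltac:(lra) ltac:(lra) ltac:(lra)).
  unfold cut_int in P1.
  apply Rabs_le_between in T. apply Rabs_lt_between in P1. apply Rabs_le. lra.
Qed.

Lemma int_pos_ext (f g : R -> R) : (forall x, 0 < x -> f x = g x) -> int_pos f = int_pos g.
Proof.
  intro H. unfold int_pos. f_equal. apply Lim_seq_ext. intro n.
  apply (RInt_ext f g). intros x Hx. apply H.
  destruct (cut_bounds n). rewrite Rmin_left in Hx by auto. lra.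
Qed.

Lemma exp_dominated_ext (K : R) (f g : R -> R) :
  (forall x, f x = g x) -> exp_dominated K f -> exp_dominated K g.
Proof.
  intros E H x Hx. destruct (H x Hx) as [H1 H2]. split.
  - apply (continuous_ext f g); auto.
  - rewrite <- E; auto.
Qed.

Lemma exp_dominated_le (K K' : R) (f : R -> R) :
  K <= K' -> exp_dominated K f -> exp_dominated K' f.
Proof.
  intros E H x Hx. destruct (H x Hx) as [H1 H2]. split; auto.
  pose proof (exp_pos (- x)). nra.
Qed.

Lemma exp_dominated_lin (a b K K' : R) (f g : R -> R) :
  exp_dominated K f -> exp_dominated K' g ->
  exp_dominated (Rabs a * K + Rabs b * K') (fun x => a * f x + b * g x).
Proof.
  intros Hf Hg x Hx. destruct (Hf x Hx) as [F1 F2], (Hg x Hx) as [G1 G2]. split.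
  - apply (continuous_plus (fun x => a * f x) (fun x => b * g x)).
    + apply (continuous_scal_r a f); auto.
    + apply (continuous_scal_r b g); auto.
  - eapply Rle_trans; [apply Rabs_triang|]. rewrite !Rabs_mult.
    pose proof (Rabs_pos a). pose proof (Rabs_pos b). nra.
Qed.

Lemma int_pos_lin (a b K K' : R) (f g : R -> R) :
  exp_dominated K f -> exp_dominated K' g ->
  int_pos (fun x => a * f x + b * g x) = a * int_pos f + b * int_pos g.
Proof.
  intros Hf Hg.
  apply (is_lim_seq_ext_unique (cut_int (fun x => a * f x + b * g x))
           (fun n => a * cut_int f n + b * cut_int g n)).
  - apply (cut_int_lim _ _ (exp_dominated_lin a b K K' f g Hf Hg)).
  - apply is_lim_seq_plus'; apply (is_lim_seq_scal_l _ _ (Finite _));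
      eapply cut_int_lim; eauto.
  - intro n. unfold cut_int. destruct (cut_bounds n) as [B1 B2].
    assert (Ef : ex_RInt f (/ (INR n + 1)) (INR n + 1))
      by (apply (exp_dominated_ex_RInt K); auto; lra).
    assert (Eg : ex_RInt g (/ (INR n + 1)) (INR n + 1))
      by (apply (exp_dominated_ex_RInt K'); auto; lra).
    rewrite (RInt_plus (fun x => a * f x) (fun x => b * g x)).
    + rewrite (RInt_scal f _ _ a), (RInt_scal g _ _ b) by auto. reflexivity.
    + apply (ex_RInt_scal f); auto.
    + apply (ex_RInt_scal g); auto.
Qed.

Lemma exp_dominated_scal (a K : R) (f : R -> R) :
  exp_dominated K f -> exp_dominated (Rabs a * K) (fun x => a * f x).
Proof.
  intro H. pose proof (exp_dominated_lin a 0 K K f f H H) as L.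
  rewrite Rabs_R0, Rmult_0_l, Rplus_0_r in L.
  eapply exp_dominated_ext; [|apply L]. intro; simpl; ring.
Qed.

Lemma int_pos_scal (a K : R) (f : R -> R) :
  exp_dominated K f -> int_pos (fun x => a * f x) = a * int_pos f.
Proof.
  intro H. rewrite (int_pos_ext _ (fun x => a * f x + 0 * f x)) by (intros; ring).
  rewrite (int_pos_lin a 0 K K); auto. ring.
Qed.

Lemma int_pos_minus (K K' : R) (f g : R -> R) :
  exp_dominated K f -> exp_dominated K' g ->
  int_pos (fun x => f x - g x) = int_pos f - int_pos g.
Proof.
  intros Hf Hg. rewrite (int_pos_ext _ (fun x => 1 * f x + (-1) * g x)) by (intros; ring).
  rewrite (int_pos_lin 1 (-1) K K'); auto. ring.
Qed.

Lemma int_pos_bound (K B : R) (f : R -> R) :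
  exp_dominated K f -> (forall a b, 0 < a <= b -> Rabs (RInt f a b) <= B) ->
  Rabs (int_pos f) <= B.
Proof.
  intros H HB. pose proof (cut_int_lim K f H) as L.
  assert (HB' : forall n, - B <= cut_int f n <= B).
  { intro n. apply Rabs_le_between. apply HB, cut_bounds. }
  apply Rabs_le. split.
  - apply (is_lim_seq_le (fun _ => - B) (cut_int f) (- B) (int_pos f)); auto.
    + intro n; apply HB'.
    + apply is_lim_seq_const.
  - apply (is_lim_seq_le (cut_int f) (fun _ => B) (int_pos f) B); auto.
    + intro n; apply HB'.
    + apply is_lim_seq_const.
Qed.

Lemma int_pos_le (K K' : R) (f g : R -> R) :
  exp_dominated K f -> exp_dominated K' g -> (forall x, 0 < x -> f x <= g x) ->
  int_pos f <= int_pos g.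
Proof.
  intros Hf Hg H.
  apply (is_lim_seq_le (cut_int f) (cut_int g) (int_pos f) (int_pos g)).
  - intro n. destruct (cut_bounds n). apply RInt_le; auto.
    + apply (exp_dominated_ex_RInt K); auto; lra.
    + apply (exp_dominated_ex_RInt K'); auto; lra.
    + intros x Hx. apply H. lra.
  - eapply cut_int_lim; eauto.
  - eapply cut_int_lim; eauto.
Qed.

(** Meant for integrands that are small only away from 0: below eta the crude constant K is paid on
    a short interval, above eta the sharp constant e. *)
Lemma int_pos_small (K e eta : R) (f : R -> R) :
  0 < eta -> 0 <= e -> exp_dominated K f ->
  (forall y, eta <= y -> Rabs (f y) <= e * exp (- y)) ->
  Rabs (int_pos f) <= K * eta + e.
Proof.
  intros Heta He H Hs. pose proof (exp_dominated_K_pos K f H) as HK.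
  assert (Q1 : forall a b, 0 < a <= b -> b <= eta -> Rabs (RInt f a b) <= K * eta).
  { intros a b Hab Hb. eapply Rle_trans; [apply (exp_dominated_RInt_le K); auto|].
    apply Rmult_le_compat_l; auto.
    assert (exp (- a) <= 1) by (rewrite <- exp_0; left; apply exp_increasing; lra).
    pose proof (exp_ineq1_le (- b)). lra. }
  assert (Q2 : forall a b, eta <= a <= b -> Rabs (RInt f a b) <= e).
  { intros a b Hab.
    eapply Rle_trans.
    - apply (RInt_abs_le_primitive f (fun x => - e * exp (- x)) (fun x => e * exp (- x))); try lra.
      + apply (exp_dominated_ex_RInt K); auto; lra.
      + intros x Hx. auto_derive; auto. ring.
      + intros x Hx. apply (ex_derive_continuous (fun x => e * exp (- x))). auto_derive; auto.
      + intros x Hx. apply Hs. lra.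
    - assert (exp (- a) <= 1) by (rewrite <- exp_0; left; apply exp_increasing; lra).
      pose proof (exp_pos (- b)). nra. }
  apply (int_pos_bound K); auto. intros a b Hab.
  assert (0 <= K * eta) by nra.
  destruct (Rle_or_lt b eta) as [L|L].
  { eapply Rle_trans; [apply Q1; auto|]. lra. }
  destruct (Rle_or_lt eta a) as [L'|L'].
  { eapply Rle_trans; [apply Q2; lra|]. lra. }
  rewrite <- (RInt_Chasles f a eta b); try (apply (exp_dominated_ex_RInt K); auto; lra).
  eapply Rle_trans; [apply Rabs_triang|]. apply Rplus_le_compat; [apply Q1|apply Q2]; lra.
Qed.

(** * Integrals depending on a parameter *)

Lemma continuous_eps (f : R -> R) (x : R) :
  (forall eps, 0 < eps -> exists d, 0 < d /\ forall y, Rabs (y - x) < d -> Rabs (f y - f x) < eps) ->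
  continuous f x.
Proof.
  intro H. apply (filterlim_locally f (f x)). intro eps.
  destruct (H eps (cond_pos eps)) as [d [Hd H1]].
  exists (mkposreal d Hd). intros y Hy. apply H1. exact Hy.
Qed.

Lemma continuity_2d_pt_slice (F : R -> R -> R) (u y : R) :
  continuity_2d_pt F u y -> continuous (fun v => F u v) y.
Proof.
  intro H. apply continuous_eps. intros e He.
  destruct (H (mkposreal e He)) as [d Hd]. exists d. split; [apply cond_pos|].
  intros v Hv. apply (Hd u v); auto. rewrite Rminus_diag, Rabs_R0. apply cond_pos.
Qed.

Lemma continuity_2d_pt_swap (F : R -> R -> R) (u y : R) :
  continuity_2d_pt F u y -> continuity_2d_pt (fun y u => F u y) y u.
Proof.
  intros H e. destruct (H e) as [d Hd]. exists d. intros a b Ha Hb. now apply Hd.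
Qed.

Lemma uniform_slice (F : R -> R -> R) (u0 c d eps : R) :
  (forall y, c <= y <= d -> continuity_2d_pt F u0 y) -> 0 < eps ->
  exists r, 0 < r /\ forall u y, Rabs (u - u0) < r -> c <= y <= d -> Rabs (F u y - F u0 y) < eps.
Proof.
  intros H He.
  destruct (uniform_continuity_2d_1d' F c d u0 H (mkposreal eps He)) as [r Hr].
  exists r. split; [apply cond_pos|]. intros u y Hu Hy.
  pose proof (cond_pos r). apply Rabs_lt_between in Hu.
  apply (Hr y u0 y u); auto; try lra.
  rewrite Rminus_diag, Rabs_R0; auto.
Qed.

Lemma RInt_param_continuous (F : R -> R -> R) (u0 c d : R) :
  c <= d -> (forall y, c <= y <= d -> continuity_2d_pt F u0 y) ->
  (exists r, 0 < r /\ forall u, Rabs (u - u0) < r -> ex_RInt (F u) c d) ->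
  continuous (fun u => RInt (F u) c d) u0.
Proof.
  intros Hcd HF [r0 [Hr0 Hex]]. apply continuous_eps. intros eps Heps.
  assert (He : 0 < eps / (d - c + 1)) by (apply Rdiv_lt_0_compat; lra).
  destruct (uniform_slice F u0 c d _ HF He) as [r [Hr Hu]].
  exists (Rmin r r0). split; [apply Rmin_glb_lt; auto|]. intros u Hu'.
  assert (Hu1 : Rabs (u - u0) < r) by (eapply Rlt_le_trans; [apply Hu'|apply Rmin_l]).
  assert (Hu2 : Rabs (u - u0) < r0) by (eapply Rlt_le_trans; [apply Hu'|apply Rmin_r]).
  assert (E1 : ex_RInt (F u) c d) by auto.
  assert (E0 : ex_RInt (F u0) c d) by (apply Hex; rewrite Rminus_diag, Rabs_R0; auto).
  assert (E : RInt (F u) c d - RInt (F u0) c d = RInt (fun y => F u y - F u0 y) c d).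
  { symmetry. apply (RInt_minus (F u) (F u0)); auto. }
  rewrite E.
  eapply Rle_lt_trans.
  - apply abs_RInt_le_const with (M := eps / (d - c + 1)); auto.
    + apply (ex_RInt_minus (F u) (F u0)); auto.
    + intros y Hy. left. apply Hu; auto.
  - replace ((d - c) * (eps / (d - c + 1))) with (eps * ((d - c) / (d - c + 1))) by (field; lra).
    assert ((d - c) / (d - c + 1) < 1) by (apply Rlt_div_l; lra). nra.
Qed.

Definition quadrant_continuous (F : R -> R -> R) : Prop :=
  forall u y, 0 < u -> 0 < y -> continuity_2d_pt F u y.

Lemma quadrant_ex_RInt (F : R -> R -> R) (u c d : R) :
  quadrant_continuous F -> 0 < u -> 0 < c -> 0 < d -> ex_RInt (F u) c d.
Proof.
  intros HF Hu Hc Hd. apply (ex_RInt_continuous (F u)). intros z Hz.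
  apply continuity_2d_pt_slice, HF; auto.
  assert (0 < Rmin c d) by (apply Rmin_glb_lt; auto). lra.
Qed.

Lemma quadrant_RInt_continuous (F : R -> R -> R) (u c d : R) :
  quadrant_continuous F -> 0 < u -> 0 < c <= d ->
  continuous (fun u => RInt (F u) c d) u.
Proof.
  intros HF Hu Hc. apply RInt_param_continuous; try lra.
  - intros y Hy. apply HF; lra.
  - exists u. split; auto. intros v Hv. apply Rabs_lt_between in Hv.
    apply quadrant_ex_RInt; auto; lra.
Qed.

Lemma quadrant_continuous_swap (F : R -> R -> R) :
  quadrant_continuous F -> quadrant_continuous (fun y u => F u y).
Proof. intros HF y u Hy Hu. apply continuity_2d_pt_swap, HF; auto. Qed.

Lemma locally_pos (x : R) : 0 < x -> locally x (fun z => 0 < z).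
Proof. intro H. apply (open_gt 0 x H). Qed.

(* Both sides have the same derivative with respect to the endpoint [b]. *)
Lemma fubini_rectangle (F : R -> R -> R) (a b c d : R) :
  quadrant_continuous F -> 0 < a <= b -> 0 < c <= d ->
  RInt (fun u => RInt (F u) c d) a b = RInt (fun y => RInt (fun u => F u y) a b) c d.
Proof.
  intros HF Hab Hcd.
  pose proof (quadrant_continuous_swap F HF) as HF'.
  destruct (Req_dec a b) as [E|E].
  { subst b. rewrite RInt_point. rewrite (RInt_ext _ (fun _ => 0)).
    - rewrite RInt_const. unfold scal, zero; simpl; unfold mult; simpl. ring.
    - intros y _. apply (RInt_point (V := R_CompleteNormedModule)). }
  set (Phi := fun X => RInt (fun u => RInt (F u) c d) a X
                       - RInt (fun y => RInt (fun u => F u y) a X) c d).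
  assert (HPhi : forall X, a <= X <= b -> is_derive Phi X 0).
  { intros X HX.
    assert (D1 : is_derive (fun X => RInt (fun u => RInt (F u) c d) a X) X (RInt (F X) c d)).
    { apply (is_derive_RInt (fun u => RInt (F u) c d) _ a).
      - apply (filter_imp (fun z => 0 < z)); [|apply locally_pos; lra].
        intros z Hz. apply (RInt_correct (V := R_CompleteNormedModule)).
        apply (ex_RInt_continuous (V := R_CompleteNormedModule)).
        intros w Hw. apply quadrant_RInt_continuous; auto.
        assert (0 < Rmin a z) by (apply Rmin_glb_lt; lra). lra.
      - apply quadrant_RInt_continuous; auto; lra. }
    assert (Dy : forall z y, 0 < z -> 0 < y ->
       is_derive (fun X => RInt (fun u => F u y) a X) z (F z y)).
    { intros z y Hz Hy. apply (is_derive_RInt (fun u => F u y) _ a).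
      - apply (filter_imp (fun z => 0 < z)); [|apply locally_pos; lra].
        intros w Hw. apply (RInt_correct (V := R_CompleteNormedModule)).
        apply (quadrant_ex_RInt (fun y u => F u y)); auto; lra.
      - apply (continuity_2d_pt_slice (fun y u => F u y) y z). apply HF'; auto. }
    assert (D2 : is_derive (fun X => RInt (fun y => RInt (fun u => F u y) a X) c d) X
                   (RInt (F X) c d)).
    { assert (Hc : forall y, Rmin c d <= y <= Rmax c d -> 0 < y).
      { intros y Hy. rewrite Rmin_left in Hy; lra. }
      evar_last.
      - apply (is_derive_RInt_param (fun X y => RInt (fun u => F u y) a X) c d X).
        + apply (filter_imp (fun z => 0 < z)); [|apply locally_pos; lra].
          intros z Hz y Hy. exists (F z y). apply Dy; auto.
        + intros y Hy. apply (continuity_2d_pt_ext_loc F).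
          * assert (Hm : 0 < Rmin X y) by (apply Rmin_glb_lt; [lra|auto]).
            exists (mkposreal _ Hm). simpl. intros u v Hu Hv.
            apply Rabs_lt_between in Hu. apply Rabs_lt_between in Hv.
            pose proof (Rmin_l X y). pose proof (Rmin_r X y).
            symmetry. apply is_derive_unique, Dy; lra.
          * apply HF; auto; lra.
        + apply (filter_imp (fun z => 0 < z)); [|apply locally_pos; lra].
          intros z Hz. apply (ex_RInt_continuous (V := R_CompleteNormedModule)).
          (* A neighbourhood of X = a contains points z < a, where the inner integral runs backwards
             and must be reversed first. *)
          intros y Hy. destruct (Rle_or_lt a z) as [L|L].
          * apply (quadrant_RInt_continuous (fun y u => F u y)); auto; lra.
          * apply (continuous_ext_loc _ (fun y => opp (RInt (fun u => F u y) z a))).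
            -- apply (filter_imp (fun z => 0 < z)); [|apply locally_pos; auto].
               intros w Hw. apply (opp_RInt_swap (V := R_CompleteNormedModule) (fun u => F u w)).
               apply (quadrant_ex_RInt (fun y u => F u y)); auto; lra.
            -- apply (continuous_opp (fun y => RInt (fun u => F u y) z a)).
               apply (quadrant_RInt_continuous (fun y u => F u y)); auto; lra.
      - apply (RInt_ext (V := R_CompleteNormedModule)). intros y Hy.
        apply is_derive_unique, Dy; [lra|]. apply Hc; lra. }
    evar_last.
    - apply (is_derive_minus _ _ _ _ _ D1 D2).
    - unfold minus, plus, opp; simpl. ring. }
  assert (P0 : Phi a = 0).
  { unfold Phi. rewrite RInt_point. rewrite (RInt_ext _ (fun _ => 0)).
    - rewrite RInt_const. unfold scal, zero; simpl; unfold mult; simpl. ring.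
    - intros y _. apply (RInt_point (V := R_CompleteNormedModule)). }
  assert (P1 : Phi a = Phi b) by (apply (eq_is_derive Phi a b HPhi); lra).
  unfold Phi in P1 at 2. rewrite P0 in P1. lra.
Qed.

(** The constant may blow up as u tends to 0, as 2/u does for the product kernel, so it is uniform
    only on compact intervals of u. *)
Definition locally_exp_dominated (F : R -> R -> R) : Prop :=
  forall a b, 0 < a <= b -> exists K, forall u, a <= u <= b -> exp_dominated K (F u).

(** Outside a fixed interval [c, d] the common K makes the integrals small uniformly in u; inside
    it, [RInt_param_continuous] applies. *)
Lemma int_pos_param_continuous (F : R -> R -> R) (u0 r K : R) :
  0 < r -> (forall u, Rabs (u - u0) < r -> exp_dominated K (F u)) ->
  (forall y, 0 < y -> continuity_2d_pt F u0 y) ->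
  continuous (fun u => int_pos (F u)) u0.
Proof.
  intros Hr HK HF. apply continuous_eps. intros eps Heps.
  assert (H0 : exp_dominated K (F u0)) by (apply HK; rewrite Rminus_diag, Rabs_R0; auto).
  pose proof (exp_dominated_K_pos _ _ H0) as HKp.
  assert (He : 0 < eps / (8 * (K + 1))) by (apply Rdiv_lt_0_compat; lra).
  destruct (cut_eventually _ He) as [n Hn]. destruct (Hn n (le_n n)) as [N1 N2].
  destruct (cut_bounds n) as [B1 B2].
  set (c := / (INR n + 1)) in *. set (d := INR n + 1) in *.
  assert (Hd : exp (- d) <= / d) by (apply exp_neg_le_inv; lra).
  fold c in Hd. change (/ d) with c in Hd.
  assert (Hsm : K * (c + exp (- d)) <= eps / 4).
  { apply Rle_trans with (K * (2 * (eps / (8 * (K + 1))))).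
    - apply Rmult_le_compat_l; lra.
    - replace (K * (2 * (eps / (8 * (K + 1))))) with (eps / 4 * (K / (K + 1))) by (field; lra).
      assert (K / (K + 1) <= 1) by (apply Rle_div_l; lra). nra. }
  assert (C : continuous (fun u => RInt (F u) c d) u0).
  { apply RInt_param_continuous; auto.
    - intros y Hy; apply HF; lra.
    - exists r. split; auto. intros u Hu. apply (exp_dominated_ex_RInt K); auto; lra. }
  apply (filterlim_locally (fun u => RInt (F u) c d)) with (eps := mkposreal (eps/4) ltac:(lra)) in C.
  destruct C as [e' He']. exists (Rmin r e'). split; [apply Rmin_glb_lt; auto; apply cond_pos|].
  intros u Hu.
  assert (Hu1 : Rabs (u - u0) < r) by (eapply Rlt_le_trans; [apply Hu|apply Rmin_l]).
  assert (Hu2 : Rabs (u - u0) < e') by (eapply Rlt_le_trans; [apply Hu|apply Rmin_r]).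
  specialize (He' u Hu2). simpl in He'. unfold ball in He'; simpl in He'.
  unfold AbsRing_ball, abs, minus, plus, opp in He'; simpl in He'.
  assert (T0 := int_pos_close K (F u0) c d H0 ltac:(lra)).
  assert (T1 := int_pos_close K (F u) c d (HK u Hu1) ltac:(lra)).
  apply Rabs_le_between in T0. apply Rabs_le_between in T1. apply Rabs_lt_between in He'.
  apply Rabs_lt_between. lra.
Qed.

Lemma quadrant_int_pos_continuous (F : R -> R -> R) (u : R) :
  quadrant_continuous F -> locally_exp_dominated F -> 0 < u ->
  continuous (fun u => int_pos (F u)) u.
Proof.
  intros HF HD Hu. destruct (HD (u/2) (2 * u)) as [K HK]; [lra|].
  apply (int_pos_param_continuous F u (u/2) K); [lra| |].
  - intros v Hv. apply Rabs_lt_between in Hv. apply HK; lra.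
  - intros y Hy. apply HF; auto.
Qed.

Lemma RInt_exp_dominated (F : R -> R -> R) (a b K : R) :
  quadrant_continuous F -> 0 < a <= b -> (forall u, a <= u <= b -> exp_dominated K (F u)) ->
  exp_dominated ((b - a) * K) (fun y => RInt (fun u => F u y) a b).
Proof.
  intros HF Hab HK y Hy. split.
  - apply (quadrant_RInt_continuous (fun y u => F u y)); auto. now apply quadrant_continuous_swap.
  - rewrite Rmult_assoc. apply abs_RInt_le_const; try lra.
    + apply (quadrant_ex_RInt (fun y u => F u y)); try lra. now apply quadrant_continuous_swap.
    + intros u Hu. apply HK; auto.
Qed.

(** Truncating y to the n-th cut makes both sides equal by [fubini_rectangle]. The left side
    converges because the truncation error is uniform for u in [a, b], the right side by definition
    of [int_pos]. *)
Lemma int_pos_RInt_swap (F : R -> R -> R) (a b : R) :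
  quadrant_continuous F -> locally_exp_dominated F -> 0 < a <= b ->
  RInt (fun u => int_pos (F u)) a b = int_pos (fun y => RInt (fun u => F u y) a b).
Proof.
  intros HF HD Hab. destruct (HD a b Hab) as [K HK].
  pose proof (RInt_exp_dominated F a b K HF Hab HK) as HG.
  apply is_lim_seq_ext_unique with
    (u := fun n => RInt (fun u => cut_int (F u) n) a b)
    (v := cut_int (fun y => RInt (fun u => F u y) a b)).
  - apply is_lim_seq_spec. intro eps.
    pose proof (exp_dominated_K_pos _ _ (HK a ltac:(lra))) as HKp.
    (* The added ones keep the quotient meaningful when K = 0 or a = b. *)
    assert (He : 0 < eps / (4 * (K + 1) * (b - a + 1))).
    { apply Rdiv_lt_0_compat; [apply cond_pos|]. apply Rmult_lt_0_compat; lra. }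
    destruct (cut_eventually _ He) as [N HN]. exists N. intros n Hn.
    destruct (HN n Hn) as [N1 N2]. destruct (cut_bounds n) as [B1 B2].
    assert (Hd : exp (- (INR n + 1)) <= / (INR n + 1)) by (apply exp_neg_le_inv; lra).
    assert (E1 : ex_RInt (fun u => cut_int (F u) n) a b).
    { apply (ex_RInt_continuous (V := R_CompleteNormedModule)). intros u Hu.
      rewrite Rmin_left in Hu by lra. apply quadrant_RInt_continuous; auto; lra. }
    assert (E2 : ex_RInt (fun u => int_pos (F u)) a b).
    { apply (ex_RInt_continuous (V := R_CompleteNormedModule)). intros u Hu.
      rewrite Rmin_left in Hu by lra. apply quadrant_int_pos_continuous; auto; lra. }
    assert (E : RInt (fun u => cut_int (F u) n) a b - RInt (fun u => int_pos (F u)) a b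
      = RInt (fun u => cut_int (F u) n - int_pos (F u)) a b).
    { symmetry. apply (RInt_minus (fun u => cut_int (F u) n) (fun u => int_pos (F u))); auto. }
    rewrite E.
    apply Rle_lt_trans with ((b - a) * (K * (2 * (eps / (4 * (K + 1) * (b - a + 1)))))).
    + apply abs_RInt_le_const; try lra.
      * apply (ex_RInt_minus (fun u => cut_int (F u) n) (fun u => int_pos (F u))); auto.
      * intros u Hu. eapply Rle_trans; [apply (int_pos_close K); auto|].
        apply Rmult_le_compat_l; lra.
    + pose proof (cond_pos eps).
      replace ((b - a) * (K * (2 * (eps / (4 * (K + 1) * (b - a + 1))))))
        with (eps / 2 * ((b - a) / (b - a + 1) * (K / (K + 1)))) by (field; lra).
      assert (0 <= (b - a) / (b - a + 1) <= 1)
        by (split; [apply Rdiv_le_0_compat; lra | apply Rle_div_l; lra]).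
      assert (0 <= K / (K + 1) <= 1)
        by (split; [apply Rdiv_le_0_compat; lra | apply Rle_div_l; lra]).
      set (p := (b - a) / (b - a + 1)) in *. set (q := K / (K + 1)) in *.
      assert (p * q <= 1) by nra.
      pose proof (Rmult_le_compat_l (eps / 2) (p * q) 1 ltac:(lra) ltac:(lra)). lra.
  - apply (cut_int_lim _ _ HG).
  - intro n. apply fubini_rectangle; auto. apply cut_bounds.
Qed.

(** * Exponential estimates and integrals starting at 0 *)

Lemma exp_le_compat (x y : R) : x <= y -> exp x <= exp y.
Proof. intros [H|H]; [left; now apply exp_increasing | subst; right; reflexivity]. Qed.

Lemma exp_half_le_2 : exp (1/2) <= 2.
Proof.
  pose proof exp_le_3 as H. pose proof (exp_pos (1/2)).
  replace 1 with (1/2 + 1/2) in H by field. rewrite exp_plus in H. nra.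
Qed.

(** Used to prove identities between integrals over the half-line from finite ones: the difference
    is a constant, while truncation at b leaves an error of order exp(-b). *)
Lemma exp_decay_zero (z K : R) : (forall b, 0 < b -> Rabs z <= K * exp (- b)) -> z = 0.
Proof.
  intro H. destruct (Req_dec z 0) as [E|E]; auto. exfalso.
  apply Rabs_pos_lt in E.
  (* At b = q + 1 the bound exp(-b) <= 1/b gives |z|(q+1) <= |K| = q|z|, a contradiction. *)
  set (q := Rabs K / Rabs z). assert (0 <= q) by (apply Rdiv_le_0_compat; auto; apply Rabs_pos).
  specialize (H (q + 1) ltac:(lra)).
  assert (Hv : exp (- (q + 1)) <= / (q + 1)) by (apply exp_neg_le_inv; lra).
  assert (K * exp (- (q + 1)) <= Rabs K * / (q + 1)).
  { apply Rle_trans with (Rabs K * exp (- (q + 1))).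
    - pose proof (RRle_abs K). pose proof (exp_pos (- (q + 1))). nra.
    - apply Rmult_le_compat_l; auto. apply Rabs_pos. }
  assert (Rabs K = q * Rabs z) by (unfold q; field; lra).
  assert (Rabs z * (q + 1) <= Rabs K).
  { apply (Rmult_le_reg_r (/ (q + 1))); [apply Rinv_0_lt_compat; lra|].
    rewrite Rmult_assoc, Rinv_r, Rmult_1_r by lra. lra. }
  nra.
Qed.

Lemma is_derive_RInt_continuous (k : R -> R) (a x : R) :
  (forall x, continuous k x) -> is_derive (fun x => RInt k a x) x (k x).
Proof.
  intro Hk. apply (is_derive_RInt k _ a); auto.
  apply filter_forall. intro z. apply (RInt_correct (V := R_CompleteNormedModule)).
  apply (ex_RInt_continuous (V := R_CompleteNormedModule)). auto.
Qed.

Lemma RInt_comp_affine (f : R -> R) (u v a b : R) :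
  ex_RInt f (u * a + v) (u * b + v) ->
  RInt (fun y => u * f (u * y + v)) a b = RInt f (u * a + v) (u * b + v).
Proof. exact (RInt_comp_lin (V := R_CompleteNormedModule) f u v a b). Qed.

Lemma RInt_ext_R (f g : R -> R) (a b : R) :
  (forall x, Rmin a b < x < Rmax a b -> f x = g x) -> RInt f a b = RInt g a b.
Proof. exact (RInt_ext (V := R_CompleteNormedModule) f g a b). Qed.

Lemma RInt_scal_R (f : R -> R) (a b l : R) :
  ex_RInt f a b -> RInt (fun x => l * f x) a b = l * RInt f a b.
Proof. exact (RInt_scal (V := R_CompleteNormedModule) f a b l). Qed.

(** Unlike [exp_dominated], this excludes a singularity at 0, so integrals may start at 0 and the
    function may be translated. *)
Definition half_dominated (K : R) (f : R -> R) : Prop :=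
  (forall x, continuous f x) /\ forall x, 0 <= x -> Rabs (f x) <= K * exp (- x).

Lemma half_dominated_exp (K : R) (f : R -> R) : half_dominated K f -> exp_dominated K f.
Proof. intros [H1 H2] x Hx. split; auto. apply H2; lra. Qed.

Lemma half_dominated_ex_RInt (K : R) (f : R -> R) (a b : R) : half_dominated K f -> ex_RInt f a b.
Proof. intros [H _]. apply (ex_RInt_continuous (V := R_CompleteNormedModule)); auto. Qed.

Lemma int_pos_close_0 (K : R) (f : R -> R) (b : R) :
  half_dominated K f -> 0 < b -> Rabs (RInt f 0 b - int_pos f) <= K * exp (- b).
Proof.
  intros Hf Hb. pose proof (half_dominated_exp _ _ Hf) as He.
  pose proof (exp_dominated_K_pos _ _ He) as HK.
  apply le_epsilon. intros e Hpe.
  (* Two errors of size K a arise, from the piece [0, a] and from [int_pos_close]; this choice keeps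
     their sum below e. *)
  set (a := Rmin b (e / (2 * (K + 1)))).
  assert (Ha : 0 < a <= b).
  { split; [|apply Rmin_l]. apply Rmin_glb_lt; auto. apply Rdiv_lt_0_compat; lra. }
  assert (Ha2 : a <= e / (2 * (K + 1))) by apply Rmin_r.
  assert (T := int_pos_close K f a b He Ha).
  rewrite <- (RInt_Chasles f 0 a b) by (eapply half_dominated_ex_RInt; eauto).
  unfold plus; simpl.
  assert (S : Rabs (RInt f 0 a) <= (a - 0) * K).
  { apply abs_RInt_le_const; try lra.
    - eapply half_dominated_ex_RInt; eauto.
    - intros t Ht. eapply Rle_trans; [apply Hf; lra|].
      assert (exp (- t) <= 1) by (rewrite <- exp_0; apply exp_le_compat; lra).
      nra. }
  assert (a * (2 * (K + 1)) <= e) by (apply Rle_div_r; lra).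
  apply Rabs_le_between in T. apply Rabs_le_between in S. apply Rabs_le.
  pose proof (exp_pos (- b)). nra.
Qed.

Lemma half_dominated_shift (K : R) (f : R -> R) (x : R) :
  0 <= x -> half_dominated K f -> half_dominated K (fun s => f (x + s)).
Proof.
  intros Hx Hf. pose proof (exp_dominated_K_pos _ _ (half_dominated_exp _ _ Hf)) as HK.
  destruct Hf as [H1 H2]. split.
  - intro s. apply (continuous_comp (fun s => x + s) f); auto.
    apply (ex_derive_continuous (fun s => x + s)). auto_derive; auto.
  - intros s Hs. eapply Rle_trans; [apply H2; lra|].
    apply Rmult_le_compat_l; auto. apply exp_le_compat; lra.
Qed.

Lemma int_pos_shift (K : R) (f : R -> R) (x : R) :
  0 <= x -> half_dominated K f -> int_pos f = RInt f 0 x + int_pos (fun s => f (x + s)).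
Proof.
  intros Hx Hf. apply Rminus_diag_uniq.
  apply (exp_decay_zero _ (2 * K)). intros b Hb.
  assert (T1 := int_pos_close_0 K f (x + b) Hf ltac:(lra)).
  assert (T2 := int_pos_close_0 K _ b (half_dominated_shift K f x Hx Hf) Hb).
  rewrite <- (RInt_Chasles f 0 x (x + b)) in T1 by (eapply half_dominated_ex_RInt; eauto).
  assert (E : RInt (fun s => f (x + s)) 0 b = RInt f x (x + b)).
  { rewrite (RInt_ext (fun s => f (x + s)) (fun y => 1 * f (1 * y + x))).
    - rewrite (RInt_comp_affine f 1 x 0 b).
      + f_equal; ring.
      + eapply half_dominated_ex_RInt; eauto.
    - intros y _. rewrite Rmult_1_l. f_equal; ring. }
  rewrite E in T2. unfold plus in T1; simpl in T1.
  pose proof (exp_dominated_K_pos _ _ (half_dominated_exp _ _ Hf)) as HK.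
  assert (K * exp (- (x + b)) <= K * exp (- b))
    by (apply Rmult_le_compat_l; auto; apply exp_le_compat; lra).
  apply Rabs_le_between in T1. apply Rabs_le_between in T2. apply Rabs_le. lra.
Qed.

(** * The standard normal distribution *)

Definition gauss (x : R) : R := exp (- (x * x / 2)).

(** Linear growth covers both Lipschitz and bounded continuous test functions, and it is stable
    under scaling, translation and integrating out one normal factor. *)
Definition lin_growth (K : R) (h : R -> R) : Prop :=
  forall x, continuous h x /\ Rabs (h x) <= K * (1 + Rabs x).

Definition moderate (h : R -> R) : Prop := exists K, lin_growth K h.

Lemma gauss_continuous (x : R) : continuous gauss x.
Proof. apply (ex_derive_continuous gauss). unfold gauss. auto_derive; auto. Qed.

Lemma gauss_pos (x : R) : 0 < gauss x.
Proof. apply exp_pos. Qed.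

Lemma gauss_opp (x : R) : gauss (- x) = gauss x.
Proof. unfold gauss. f_equal. field. Qed.

Lemma gauss_le (s : R) : gauss s <= 2 * exp (- s).
Proof.
  apply Rle_trans with (exp (1/2) * exp (- s)).
  - unfold gauss. rewrite <- exp_plus. apply exp_le_compat.
    pose proof (Rle_0_sqr (s - 1)) as P; unfold Rsqr in P. lra.
  - apply Rmult_le_compat_r; [left; apply exp_pos | apply exp_half_le_2].
Qed.

Lemma lin_gauss_le (x : R) : 0 <= x -> (1 + x) * gauss x <= exp 2 * exp (- x).
Proof.
  intro Hx. apply Rle_trans with (exp x * gauss x).
  - apply Rmult_le_compat_r; [left; apply gauss_pos | apply exp_ineq1_le].
  - unfold gauss. rewrite <- !exp_plus. apply exp_le_compat.
    pose proof (Rle_0_sqr (x - 2)) as P; unfold Rsqr in P. lra.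
Qed.

Lemma lin_growth_K_pos (K : R) (h : R -> R) : lin_growth K h -> 0 <= K.
Proof.
  intro H. destruct (H 0) as [_ H1]. rewrite Rabs_R0 in H1. pose proof (Rabs_pos (h 0)). lra.
Qed.

Lemma lin_growth_gauss (K : R) (h : R -> R) :
  lin_growth K h -> half_dominated (K * exp 2) (fun x => h x * gauss x).
Proof.
  intro H. pose proof (lin_growth_K_pos _ _ H) as HK. split.
  - intro x. apply (continuous_mult h gauss); [apply H | apply gauss_continuous].
  - intros x Hx. rewrite Rabs_mult, (Rabs_pos_eq (gauss x)) by (left; apply gauss_pos).
    destruct (H x) as [_ H1]. rewrite (Rabs_pos_eq x) in H1 by auto.
    pose proof (lin_gauss_le x Hx). pose proof (gauss_pos x).
    apply Rle_trans with (K * ((1 + x) * gauss x)); nra.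
Qed.

Lemma moderate_gauss (h : R -> R) :
  moderate h -> exists K, half_dominated K (fun x => h x * gauss x).
Proof. intros [K H]. exists (K * exp 2). now apply lin_growth_gauss. Qed.

Lemma lin_growth_scale (K a : R) (h : R -> R) :
  lin_growth K h -> lin_growth (K * (1 + Rabs a)) (fun x => h (a * x)).
Proof.
  intro H. pose proof (lin_growth_K_pos _ _ H) as HK. intro x. destruct (H (a * x)) as [H1 H2]. split.
  - apply (continuous_comp (fun x => a * x) h); auto.
    apply (ex_derive_continuous (fun s => a * s)). auto_derive; auto.
  - eapply Rle_trans; [apply H2|]. rewrite Rabs_mult, Rmult_assoc.
    apply Rmult_le_compat_l; auto. pose proof (Rabs_pos a). pose proof (Rabs_pos x). nra.
Qed.

Lemma moderate_scale (a : R) (h : R -> R) : moderate h -> moderate (fun x => h (a * x)).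
Proof. intros [K H]. eexists. apply lin_growth_scale; eauto. Qed.

Lemma moderate_ext (h g : R -> R) : (forall x, h x = g x) -> moderate h -> moderate g.
Proof.
  intros E [K H]. exists K. intro x. destruct (H x) as [H1 H2]. split.
  - apply (continuous_ext h); auto.
  - rewrite <- E; auto.
Qed.

Lemma moderate_opp (h : R -> R) : moderate h -> moderate (fun x => h (- x)).
Proof.
  intro H. apply (moderate_ext (fun x => h (-1 * x))).
  - intro x. f_equal; ring.
  - now apply moderate_scale.
Qed.

Lemma moderate_lin (a b : R) (h g : R -> R) :
  moderate h -> moderate g -> moderate (fun x => a * h x + b * g x).
Proof.
  intros [K Hh] [K' Hg]. exists (Rabs a * K + Rabs b * K'). intro x.
  destruct (Hh x) as [F1 F2], (Hg x) as [G1 G2]. split.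
  - apply (continuous_plus (fun x => a * h x) (fun x => b * g x)).
    + apply (continuous_scal_r a h); auto.
    + apply (continuous_scal_r b g); auto.
  - eapply Rle_trans; [apply Rabs_triang|]. rewrite !Rabs_mult.
    pose proof (Rabs_pos a). pose proof (Rabs_pos b). nra.
Qed.

Lemma moderate_const (c : R) : moderate (fun _ => c).
Proof.
  exists (Rabs c). intro x. split; [apply continuous_const|].
  pose proof (Rabs_pos c). pose proof (Rabs_pos x). nra.
Qed.

Lemma moderate_abs : moderate Rabs.
Proof.
  exists 1. intro x. split; [apply continuous_Rabs|]. rewrite Rabs_Rabsolu. lra.
Qed.

Lemma moderate_id : moderate (fun x => x).
Proof.
  exists 1. intro x. split; [apply continuous_id|]. lra.
Qed.

Lemma moderate_minus (h g : R -> R) : moderate h -> moderate g -> moderate (fun x => h x - g x).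
Proof.
  intros Hh Hg. apply (moderate_ext (fun x => 1 * h x + (-1) * g x)); [intro; ring|].
  now apply moderate_lin.
Qed.

Lemma moderate_bexp (m : nat) (H : nat -> R -> R) :
  (forall i, moderate (H i)) -> moderate (fun y => bexp m (fun i => H i y)).
Proof.
  revert H; induction m as [|m IH]; intros H HH; simpl; auto.
  apply (moderate_ext (fun y => (1/2) * bexp m (fun i => H i y) + (1/2) * bexp m (fun i => H (S i) y))).
  - intro; field.
  - apply moderate_lin; [now apply IH | apply (IH (fun i => H (S i))); auto].
Qed.

Lemma RInt_id_gauss (b : R) : RInt (fun x => x * gauss x) 0 b = 1 - gauss b.
Proof.
  apply is_RInt_unique. evar_last.
  - apply (is_RInt_derive (fun x => - gauss x) (fun x => x * gauss x)).
    + intros t _. unfold gauss. auto_derive; auto. unfold Rdiv. field.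
    + intros t _. apply (continuous_mult (fun t => t) gauss); [apply continuous_id | apply gauss_continuous].
  - unfold minus, plus, opp; simpl. unfold gauss.
    replace (- (0 * 0 / 2)) with 0 by field. rewrite exp_0. ring.
Qed.

Lemma int_pos_id_gauss : int_pos (fun x => x * gauss x) = 1.
Proof.
  destruct (moderate_gauss _ moderate_id) as [K H].
  apply Rminus_diag_uniq. apply (exp_decay_zero _ (K + 2)). intros b Hb.
  assert (T := int_pos_close_0 K _ b H Hb).
  rewrite RInt_id_gauss in T. pose proof (gauss_le b). pose proof (gauss_pos b).
  apply Rabs_le_between in T. apply Rabs_le. lra.
Qed.

(* The quantity [(int_0^x e^(-t^2/2) dt)^2 + 2 int_0^1 e^(-x^2(1+t^2)/2)/(1+t^2) dt]
   does not depend on [x]; at [x = 0] it equals [2 atan 1]. *)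
Lemma gauss_sq_identity (x : R) : 0 < x ->
  (RInt gauss 0 x) ^ 2 + 2 * RInt (fun t => exp (- (x * x * (1 + t * t) / 2)) / (1 + t * t)) 0 1 = PI / 2.
Proof.
  intro Hx.
  set (B := fun x => RInt (fun t => exp (- (x * x * (1 + t * t) / 2)) / (1 + t * t)) 0 1).
  assert (Hpos : forall t, 0 < 1 + t * t) by (intro t; nra).
  assert (DA : forall y, is_derive (fun x => RInt gauss 0 x) y (gauss y)).
  { intro y. apply is_derive_RInt_continuous, gauss_continuous. }
  assert (Dt : forall y t, is_derive (fun x => exp (- (x * x * (1 + t * t) / 2)) / (1 + t * t)) y
                 (- y * exp (- (y * y * (1 + t * t) / 2)))).
  { intros y t. pose proof (Hpos t). auto_derive; [lra|]. unfold Rdiv. field. lra. }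
  (* Differentiating under the integral cancels the denominator 1+t^2; the substitution s = y t then
     produces the integral of [gauss] up to y, so this derivative offsets that of the square. *)
  assert (DB : forall y, is_derive B y (- gauss y * RInt gauss 0 y)).
  { intro y. evar_last.
    - apply (is_derive_RInt_param (fun x t => exp (- (x * x * (1 + t * t) / 2)) / (1 + t * t)) 0 1 y).
      + apply filter_forall. intros z t _. eexists. apply Dt.
      + intros t _. apply (continuity_2d_pt_ext (fun u v => - u * exp (- (u * u * (1 + v * v) / 2)))).
        * intros u v. symmetry. apply is_derive_unique, Dt.
        * apply continuity_2d_pt_mult.
          -- apply continuity_2d_pt_opp, continuity_2d_pt_id1.
          -- apply (continuity_1d_2d_pt_comp exp (fun u v => - (u * u * (1 + v * v) / 2))).
             { apply derivable_continuous_pt, derivable_pt_exp. }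
             apply continuity_2d_pt_opp, continuity_2d_pt_mult; [|apply continuity_2d_pt_const].
             repeat first [apply continuity_2d_pt_mult | apply continuity_2d_pt_plus
                | apply continuity_2d_pt_id1 | apply continuity_2d_pt_id2 | apply continuity_2d_pt_const].
      + apply filter_forall. intro z. apply (ex_RInt_continuous (V := R_CompleteNormedModule)).
        intros t _. apply (ex_derive_continuous (fun t => exp (- (z * z * (1 + t * t) / 2)) / (1 + t * t))).
        pose proof (Hpos t). auto_derive. lra.
    - rewrite (RInt_ext _ (fun t => - gauss y * (y * gauss (y * t + 0)))).
      + assert (Ex : ex_RInt gauss (y * 0 + 0) (y * 1 + 0)).
        { apply (ex_RInt_continuous (V := R_CompleteNormedModule)). intros; apply gauss_continuous. }
        rewrite (RInt_scal_R (fun t => y * gauss (y * t + 0))).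
        * rewrite (RInt_comp_affine gauss y 0 0 1) by auto.
          f_equal. f_equal; ring.
        * apply (ex_RInt_comp_lin gauss y 0 0 1); auto.
      + intros t _. etransitivity; [apply is_derive_unique, Dt|].
        change (- y * exp (- (y * y * (1 + t * t) / 2)) = - gauss y * (y * gauss (y * t + 0)) :> R).
        unfold gauss.
        replace (exp (- (y * y * (1 + t * t) / 2)))
          with (exp (- (y * y / 2)) * exp (- ((y * t + 0) * (y * t + 0) / 2))).
        * ring.
        * rewrite <- exp_plus. f_equal. field. }
  assert (C : (fun x => (RInt gauss 0 x) ^ 2 + 2 * B x) 0 = (fun x => (RInt gauss 0 x) ^ 2 + 2 * B x) x).
  { apply (eq_is_derive (fun x => (RInt gauss 0 x) ^ 2 + 2 * B x) 0 x); auto.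
    intros y _. evar_last.
    - apply (is_derive_plus (fun x => (RInt gauss 0 x) ^ 2) (fun x => 2 * B x)).
      + apply (is_derive_pow (fun x => RInt gauss 0 x) 2 y (gauss y)). apply DA.
      + apply (is_derive_scal B y 2). apply DB.
    - unfold plus, zero; simpl. ring. }
  simpl in C. change (RInt (fun t => exp (- (x * x * (1 + t * t) / 2)) / (1 + t * t)) 0 1) with (B x).
  simpl. rewrite <- C. rewrite RInt_point. unfold zero; simpl.
  assert (E : B 0 = PI / 4).
  { unfold B. rewrite (RInt_ext _ (fun t => / (1 + t²))).
    - apply is_RInt_unique. evar_last.
      + apply (is_RInt_derive atan (fun t => / (1 + t²))).
        * intros t _. apply is_derive_atan.
        * intros t _. apply (ex_derive_continuous (fun t => / (1 + t²))). unfold Rsqr.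
          pose proof (Hpos t). auto_derive. lra.
      + unfold minus, plus, opp; simpl. rewrite atan_1, atan_0. field.
    - intros t _. replace (- (0 * 0 * (1 + t * t) / 2)) with 0 by field. rewrite exp_0.
      change (1 / (1 + t * t) = / (1 + t * t) :> R). field. pose proof (Hpos t). lra. }
  rewrite E. field.
Qed.

Lemma int_pos_gauss_sq : int_pos gauss * int_pos gauss = PI / 2.
Proof.
  destruct (moderate_gauss _ (moderate_const 1)) as [K H].
  assert (H' : half_dominated K gauss).
  { destruct H as [H1 H2]. split.
    - apply gauss_continuous.
    - intros x Hx. specialize (H2 x Hx). now rewrite Rmult_1_l in H2. }
  apply Rminus_diag_uniq.
  pose proof (exp_dominated_K_pos _ _ (half_dominated_exp _ _ H')) as HK.
  set (I := int_pos gauss).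
  (* The first term bounds J^2 - I^2 = (J - I)(2I + (J - I)) through |J - I| <= K exp(-b) <= K; the
     4 bounds 2r, since r <= 2 exp(-b). *)
  apply (exp_decay_zero _ (K * (2 * Rabs I + K) + 4)). intros b Hb.
  assert (T := int_pos_close_0 K _ b H' Hb).
  pose proof (gauss_sq_identity b Hb) as G.
  set (J := RInt gauss 0 b) in *. fold I in T.
  set (r := RInt _ 0 1) in G.
  assert (Hr : Rabs r <= (1 - 0) * (2 * exp (- b))).
  { unfold r. apply abs_RInt_le_const; [lra| |].
    - apply (ex_RInt_continuous (V := R_CompleteNormedModule)). intros t _.
      apply (ex_derive_continuous (fun t => exp (- (b * b * (1 + t * t) / 2)) / (1 + t * t))).
      auto_derive. nra.
    - intros t _. rewrite Rabs_pos_eq.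
      + apply Rle_trans with (gauss b); [|apply gauss_le].
        apply Rle_div_l; [nra|]. apply Rle_trans with (gauss b * 1).
        * rewrite Rmult_1_r. apply exp_le_compat. nra.
        * apply Rmult_le_compat_l; [left; apply gauss_pos | nra].
      + apply Rdiv_le_0_compat; [left; apply exp_pos | nra]. }
  assert (e1 : exp (- b) <= 1) by (rewrite <- exp_0; apply exp_le_compat; lra).
  replace (I * I - PI / 2) with (- ((J - I) * (2 * I + (J - I))) - 2 * r) by (rewrite <- G; ring).
  assert (Q : Rabs ((J - I) * (2 * I + (J - I))) <= K * exp (- b) * (2 * Rabs I + K)).
  { rewrite Rabs_mult. apply Rmult_le_compat; try apply Rabs_pos; auto.
    eapply Rle_trans; [apply Rabs_triang|]. rewrite Rabs_mult, (Rabs_pos_eq 2) by lra.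
    apply Rplus_le_compat_l. eapply Rle_trans; [apply T|]. nra. }
  apply Rabs_le_between in Q. apply Rabs_le_between in Hr. apply Rabs_le. lra.
Qed.

(** Folding the line onto the half-line lets [int_pos] serve for everything and makes the symmetry
    of the normal law a swap of two terms. *)
Definition normal_exp (h : R -> R) : R :=
  (int_pos (fun x => h x * gauss x) + int_pos (fun x => h (- x) * gauss x)) / sqrt (2 * PI).

Lemma sqrt_2PI_pos : 0 < sqrt (2 * PI).
Proof. apply sqrt_lt_R0. pose proof PI_RGT_0. lra. Qed.

Lemma int_pos_gauss : int_pos gauss = sqrt (2 * PI) / 2.
Proof.
  pose proof PI_RGT_0 as HP. pose proof sqrt_2PI_pos as HS.
  assert (H0 : 0 <= int_pos gauss).
  { destruct (moderate_gauss _ (moderate_const 1)) as [K H].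
    destruct (moderate_gauss _ (moderate_const 0)) as [K' H'].
    apply half_dominated_exp in H. apply half_dominated_exp in H'.
    rewrite (int_pos_ext gauss (fun x => 1 * gauss x)) by (intros; ring).
    replace 0 with (0 * int_pos (fun x => 1 * gauss x)) by ring.
    rewrite <- (int_pos_scal 0 K) by auto.
    apply (int_pos_le _ _ _ _ (exp_dominated_scal 0 _ _ H) H).
    intros x _. pose proof (gauss_pos x). lra. }
  apply Rsqr_inj; auto; [lra|]. unfold Rsqr.
  rewrite int_pos_gauss_sq.
  replace (sqrt (2 * PI) / 2 * (sqrt (2 * PI) / 2)) with ((sqrt (2 * PI) * sqrt (2 * PI)) / 4) by field.
  rewrite sqrt_sqrt by lra. field.
Qed.

Lemma normal_exp_ext (h g : R -> R) : (forall x, h x = g x) -> normal_exp h = normal_exp g.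
Proof.
  intro E. unfold normal_exp.
  rewrite (int_pos_ext (fun x => h x * gauss x) (fun x => g x * gauss x)) by (intros; now rewrite E).
  rewrite (int_pos_ext (fun x => h (- x) * gauss x) (fun x => g (- x) * gauss x)) by (intros; now rewrite E).
  reflexivity.
Qed.

Lemma normal_exp_lin (a b : R) (h g : R -> R) : moderate h -> moderate g ->
  normal_exp (fun x => a * h x + b * g x) = a * normal_exp h + b * normal_exp g.
Proof.
  intros Hh Hg. unfold normal_exp.
  assert (L : forall h g, moderate h -> moderate g ->
    int_pos (fun x => (a * h x + b * g x) * gauss x)
    = a * int_pos (fun x => h x * gauss x) + b * int_pos (fun x => g x * gauss x)).
  { clear h g Hh Hg. intros h g Hh Hg.
    destruct (moderate_gauss h Hh) as [K H], (moderate_gauss g Hg) as [K' H'].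
    rewrite <- (int_pos_lin a b K K') by (apply half_dominated_exp; auto).
    apply int_pos_ext. intros; ring. }
  rewrite L by auto.
  rewrite (L (fun x => h (- x)) (fun x => g (- x))) by (apply moderate_opp; auto).
  field. pose proof sqrt_2PI_pos. lra.
Qed.

Lemma normal_exp_const (c : R) : normal_exp (fun _ => c) = c.
Proof.
  unfold normal_exp. destruct (moderate_gauss _ (moderate_const 1)) as [K H].
  assert (E : int_pos (fun x => c * gauss x) = c * int_pos gauss).
  { apply (int_pos_scal c K). apply half_dominated_exp in H.
    eapply exp_dominated_ext; [|apply H]. intro; simpl; ring. }
  rewrite E, int_pos_gauss. field. pose proof sqrt_2PI_pos. lra.
Qed.

Lemma normal_exp_opp (h : R -> R) : normal_exp (fun x => h (- x)) = normal_exp h.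
Proof.
  unfold normal_exp. rewrite (int_pos_ext (fun x => h (- - x) * gauss x) (fun x => h x * gauss x)).
  - f_equal; ring.
  - intros x _. now rewrite Ropp_involutive.
Qed.

Lemma normal_exp_le (h g : R -> R) : moderate h -> moderate g ->
  (forall x, h x <= g x) -> normal_exp h <= normal_exp g.
Proof.
  intros Hh Hg H. unfold normal_exp.
  apply Rmult_le_compat_r; [left; apply Rinv_0_lt_compat, sqrt_2PI_pos|].
  assert (L : forall h g, moderate h -> moderate g -> (forall x, h x <= g x) ->
    int_pos (fun x => h x * gauss x) <= int_pos (fun x => g x * gauss x)).
  { clear h g Hh Hg H. intros h g Hh Hg H.
    destruct (moderate_gauss h Hh) as [K H1], (moderate_gauss g Hg) as [K' H2].
    apply (int_pos_le K K'); try (apply half_dominated_exp; auto).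
    intros x _. apply Rmult_le_compat_r; auto. left; apply gauss_pos. }
  apply Rplus_le_compat; apply L; auto using moderate_opp.
Qed.

Lemma normal_exp_minus (h g : R -> R) : moderate h -> moderate g ->
  normal_exp (fun x => h x - g x) = normal_exp h - normal_exp g.
Proof.
  intros Hh Hg. rewrite (normal_exp_ext _ (fun x => 1 * h x + (-1) * g x)) by (intro; ring).
  rewrite normal_exp_lin by auto. ring.
Qed.

Lemma normal_exp_abs_le (h g : R -> R) : moderate h -> moderate g ->
  (forall x, Rabs (h x) <= g x) -> Rabs (normal_exp h) <= normal_exp g.
Proof.
  intros Hh Hg H. apply Rabs_le. split.
  - replace (- normal_exp g) with (normal_exp (fun x => (-1) * g x + 0 * g x))
      by (rewrite normal_exp_lin; auto; ring).
    apply normal_exp_le; auto using moderate_lin.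
    intro x. specialize (H x). apply Rabs_le_between in H. lra.
  - apply normal_exp_le; auto. intro x. specialize (H x). apply Rabs_le_between in H. lra.
Qed.

Lemma normal_exp_abs : normal_exp Rabs <= 1.
Proof.
  unfold normal_exp.
  rewrite (int_pos_ext (fun x => Rabs x * gauss x) (fun x => x * gauss x))
    by (intros; now rewrite Rabs_pos_eq by lra).
  rewrite (int_pos_ext (fun x => Rabs (- x) * gauss x) (fun x => x * gauss x))
    by (intros; now rewrite Rabs_Ropp, Rabs_pos_eq by lra).
  rewrite int_pos_id_gauss.
  apply Rle_div_l; [apply sqrt_2PI_pos|].
  assert (H : sqrt (2 * 2) <= sqrt (2 * PI)).
  { apply sqrt_le_1_alt. pose proof PI2_1. lra. }
  rewrite sqrt_square in H; lra.
Qed.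

Lemma normal_exp_bexp (m : nat) (H : nat -> R -> R) : (forall i, moderate (H i)) ->
  normal_exp (fun y => bexp m (fun i => H i y)) = bexp m (fun i => normal_exp (H i)).
Proof.
  revert H; induction m as [|m IH]; intros H HH; simpl; [now apply normal_exp_ext|].
  rewrite (normal_exp_ext _ (fun y => (1/2) * bexp m (fun i => H i y) + (1/2) * bexp m (fun i => H (S i) y)))
      by (intro; field).
  rewrite normal_exp_lin.
  - rewrite IH, (IH (fun i => H (S i))) by auto. field.
  - now apply moderate_bexp.
  - now apply (moderate_bexp m (fun i => H (S i))).
Qed.

(** * The solution of Stein's equation for the normal distribution *)

(** The classical solution exp(x^2/2) times the integral over (-oo, x) of the centred h against the
    Gaussian weight. As the integral over the whole line vanishes, the part over (-oo, 0) is minus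
    [int_pos]. *)
Definition stein_sol (h : R -> R) (x : R) : R :=
  exp (x * x / 2) * (RInt (fun t => (h t - normal_exp h) * gauss t) 0 x
                     - int_pos (fun t => (h t - normal_exp h) * gauss t)).

Lemma moderate_centered (h : R -> R) (c : R) : moderate h -> moderate (fun t => h t - c).
Proof. intro H. apply moderate_minus; auto. apply moderate_const. Qed.

Lemma stein_sol_derive (h : R -> R) (x : R) : moderate h ->
  is_derive (stein_sol h) x (x * stein_sol h x + h x - normal_exp h).
Proof.
  intro Hh. destruct (moderate_gauss _ (moderate_centered h (normal_exp h) Hh)) as [K [H _]].
  unfold stein_sol.
  set (k := fun t => (h t - normal_exp h) * gauss t) in *.
  evar_last.
  - apply (is_derive_mult (fun x => exp (x * x / 2)) (fun x => RInt k 0 x - int_pos k) x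
      (x * exp (x * x / 2)) (k x)).
    + auto_derive; auto. unfold Rdiv. field.
    + evar_last.
      * apply (is_derive_minus (fun x => RInt k 0 x) (fun _ => int_pos k) x (k x) 0).
        -- now apply is_derive_RInt_continuous.
        -- apply (is_derive_const (int_pos k) x).
      * unfold minus, plus, opp; simpl. ring.
    + intros; apply Rmult_comm.
  - unfold plus, mult; simpl.
    assert (E : exp (x * x / 2) * k x = h x - normal_exp h).
    { replace (exp (x * x / 2) * k x) with (exp (x * x / 2) * gauss x * (h x - normal_exp h))
        by (unfold k; ring).
      unfold gauss. rewrite <- exp_plus, Rplus_opp_r, exp_0. ring. }
    rewrite E. ring.
Qed.

Lemma int_pos_centered_opp (h : R -> R) : moderate h ->
  int_pos (fun t => (h (- t) - normal_exp h) * gauss t)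
  = - int_pos (fun t => (h t - normal_exp h) * gauss t).
Proof.
  intro Hh. pose proof (moderate_centered h (normal_exp h) Hh) as Hk.
  assert (E : normal_exp (fun t => h t - normal_exp h) = 0).
  { rewrite normal_exp_minus by (auto using moderate_const). rewrite normal_exp_const. ring. }
  unfold normal_exp at 1 in E.
  set (A := int_pos _) in E at 1. set (B := int_pos _) in E.
  change (B = - A). pose proof sqrt_2PI_pos.
  apply (f_equal (fun z => z * sqrt (2 * PI))) in E. unfold Rdiv in E.
  rewrite Rmult_assoc, Rinv_l in E by lra. lra.
Qed.

(** Reduces bounds at negative x to x >= 0 with h reflected; the tail formula below is used on that
    side only. *)
Lemma stein_sol_opp (h : R -> R) (x : R) : moderate h ->
  stein_sol h (- x) = - stein_sol (fun t => h (- t)) x.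
Proof.
  intro Hh. unfold stein_sol. rewrite normal_exp_opp, int_pos_centered_opp by auto.
  destruct (moderate_gauss _ (moderate_centered h (normal_exp h) Hh)) as [K H].
  set (k := fun t => (h t - normal_exp h) * gauss t) in *.
  assert (E : RInt (fun t => (h (- t) - normal_exp h) * gauss t) 0 x = - RInt k 0 (- x) :> R).
  { rewrite (RInt_ext_R _ (fun t => -1 * (-1 * k (-1 * t + 0)))).
    - rewrite RInt_scal_R.
      + rewrite RInt_comp_affine by (eapply half_dominated_ex_RInt; eauto).
        replace (-1 * 0 + 0) with 0 by ring. replace (-1 * x + 0) with (- x) by ring. ring.
      + apply (ex_RInt_comp_lin k (-1) 0 0 x). eapply half_dominated_ex_RInt; eauto.
    - intros t _. replace (-1 * t + 0) with (- t) by ring. unfold k. rewrite gauss_opp.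
      simpl. ring. }
  rewrite E. replace (- x * - x) with (x * x) by ring. ring.
Qed.

(** This is exp(x^2/2) times [gauss (x + s)], see [gtilt_shift]: the growing prefactor of the Stein
    solution is absorbed into the Gaussian tail before anything is estimated. *)
Definition gtilt (x s : R) : R := gauss s * exp (- (s * x)).

(** The factor [gauss s] is traded for extra decay, so the rate is 1+x instead of x. Integrals then
    stay bounded at x = 0 and still decay like 1/x. *)
Lemma gtilt_le (x s : R) : gtilt x s <= 2 * exp (- (s * (1 + x))).
Proof.
  unfold gtilt. apply Rle_trans with (2 * exp (- s) * exp (- (s * x))).
  - apply Rmult_le_compat_r; [left; apply exp_pos | apply gauss_le].
  - right. rewrite Rmult_assoc, <- exp_plus. do 2 f_equal. ring.
Qed.

Lemma gtilt_pos (x s : R) : 0 < gtilt x s.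
Proof. apply Rmult_lt_0_compat; apply exp_pos. Qed.

Lemma gtilt_shift (x s : R) : exp (x * x / 2) * gauss (x + s) = gtilt x s.
Proof. unfold gtilt, gauss. rewrite <- !exp_plus. f_equal. field. Qed.

Lemma moderate_gtilt (h : R -> R) (x : R) : moderate h -> 0 <= x ->
  exists K, exp_dominated K (fun s => h s * gtilt x s).
Proof.
  intros Hh Hx. destruct (moderate_gauss h Hh) as [K H]. exists K. intros s Hs.
  destruct (half_dominated_exp _ _ H s Hs) as [H1 H2]. split.
  - apply (continuous_ext (fun s => h s * gauss s * exp (- (s * x)))).
    + intro t. unfold gtilt. as_R. ring.
    + apply (continuous_mult (fun s => h s * gauss s) (fun s => exp (- (s * x)))); auto.
      apply (ex_derive_continuous (fun s => exp (- (s * x)))). auto_derive; auto.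
  - unfold gtilt. rewrite <- Rmult_assoc, Rabs_mult.
    rewrite (Rabs_pos_eq (exp _)) by (left; apply exp_pos).
    assert (exp (- (s * x)) <= 1) by (rewrite <- exp_0; apply exp_le_compat; nra).
    pose proof (exp_pos (- (s * x))). pose proof (Rabs_pos (h s * gauss s)). nra.
Qed.

Lemma moderate_shift (h : R -> R) (x : R) : moderate h -> moderate (fun s => h (x + s)).
Proof.
  intros [K H]. pose proof (lin_growth_K_pos _ _ H) as HK.
  exists (K * (1 + Rabs x)). intro s. destruct (H (x + s)) as [H1 H2]. split.
  - apply (continuous_comp (fun s => x + s) h); auto.
    apply (ex_derive_continuous (fun s => x + s)). auto_derive; auto.
  - eapply Rle_trans; [apply H2|]. rewrite Rmult_assoc. apply Rmult_le_compat_l; auto.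
    pose proof (Rabs_triang x s). pose proof (Rabs_pos x). pose proof (Rabs_pos s). nra.
Qed.

Lemma int_pos_gtilt (k : R -> R) (x : R) : moderate k -> 0 <= x ->
  exp (x * x / 2) * (int_pos (fun t => k t * gauss t) - RInt (fun t => k t * gauss t) 0 x)
  = int_pos (fun s => k (x + s) * gtilt x s).
Proof.
  intros Hk Hx. destruct (moderate_gauss k Hk) as [K H].
  rewrite (int_pos_shift K _ x Hx H).
  rewrite (int_pos_ext (fun s => k (x + s) * gtilt x s)
     (fun s => exp (x * x / 2) * (k (x + s) * gauss (x + s)))).
  - rewrite (int_pos_scal (exp (x * x / 2)) K (fun s => k (x + s) * gauss (x + s))).
    + ring.
    + apply half_dominated_exp. apply (half_dominated_shift K _ x Hx H).
  - intros s _. rewrite <- gtilt_shift. ring.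
Qed.

Lemma stein_sol_tail (h : R -> R) (x : R) : moderate h -> 0 <= x ->
  stein_sol h x = - int_pos (fun s => (h (x + s) - normal_exp h) * gtilt x s).
Proof.
  intros Hh Hx.
  rewrite <- (int_pos_gtilt (fun t => h t - normal_exp h)) by (auto using moderate_centered).
  unfold stein_sol. ring.
Qed.

(** Here the integrand is an exact derivative. The identity lets a constant be moved under the tail
    integral when f' is bounded. *)
Lemma int_pos_id_gtilt (x : R) : 0 <= x -> int_pos (fun s => (x + s) * gtilt x s) = 1.
Proof.
  intro Hx. rewrite <- (int_pos_gtilt (fun t => t)) by (auto using moderate_id).
  rewrite int_pos_id_gauss.
  rewrite RInt_id_gauss. unfold gauss. replace (1 - (1 - exp (- (x * x / 2)))) with (exp (- (x * x / 2))) by ring.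
  rewrite <- exp_plus, <- exp_0. f_equal. ring.
Qed.

(** The bound is the integral of (A + B s) * 2 exp(-s(1+x)) over the half-line, obtained from an
    explicit primitive. *)
Lemma int_pos_gtilt_bound (k : R -> R) (x A B : R) : moderate k -> 0 <= x -> 0 <= A -> 0 <= B ->
  (forall s, 0 < s -> Rabs (k s) <= A + B * s) ->
  Rabs (int_pos (fun s => k s * gtilt x s)) <= 2 * (A / (1 + x) + B / (1 + x) ^ 2).
Proof.
  intros Hk Hx HA HB H. destruct (moderate_gtilt k x Hk Hx) as [K HK].
  set (l := 1 + x). assert (Hl : 0 < l) by (unfold l; lra).
  apply (int_pos_bound K); auto. intros a b Hab.
  eapply Rle_trans.
  - apply (RInt_abs_le_primitive _
      (fun s => - 2 * exp (- (s * l)) * ((A + B * s) / l + B / l ^ 2))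
      (fun s => (A + B * s) * (2 * exp (- (s * l))))); try lra.
    + apply (exp_dominated_ex_RInt K); auto; lra.
    + intros s _. auto_derive; auto. field. lra.
    + intros s _. apply (ex_derive_continuous (fun s => (A + B * s) * (2 * exp (- (s * l))))).
      auto_derive; auto.
    + intros s Hs. rewrite Rabs_mult, (Rabs_pos_eq (gtilt x s)) by (left; apply gtilt_pos).
      apply Rmult_le_compat; [apply Rabs_pos | left; apply gtilt_pos | apply H; lra | apply gtilt_le].
  - simpl.
    assert (Ha : exp (- (a * l)) <= 1) by (rewrite <- exp_0; apply exp_le_compat; nra).
    assert (Hb : 0 <= exp (- (b * l)) * ((A + B * b) / l + B / (l * (l * 1)))).
    { apply Rmult_le_pos; [left; apply exp_pos|].
      apply Rplus_le_le_0_compat; apply Rdiv_le_0_compat; nra. }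
    assert (Ha' : exp (- (a * l)) * ((A + B * a) / l + B / (l * (l * 1))) <= A / l + B / (l * (l * 1))).
    (* The factor 1 + a l reproduces the left bracket with a A to spare, and exp(-a l)(1 + a l) <=
       1. *)
    { apply Rle_trans with (exp (- (a * l)) * (1 + a * l) * (A / l + B / (l * (l * 1)))).
      - rewrite Rmult_assoc. apply Rmult_le_compat_l; [left; apply exp_pos|].
        replace ((1 + a * l) * (A / l + B / (l * (l * 1))))
          with ((A + B * a) / l + B / (l * (l * 1)) + a * A) by (field; lra). nra.
      - rewrite <- (Rmult_1_l (A / l + _)) at 2. apply Rmult_le_compat_r.
        + apply Rplus_le_le_0_compat; apply Rdiv_le_0_compat; nra.
        + apply Rle_trans with (exp (- (a * l)) * exp (a * l)).
          * apply Rmult_le_compat_l; [left; apply exp_pos | apply exp_ineq1_le].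
          * right. rewrite <- exp_plus, <- exp_0. f_equal. ring. }
    lra.
Qed.

Lemma normal_exp_unit (h : R -> R) : moderate h -> (forall x, 0 <= h x <= 1) -> 0 <= normal_exp h <= 1.
Proof.
  intros Hh H. pose proof (normal_exp_const 0) as E0. pose proof (normal_exp_const 1) as E1.
  split; [rewrite <- E0 | rewrite <- E1]; apply normal_exp_le; auto using moderate_const; apply H.
Qed.

(** For x >= 0 the tail formula gives |f| <= 2/(1+x), hence |f| <= 2 and |x f| <= 2; the remaining
    part h - E h of f' adds at most 1. *)
Lemma stein_sol_unit_bounds (h : R -> R) (x : R) : moderate h -> (forall x, 0 <= h x <= 1) ->
  Rabs (stein_sol h x) <= 2 /\ Rabs (x * stein_sol h x + h x - normal_exp h) <= 3.
Proof.
  intros Hh H.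
  assert (main : forall h x, moderate h -> (forall x, 0 <= h x <= 1) -> 0 <= x ->
    Rabs (stein_sol h x) <= 2 /\ Rabs (x * stein_sol h x) <= 2).
  { clear h x Hh H. intros h x Hh H Hx. rewrite stein_sol_tail by auto.
    pose proof (normal_exp_unit h Hh H) as Hc.
    assert (Q : Rabs (int_pos (fun s => (h (x + s) - normal_exp h) * gtilt x s)) <= 2 * (1 / (1 + x) + 0 / (1 + x) ^ 2)).
    { apply (int_pos_gtilt_bound (fun s => h (x + s) - normal_exp h) x 1 0); try lra.
      - apply moderate_centered, moderate_shift; auto.
      - intros s _. specialize (H (x + s)). apply Rabs_le. lra. }
    assert (E : 2 * (1 / (1 + x) + 0 / (1 + x) ^ 2) = 2 / (1 + x)) by (field; lra). rewrite E in Q.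
    rewrite Rabs_mult, Rabs_Ropp, (Rabs_pos_eq x) by auto.
    assert (2 / (1 + x) <= 2) by (apply Rle_div_l; lra).
    assert (x * (2 / (1 + x)) <= 2).
    { replace (x * (2 / (1 + x))) with (2 * x / (1 + x)) by (field; lra). apply Rle_div_l; lra. }
    split; [lra|]. eapply Rle_trans; [|eassumption]. apply Rmult_le_compat_l; auto. }
  assert (both : Rabs (stein_sol h x) <= 2 /\ Rabs (x * stein_sol h x) <= 2).
  { destruct (Rle_or_lt 0 x) as [L|L]; [now apply main|].
    replace x with (- (- x)) by ring. rewrite stein_sol_opp by auto.
    rewrite Rmult_opp_opp, Rabs_Ropp.
    apply main; [now apply moderate_opp | intro; apply H | lra]. }
  destruct both as [B1 B2]. split; auto.
  pose proof (normal_exp_unit h Hh H). specialize (H x).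
  apply Rabs_le_between in B2. apply Rabs_le. lra.
Qed.

Definition lipschitz (L : R) (h : R -> R) : Prop := forall x y, Rabs (h x - h y) <= L * Rabs (x - y).

Lemma lipschitz_const_nonneg (L : R) (h : R -> R) : lipschitz L h -> 0 <= L.
Proof.
  intro H. specialize (H 1 0). pose proof (Rabs_pos (h 1 - h 0)).
  replace (1 - 0) with 1 in H by ring. rewrite Rabs_R1 in H. lra.
Qed.

Lemma lipschitz_moderate (L : R) (h : R -> R) : lipschitz L h -> moderate h.
Proof.
  intro H. pose proof (lipschitz_const_nonneg L h H) as HL.
  exists (Rabs (h 0) + L). intro x. split.
  - apply continuous_eps. intros e He. exists (e / (L + 1)). split; [apply Rdiv_lt_0_compat; lra|].
    intros y Hy. eapply Rle_lt_trans; [apply H|].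
    apply (proj2 (Rlt_div_r _ _ (L + 1) ltac:(lra))) in Hy.
    pose proof (Rabs_pos (y - x)). nra.
  - specialize (H x 0). rewrite Rminus_0_r in H.
    replace (h x) with ((h x - h 0) + h 0) by ring.
    eapply Rle_trans; [apply Rabs_triang|].
    pose proof (Rabs_pos (h 0)). pose proof (Rabs_pos x). nra.
Qed.

Lemma lipschitz_centered (L : R) (h : R -> R) (x : R) : lipschitz L h ->
  Rabs (h x - normal_exp h) <= L * (Rabs x + 1).
Proof.
  intro H. pose proof (lipschitz_moderate L h H) as Hh.
  pose proof (lipschitz_const_nonneg L h H) as HL.
  rewrite <- (normal_exp_const (h x)), <- normal_exp_minus by (auto using moderate_const).
  apply Rle_trans with (normal_exp (fun y => L * Rabs y + (L * Rabs x) * 1)).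
  - apply normal_exp_abs_le.
    + apply moderate_minus; auto using moderate_const.
    + apply (moderate_lin L (L * Rabs x) Rabs (fun _ => 1)); [apply moderate_abs | apply moderate_const].
    + intro y. eapply Rle_trans; [apply H|].
      pose proof (Rabs_triang x (- y)) as T. rewrite Rabs_Ropp in T.
      unfold Rminus. nra.
  - rewrite (normal_exp_lin L (L * Rabs x) Rabs (fun _ => 1)) by (auto using moderate_abs, moderate_const).
    rewrite normal_exp_const. pose proof normal_exp_abs. nra.
Qed.

(** The bound on f follows from |h(x+s) - E h| <= L(1+x+s). For f' the terms x f and h - E h may
    each grow linearly, so their cancellation has to be exploited. *)
Lemma stein_sol_lipschitz_bounds (L : R) (h : R -> R) (x : R) : lipschitz L h ->
  Rabs (stein_sol h x) <= 4 * L /\ Rabs (x * stein_sol h x + h x - normal_exp h) <= 2 * L.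
Proof.
  intros H.
  pose proof (lipschitz_const_nonneg L h H) as HL.
  assert (main : forall h x, lipschitz L h -> 0 <= x ->
    Rabs (stein_sol h x) <= 4 * L /\ Rabs (x * stein_sol h x + h x - normal_exp h) <= 2 * L).
  { clear h x H. intros h x H Hx. pose proof (lipschitz_moderate L h H) as Hh.
    rewrite stein_sol_tail by auto. split.
    - rewrite Rabs_Ropp. eapply Rle_trans.
      + apply (int_pos_gtilt_bound (fun s => h (x + s) - normal_exp h) x (L * (1 + x)) L); auto.
        * apply moderate_centered, moderate_shift; auto.
        * nra.
        * intros s Hs. eapply Rle_trans; [apply (lipschitz_centered L); auto|].
          rewrite Rabs_pos_eq by lra. right; ring.
      + replace (2 * (L * (1 + x) / (1 + x) + L / (1 + x) ^ 2)) with (2 * L + 2 * (L / (1 + x) ^ 2)) by (field; lra).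
        assert (L / (1 + x) ^ 2 <= L) by (apply Rle_div_l; nra). lra.
    - set (c := normal_exp h).
      destruct (moderate_gtilt (fun s => h (x + s) - c) x) as [K1 HK1]; auto.
      { apply moderate_centered, moderate_shift; auto. }
      destruct (moderate_gtilt (fun s => x + s) x) as [K2 HK2]; auto.
      { apply (moderate_shift (fun x => x)), moderate_id. }
      (* Writing h x - c as (h x - c) times an integral equal to 1 merges the two terms. The
         integrand becomes -x(h(x+s) - h x) + (h x - c)s, at most L(2x+1)s in absolute value, and
         2x+1 <= (1+x)^2. *)
      replace (x * - int_pos (fun s => (h (x + s) - c) * gtilt x s) + h x - c)
        with (- x * int_pos (fun s => (h (x + s) - c) * gtilt x s)
              + (h x - c) * int_pos (fun s => (x + s) * gtilt x s))
        by (rewrite int_pos_id_gtilt by auto; ring).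
      rewrite <- (int_pos_lin (- x) (h x - c) K1 K2) by auto.
      rewrite (int_pos_ext _ (fun s => (- x * (h (x + s) - h x) + (h x - c) * s) * gtilt x s)) by (intros; ring).
      eapply Rle_trans.
      + apply (int_pos_gtilt_bound (fun s => - x * (h (x + s) - h x) + (h x - c) * s) x 0 (L * (2 * x + 1))); try lra.
        * apply (moderate_lin (- x) (h x - c) (fun s => h (x + s) - h x) (fun s => s)); [|apply moderate_id].
          apply moderate_centered, moderate_shift; auto.
        * nra.
        * intros s Hs. rewrite Rplus_0_l. eapply Rle_trans; [apply Rabs_triang|].
          rewrite !Rabs_mult, Rabs_Ropp, (Rabs_pos_eq x), (Rabs_pos_eq s) by lra.
          pose proof (lipschitz_centered L h x H) as T1. fold c in T1. rewrite (Rabs_pos_eq x) in T1 by auto.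
          pose proof (H (x + s) x) as T2. replace (x + s - x) with s in T2 by ring.
          rewrite (Rabs_pos_eq s) in T2 by lra.
          apply Rle_trans with (x * (L * s) + L * (x + 1) * s); [|right; ring].
          apply Rplus_le_compat; [apply Rmult_le_compat_l; auto | apply Rmult_le_compat_r; lra].
      + assert (L * (2 * x + 1) / (1 + x) ^ 2 <= L) by (apply Rle_div_l; nra).
        unfold Rdiv at 1. lra. }
  destruct (Rle_or_lt 0 x) as [Lx|Lx]; [now apply main|].
  pose proof (lipschitz_moderate L h H) as Hh.
  assert (H' : lipschitz L (fun t => h (- t))).
  { intros y z. eapply Rle_trans; [apply H|]. right. f_equal.
    replace (- y - - z) with (- (y - z)) by ring. apply Rabs_Ropp. }
  destruct (main (fun t => h (- t)) (- x) H' ltac:(lra)) as [M1 M2].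
  rewrite Ropp_involutive, normal_exp_opp in M2.
  replace (stein_sol h x) with (- stein_sol (fun t => h (- t)) (- x))
    by (rewrite <- stein_sol_opp, Ropp_involutive; auto).
  rewrite Rabs_Ropp. split; auto.
  replace (x * - stein_sol (fun t => h (- t)) (- x)) with (- x * stein_sol (fun t => h (- t)) (- x)) by ring.
  auto.
Qed.

Lemma std_point_lt (m k : nat) : std_point (S m) k < std_point (S m) (S k).
Proof.
  unfold std_point. apply Rmult_lt_compat_r.
  - apply Rinv_0_lt_compat, sqrt_lt_R0, lt_0_INR; lia.
  - rewrite (S_INR k). lra.
Qed.

(** 17 L = 2(4L) + 4(2L) + L. The last L arises because the mean of h at the ends of a window of
    length 2/sqrt m differs from any value inside by at most half of L times that length. *)
Lemma bexp_normal_lipschitz (m : nat) (L : R) (h : R -> R) : (0 < m)%nat -> lipschitz L h ->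
  Rabs (bexp m (fun i => h (std_point m i)) - normal_exp h) <= 17 * L * / sqrt (INR m).
Proof.
  intros Hm H. destruct m as [|m]; [lia|].
  assert (Hs : 0 < sqrt (INR (S m))) by (apply sqrt_lt_R0, lt_0_INR; lia).
  eapply Rle_trans.
  - apply (stein_bexp_error h (stein_sol h) (normal_exp h) (4 * L) (2 * L)) with (o := fun _ => L * / sqrt (INR (S m))).
    + intro x. apply stein_sol_derive. eapply lipschitz_moderate; eauto.
    + intro x. now apply stein_sol_lipschitz_bounds.
    + intro x. now apply stein_sol_lipschitz_bounds.
    + intros k e He.
      pose proof (H (std_point (S m) k) e) as H1.
      pose proof (H (std_point (S m) (S k)) e) as H2.
      rewrite (Rabs_left1 (std_point (S m) k - e)) in H1 by lra.
      rewrite (Rabs_pos_eq (std_point (S m) (S k) - e)) in H2 by lra.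
      assert (E : L * (std_point (S m) (S k) - std_point (S m) k) = 2 * (L * / sqrt (INR (S m)))).
      { unfold std_point. rewrite (S_INR k). field. lra. }
      apply Rabs_le_between in H1. apply Rabs_le_between in H2. apply Rabs_le. lra.
  - rewrite bexp_const. right. ring.
Qed.

Definition unit_monotone (h : R -> R) : Prop :=
  moderate h /\ (forall x, 0 <= h x <= 1)
  /\ ((forall x y, x <= y -> h y <= h x) \/ (forall x y, x <= y -> h x <= h y)).

(** 33/2 = 2*2 + 4*3 + 1/2. For monotone h the mean of the end values differs from any value in
    between by at most half the jump, and the mean jump is at most 1/sqrt m by [bexp_telescope_le],
    however steep h is. *)
Lemma bexp_normal_monotone (m : nat) (h : R -> R) : (0 < m)%nat -> unit_monotone h ->
  Rabs (bexp m (fun i => h (std_point m i)) - normal_exp h) <= 33/2 * / sqrt (INR m).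
Proof.
  intros Hm [Hh [Hu Hmon]]. destruct m as [|m]; [lia|].
  set (g := fun k => (1/2) * Rabs (h (std_point (S m) k) - h (std_point (S m) (S k)))).
  eapply Rle_trans.
  - apply (stein_bexp_error h (stein_sol h) (normal_exp h) 2 3) with (o := g).
    + intro x. now apply stein_sol_derive.
    + intro x. now apply stein_sol_unit_bounds.
    + intro x. now apply stein_sol_unit_bounds.
    + intros k e He. unfold g. destruct Hmon as [M|M].
      * pose proof (M _ _ (proj1 He)). pose proof (M _ _ (proj2 He)).
        rewrite (Rabs_pos_eq (h (std_point (S m) k) - h (std_point (S m) (S k)))) by lra. apply Rabs_le. lra.
      * pose proof (M _ _ (proj1 He)). pose proof (M _ _ (proj2 He)).
        rewrite (Rabs_left1 (h (std_point (S m) k) - h (std_point (S m) (S k)))) by lra. apply Rabs_le. lra.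
  - unfold g. rewrite bexp_scal.
    assert (B : bexp m (fun k => Rabs (h (std_point (S m) k) - h (std_point (S m) (S k)))) <= / sqrt (INR (S m))).
    { destruct Hmon as [M|M].
      - rewrite (bexp_ext m _ (fun k => h (std_point (S m) k) - h (std_point (S m) (S k)))).
        + apply (bexp_telescope_le m (fun k => h (std_point (S m) k))); auto.
          intro i. apply M. left; apply std_point_lt.
        + intro i. apply Rabs_pos_eq. pose proof (M _ _ (Rlt_le _ _ (std_point_lt m i))). lra.
      - rewrite (bexp_ext m _ (fun k => (1 - h (std_point (S m) k)) - (1 - h (std_point (S m) (S k))))).
        + apply (bexp_telescope_le m (fun k => 1 - h (std_point (S m) k))).
          * intro i. pose proof (M _ _ (Rlt_le _ _ (std_point_lt m i))). lra.
          * intro i. specialize (Hu (std_point (S m) i)). lra.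
        + intro i. rewrite Rabs_left1; pose proof (M _ _ (Rlt_le _ _ (std_point_lt m i))); lra. }
    lra.
Qed.

(** * The product of two normal variables and the Bessel kernel *)

(** Up to the factor 1/(2 pi), the joint density of (N N', N) at (u, y) for u, y > 0; 1/y is the
    Jacobian. *)
Definition prod_kernel (u y : R) : R := gauss y * (gauss (u / y) * / y).

Lemma gauss_mul_le_1 (v : R) : v * gauss v <= 1.
Proof.
  apply Rle_trans with (exp (v * v / 2) * gauss v).
  - apply Rmult_le_compat_r; [left; apply gauss_pos|].
    apply Rle_trans with (1 + v * v / 2); [|apply exp_ineq1_le].
    pose proof (Rle_0_sqr (v - 1)) as P; unfold Rsqr in P. lra.
  - unfold gauss. rewrite <- exp_plus, Rplus_opp_r, exp_0. lra.
Qed.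

Lemma prod_kernel_pos (u y : R) : 0 < y -> 0 < prod_kernel u y.
Proof.
  intro Hy. apply Rmult_lt_0_compat; [apply gauss_pos|].
  apply Rmult_lt_0_compat; [apply gauss_pos | now apply Rinv_0_lt_compat].
Qed.

(** Applying v [gauss v] <= 1 at v = u/y trades the singularity 1/y for the constant 1/u. *)
Lemma prod_kernel_le (u y : R) : 0 < u -> 0 < y -> prod_kernel u y <= 2 / u * exp (- y).
Proof.
  intros Hu Hy. unfold prod_kernel.
  replace (2 / u * exp (- y)) with (2 * exp (- y) * / u) by (field; lra).
  assert (Hiy : 0 < / y) by (apply Rinv_0_lt_compat; auto).
  apply Rmult_le_compat; [left; apply gauss_pos | | apply gauss_le |].
  - apply Rmult_le_pos; [left; apply gauss_pos | lra].
  - apply (Rmult_le_reg_r u); auto. rewrite Rinv_l by lra.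
    replace (gauss (u / y) * / y * u) with (u / y * gauss (u / y)) by (field; lra).
    apply gauss_mul_le_1.
Qed.

Lemma gauss_continuity_2d (g : R -> R -> R) (u y : R) :
  continuity_2d_pt g u y -> continuity_2d_pt (fun u y => gauss (g u y)) u y.
Proof.
  intro H. apply (continuity_1d_2d_pt_comp gauss g); auto.
  apply continuity_pt_filterlim, gauss_continuous.
Qed.

Lemma prod_kernel_continuous : quadrant_continuous prod_kernel.
Proof.
  intros u y Hu Hy. unfold prod_kernel.
  assert (Hi : continuity_2d_pt (fun _ y => / y) u y)
    by (apply continuity_2d_pt_inv; [apply continuity_2d_pt_id2 | lra]).
  apply continuity_2d_pt_mult; [|apply continuity_2d_pt_mult; auto].
  - apply (gauss_continuity_2d (fun _ y => y)), continuity_2d_pt_id2.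
  - apply (gauss_continuity_2d (fun u y => u / y)).
    apply continuity_2d_pt_mult; auto. apply continuity_2d_pt_id1.
Qed.

Lemma weighted_kernel_continuous (H : R -> R) : (forall x, continuous H x) ->
  quadrant_continuous (fun u y => H u * prod_kernel u y).
Proof.
  intros HH u y Hu Hy. apply continuity_2d_pt_mult; [|now apply prod_kernel_continuous].
  apply (continuity_1d_2d_pt_comp H (fun u _ => u)); [|apply continuity_2d_pt_id1].
  apply continuity_pt_filterlim, HH.
Qed.

Lemma weighted_kernel_dominated (H : R -> R) : moderate H ->
  locally_exp_dominated (fun u y => H u * prod_kernel u y).
Proof.
  intros [K HH] a b Hab. exists (K * (1 + b) * (2 / a)). intros u Hu y Hy. split.
  - apply (continuity_2d_pt_slice (fun u y => H u * prod_kernel u y)).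
    apply weighted_kernel_continuous; try lra. intro; apply HH.
  - pose proof (lin_growth_K_pos _ _ HH) as HK.
    rewrite Rabs_mult, (Rabs_pos_eq (prod_kernel u y)) by (left; now apply prod_kernel_pos).
    rewrite Rmult_assoc. apply Rmult_le_compat; try apply Rabs_pos.
    + left; now apply prod_kernel_pos.
    + eapply Rle_trans; [apply HH|]. rewrite Rabs_pos_eq by lra. nra.
    + eapply Rle_trans; [apply prod_kernel_le; lra|].
      apply Rmult_le_compat_r; [left; apply exp_pos|].
      apply Rmult_le_compat_l; [lra|]. apply Rinv_le_contravar; lra.
Qed.

Lemma prod_kernel_dominated (u : R) : 0 < u -> exp_dominated (2 / u) (prod_kernel u).
Proof.
  intros Hu y Hy. split.
  - apply (continuity_2d_pt_slice prod_kernel). now apply prod_kernel_continuous.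
  - rewrite Rabs_pos_eq by (left; now apply prod_kernel_pos). now apply prod_kernel_le.
Qed.

(* The substitution [y = sqrt u e^(t/2)]. *)
Lemma bessel_integral_subst (u b : R) : 0 < u -> 0 <= b ->
  RInt (fun t => exp (- (u * cosh t))) 0 b
  = RInt (prod_kernel u) (sqrt u * exp (- b / 2)) (sqrt u * exp (b / 2)).
Proof.
  intros Hu Hb. assert (Hs : 0 < sqrt u) by (apply sqrt_lt_R0; auto).
  set (e := fun t => exp (- (u * cosh t))).
  set (g := fun t => sqrt u * exp (t / 2)).
  assert (Hg : forall t, 0 < g t) by (intro t; apply Rmult_lt_0_compat; auto; apply exp_pos).
  assert (He : forall t, continuous e t).
  { intro t. apply (ex_derive_continuous e). unfold e, cosh. auto_derive; auto. }
  assert (Ee : forall p q, ex_RInt e p q).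
  { intros p q. apply (ex_RInt_continuous (V := R_CompleteNormedModule)). intros; apply He. }
  (* The differential dy = (y/2) dt cancels the 1/y of the kernel and leaves a factor 1/2, which the
     evenness of cosh on [-b, b] compensates. *)
  assert (C : is_RInt (fun t => scal (g t / 2) (prod_kernel u (g t))) (- b) b
     (RInt (prod_kernel u) (g (- b)) (g b))).
  { apply (is_RInt_comp (prod_kernel u) g (fun t => g t / 2)).
    - intros t _. apply (prod_kernel_dominated u Hu (g t) (Hg t)).
    - intros t _. split.
      + unfold g. auto_derive; auto. unfold Rdiv. field.
      + apply (ex_derive_continuous (fun t => g t / 2)). unfold g. auto_derive; auto. }
  apply (is_RInt_unique (V := R_CompleteNormedModule)) in C.
  change (g (- b)) with (sqrt u * exp (- b / 2)) in C.
  change (g b) with (sqrt u * exp (b / 2)) in C.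
  rewrite <- C.
  rewrite (RInt_ext_R (fun t => scal (g t / 2) (prod_kernel u (g t))) (fun t => 1/2 * e t)).
  - rewrite RInt_scal_R by auto.
    rewrite <- (RInt_Chasles e (- b) 0 b) by auto. unfold plus; simpl.
    assert (S : RInt e (- b) 0 = RInt e 0 b :> R).
    { rewrite (RInt_ext_R (fun t => e t) (fun t => -1 * (-1 * e (-1 * t + 0)))).
      - rewrite RInt_scal_R by (apply (ex_RInt_comp_lin e (-1) 0); auto).
        rewrite RInt_comp_affine by auto.
        replace (-1 * - b + 0) with b by ring. replace (-1 * 0 + 0) with 0 by ring.
        rewrite <- (opp_RInt_swap e) by auto. unfold opp; simpl. ring.
      - intros t _. replace (-1 * t + 0) with (- t) by ring. unfold e, cosh.
        rewrite Ropp_involutive. replace (exp (- t) + exp t) with (exp t + exp (- t)) by ring. ring. }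
    change (RInt e 0 b = 1/2 * (RInt e (- b) 0 + RInt e 0 b) :> R).
    rewrite S. assert (Q : forall r : R, r = 1/2 * (r + r)) by (intro; field). apply Q.
  - intros t _. unfold scal; simpl; unfold mult; simpl.
    unfold prod_kernel. pose proof (Hg t).
    replace (g t / 2 * (gauss (g t) * (gauss (u / g t) * / g t)))
      with (1/2 * (gauss (g t) * gauss (u / g t))) by (field; lra).
    f_equal. unfold gauss, e. rewrite <- exp_plus. f_equal.
    (* With y^2 = u e^t the exponent y^2/2 + (u/y)^2/2 becomes u cosh t. *)
    assert (G2 : g t * g t = u * exp t).
    { unfold g. replace (sqrt u * exp (t / 2) * (sqrt u * exp (t / 2)))
        with (sqrt u * sqrt u * (exp (t / 2) * exp (t / 2))) by ring.
      rewrite sqrt_sqrt, <- exp_plus by lra. f_equal. f_equal. field. }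
    replace (u / g t * (u / g t)) with (u * u / (g t * g t)) by (field; lra).
    rewrite G2. unfold cosh. rewrite exp_Ropp. pose proof (exp_pos t). field. lra.
Qed.

Lemma improper_int_0_inf_unique (f : R -> R) (l l' : R) :
  improper_int_0_inf f l -> improper_int_0_inf f l' -> l = l'.
Proof.
  intros H H'. apply Rminus_diag_uniq. apply Rabs_eq_0.
  apply Rle_antisym; [|apply Rabs_pos]. apply le_epsilon. intros eps He.
  destruct (H (eps / 2) ltac:(lra)) as [B HB]. destruct (H' (eps / 2) ltac:(lra)) as [B' HB'].
  destruct (HB (Rmax B B') (Rmax_l _ _)) as [p Hp].
  destruct (HB' (Rmax B B') (Rmax_r _ _)) as [p' Hp'].
  rewrite <- RInt_Reals in Hp. rewrite <- RInt_Reals in Hp'.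
  apply Rabs_lt_between in Hp. apply Rabs_lt_between in Hp'. apply Rabs_le. lra.
Qed.

(** [K0] is a chosen limit, so it can be identified only after the limit is shown to exist and to be
    unique. *)
Lemma K0_int_pos (u : R) : 0 < u -> K0 u = int_pos (prod_kernel u).
Proof.
  intro Hu.
  assert (I : improper_int_0_inf (fun t => exp (- (u * cosh t))) (int_pos (prod_kernel u))).
  { intros eps Heps.
    assert (Hs : 0 < sqrt u) by (apply sqrt_lt_R0; auto).
    (* At the cut-offs sqrt u e^(-b/2) and sqrt u e^(b/2), the error in [int_pos_close] is at most A
       exp(-b/2) <= 2A/b. *)
    set (A := 2 / u * (sqrt u + / sqrt u)).
    assert (HA : 0 < A).
    { apply Rmult_lt_0_compat; [apply Rdiv_lt_0_compat; lra|].
      pose proof (Rinv_0_lt_compat _ Hs). lra. }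
    exists (2 * A / eps + 1). intros b Hb.
    assert (0 < 2 * A / eps) by (apply Rdiv_lt_0_compat; lra).
    assert (E : ex_RInt (fun t => exp (- (u * cosh t))) 0 b).
    { apply (ex_RInt_continuous (V := R_CompleteNormedModule)). intros t _.
      apply (ex_derive_continuous (fun t => exp (- (u * cosh t)))). unfold cosh. auto_derive; auto. }
    exists (ex_RInt_Reals_0 _ _ _ E).
    rewrite <- RInt_Reals, bessel_integral_subst by lra.
    assert (e1 : exp (- b / 2) <= 2 / b).
    { replace (- b / 2) with (- (b / 2)) by field. replace (2 / b) with (/ (b / 2)) by (field; lra).
      apply exp_neg_le_inv. lra. }
    pose proof (exp_pos (b / 2)) as ep. pose proof (exp_pos (- b / 2)) as em.
    assert (e2 : exp (- (sqrt u * exp (b / 2))) <= / sqrt u * exp (- b / 2)).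
    { eapply Rle_trans; [apply exp_neg_le_inv; nra|].
      rewrite Rinv_mult. right. f_equal. replace (- b / 2) with (- (b / 2)) by field.
      symmetry; apply exp_Ropp. }
    eapply Rle_lt_trans.
    - apply (int_pos_close (2 / u)); [now apply prod_kernel_dominated|].
      split; [nra|]. apply Rmult_le_compat_l; [lra|]. apply exp_le_compat. lra.
    - apply Rle_lt_trans with (A * (2 / b)).
      + unfold A. rewrite Rmult_assoc. apply Rmult_le_compat_l; [left; apply Rdiv_lt_0_compat; lra|].
        rewrite Rmult_plus_distr_r. pose proof (Rinv_0_lt_compat _ Hs).
        apply Rplus_le_compat; [apply Rmult_le_compat_l; lra|].
        eapply Rle_trans; [apply e2|]. apply Rmult_le_compat_l; lra.
      + replace (A * (2 / b)) with (2 * A / b) by (field; lra).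
        apply Rlt_div_l; [lra|].
        assert (2 * A < b * eps) by (apply Rlt_div_l; lra). lra. }
  apply (improper_int_0_inf_unique (fun t => exp (- (u * cosh t)))); auto.
  unfold K0. apply epsilon_spec. now exists (int_pos (prod_kernel u)).
Qed.

Lemma K0_nonneg (u : R) : 0 < u -> 0 <= K0 u.
Proof.
  intro Hu. rewrite K0_int_pos by auto. pose proof (prod_kernel_dominated u Hu) as H.
  replace 0 with (int_pos (fun y => 0 * prod_kernel u y)) by (rewrite (int_pos_scal 0 _ _ H); ring).
  apply (int_pos_le _ _ _ _ (exp_dominated_scal 0 _ _ H) H).
  intros y Hy. pose proof (prod_kernel_pos u y Hy). lra.
Qed.

Lemma K0_continuous (u : R) : 0 < u -> continuous K0 u.
Proof.
  intro Hu. apply (continuous_ext_loc _ (fun u => int_pos (fun y => 1 * prod_kernel u y))).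
  - apply (filter_imp (fun z => 0 < z)); [|now apply locally_pos].
    intros z Hz. rewrite K0_int_pos by auto. apply int_pos_ext. intros; ring.
  - apply (quadrant_int_pos_continuous (fun u y => 1 * prod_kernel u y)); auto.
    + apply (weighted_kernel_continuous (fun _ => 1)). intro; apply continuous_const.
    + apply (weighted_kernel_dominated (fun _ => 1)), moderate_const.
Qed.

Definition inner_gauss (H : R -> R) (y : R) : R := int_pos (fun x => H (y * x) * gauss x).

(** The contribution of N, N' > 0 to E H(N N'), without the factor 1/(2 pi). *)
Definition prod_half (H : R -> R) : R := int_pos (fun y => inner_gauss H y * gauss y).

Lemma inner_gauss_dominated (K y : R) (H : R -> R) : lin_growth K H ->
  exp_dominated (K * (1 + Rabs y) * exp 2) (fun x => H (y * x) * gauss x).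
Proof. intro HH. apply half_dominated_exp, lin_growth_gauss, lin_growth_scale, HH. Qed.

Lemma int_pos_abs_le_K (K : R) (f : R -> R) : exp_dominated K f -> Rabs (int_pos f) <= K.
Proof.
  intro H. apply (int_pos_bound K); auto. intros a b Hab.
  eapply Rle_trans; [apply (exp_dominated_RInt_le K); auto|].
  pose proof (exp_dominated_K_pos _ _ H).
  assert (exp (- a) <= 1) by (rewrite <- exp_0; apply exp_le_compat; lra).
  pose proof (exp_pos (- b)). nra.
Qed.

Lemma inner_gauss_lin_growth (K : R) (H : R -> R) :
  lin_growth K H -> lin_growth (K * exp 2) (inner_gauss H).
Proof.
  intros HH y. pose proof (lin_growth_K_pos _ _ HH) as HK. split.
  - apply (int_pos_param_continuous (fun y x => H (y * x) * gauss x) y 1 (K * (2 + Rabs y) * exp 2)); [lra| |].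
    + intros z Hz. eapply exp_dominated_le; [|now apply inner_gauss_dominated].
      apply Rmult_le_compat_r; [left; apply exp_pos|]. apply Rmult_le_compat_l; auto.
      pose proof (Rabs_triang_inv z y). lra.
    + intros x Hx. apply continuity_2d_pt_mult.
      * apply (continuity_1d_2d_pt_comp H (fun y x => y * x)).
        -- apply continuity_pt_filterlim, HH.
        -- apply continuity_2d_pt_mult; [apply continuity_2d_pt_id1 | apply continuity_2d_pt_id2].
      * apply (gauss_continuity_2d (fun _ x => x)), continuity_2d_pt_id2.
  - eapply Rle_trans; [apply int_pos_abs_le_K, inner_gauss_dominated, HH|]. right; ring.
Qed.

(** By u = y x, truncating u to (a, b) truncates the inner variable to (a/y, b/y), an interval that
    depends on y. *)
Lemma kernel_slice_integral (K a b y : R) (H : R -> R) : lin_growth K H -> 0 < a <= b -> 0 < y ->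
  RInt (fun u => H u * prod_kernel u y) a b
  = RInt (fun x => H (y * x) * gauss x) (a / y) (b / y) * gauss y.
Proof.
  intros HH Hab Hy.
  assert (Cf : forall u, continuous (fun u => H u * gauss (u / y)) u).
  { intro u. apply (continuous_mult H (fun u => gauss (u / y))); [apply HH|].
    apply (continuous_comp (fun u => u / y) gauss); [|apply gauss_continuous].
    apply (ex_derive_continuous (fun u => u / y)). auto_derive; auto. }
  assert (Ef : forall p q, ex_RInt (fun u => H u * gauss (u / y)) p q).
  { intros p q. apply (ex_RInt_continuous (V := R_CompleteNormedModule)). intros; apply Cf. }
  rewrite (RInt_ext_R _ (fun u => (gauss y * / y) * (H u * gauss (u / y)))).
  2:{ intros u _. unfold prod_kernel. ring. }
  rewrite RInt_scal_R by auto.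
  replace a with (y * (a / y) + 0) at 1 by (field; lra).
  replace b with (y * (b / y) + 0) at 1 by (field; lra).
  rewrite <- RInt_comp_affine by auto.
  rewrite (RInt_ext_R _ (fun x => y * (H (y * x) * gauss x))).
  2:{ intros x _. rewrite Rplus_0_r. do 3 f_equal. field. lra. }
  rewrite RInt_scal_R.
  - as_R. field. lra.
  - eapply half_dominated_ex_RInt. apply lin_growth_gauss, lin_growth_scale, HH.
Qed.

(** The exponent 3y - y^2/2 has maximum 9/2, at y = 3, rounded up to 5. *)
Lemma gauss_poly_le (y : R) : 0 <= y -> (1 + y) * (1 + y) * gauss y <= exp 5 * exp (- y).
Proof.
  intro Hy. apply Rle_trans with (exp y * exp y * gauss y).
  - apply Rmult_le_compat_r; [left; apply gauss_pos|].
    pose proof (exp_ineq1_le y). apply Rmult_le_compat; lra.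
  - unfold gauss. rewrite <- !exp_plus. apply exp_le_compat.
    pose proof (Rle_0_sqr (y - 3)) as P; unfold Rsqr in P. lra.
Qed.

Definition half_lim (f : R -> R) (l : R) : Prop :=
  forall eps, 0 < eps -> exists d M, 0 < d <= M /\ forall a b, 0 < a < d -> M <= b ->
    ex_RInt f a b /\ Rabs (RInt f a b - l) < eps.

Lemma weighted_K0_ex_RInt (H : R -> R) (a b : R) : (forall x, continuous H x) -> 0 < a <= b ->
  ex_RInt (fun u => H u * K0 u) a b.
Proof.
  intros HH Hab. apply (ex_RInt_continuous (V := R_CompleteNormedModule)). intros u Hu.
  rewrite Rmin_left in Hu by lra.
  apply (continuous_mult H K0); auto. apply K0_continuous. lra.
Qed.

(** After the exchange of integrals the error is an integral over y of the truncation error on (a/y,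
    b/y). As a/y is not small for y near 0, the integral is split at eta by [int_pos_small]; for y
    >= eta the error is controlled by (1+y)(a/eta + 1/b), the 1/b coming from exp(-b/y) <= y/b. *)
Lemma half_lim_K0 (H : R -> R) : moderate H -> half_lim (fun u => H u * K0 u) (prod_half H).
Proof.
  intros [K HH] eps Heps. pose proof (lin_growth_K_pos _ _ HH) as HK.
  set (C := K * exp 2 * exp 5 + 1).
  assert (HC : 0 < C).
  { pose proof (exp_pos 2). pose proof (exp_pos 5). unfold C.
    assert (0 <= K * exp 2 * exp 5) by (repeat apply Rmult_le_pos; lra). lra. }
  (* These choices give eps/4 from y < eta, and eps/8 each from a/eta and 1/b. *)
  set (eta := eps / (8 * C)).
  assert (Heta : 0 < eta) by (apply Rdiv_lt_0_compat; lra).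
  set (d := eta * (eps / (8 * C))).
  assert (Hd : 0 < d) by (apply Rmult_lt_0_compat; auto).
  set (M := Rmax d (8 * C / eps)).
  assert (HM : 0 < 8 * C / eps) by (apply Rdiv_lt_0_compat; lra).
  exists d, M. split; [split; auto; apply Rmax_l|]. intros a b Ha Hb.
  assert (HdM : d <= M) by apply Rmax_l. assert (HcM : 8 * C / eps <= M) by apply Rmax_r.
  split; [apply weighted_K0_ex_RInt; [intro; apply HH | lra]|].
  assert (HFc : quadrant_continuous (fun u y => H u * prod_kernel u y))
    by (apply weighted_kernel_continuous; intro; apply HH).
  assert (HFd : locally_exp_dominated (fun u y => H u * prod_kernel u y))
    by (apply weighted_kernel_dominated; exists K; auto).
  assert (Hab : 0 < a <= b) by lra.
  rewrite (RInt_ext_R _ (fun u => int_pos (fun y => H u * prod_kernel u y))).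
  2:{ intros u Hu. rewrite Rmin_left in Hu by lra.
      rewrite K0_int_pos by lra. symmetry. apply (int_pos_scal (H u) (2 / u)).
      apply prod_kernel_dominated; lra. }
  rewrite (int_pos_RInt_swap (fun u y => H u * prod_kernel u y) a b HFc HFd Hab).
  destruct (HFd a b Hab) as [K' HK'].
  pose proof (RInt_exp_dominated _ a b K' HFc Hab HK') as D1.
  pose proof (half_dominated_exp _ _ (lin_growth_gauss _ _ (inner_gauss_lin_growth K H HH))) as D2.
  unfold prod_half. rewrite <- (int_pos_minus _ _ _ _ D1 D2).
  set (f := fun y => RInt (fun u => H u * prod_kernel u y) a b - inner_gauss H y * gauss y).
  assert (Ef : forall y, 0 < y -> f y = (RInt (fun x => H (y * x) * gauss x) (a / y) (b / y)
                   - int_pos (fun x => H (y * x) * gauss x)) * gauss y).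
  { intros y Hy. unfold f. rewrite (kernel_slice_integral K) by auto. unfold inner_gauss. ring. }
  assert (Hexp : exp 2 * exp 5 * K <= C) by (unfold C; lra).
  assert (Pos : forall y, 0 < y -> 0 < a / y <= b / y).
  { intros y Hy. split; [apply Rdiv_lt_0_compat; lra|].
    apply Rmult_le_compat_r; [left; now apply Rinv_0_lt_compat | lra]. }
  assert (Df : exp_dominated (2 * C) f).
  { intros y Hy. split.
    - apply (continuous_minus (fun y => RInt (fun u => H u * prod_kernel u y) a b)
        (fun y => inner_gauss H y * gauss y)); [apply D1 | apply D2]; auto.
    - rewrite Ef, Rabs_mult, (Rabs_pos_eq (gauss y)) by (auto; left; apply gauss_pos).
      pose proof (inner_gauss_dominated K y H HH) as D. rewrite (Rabs_pos_eq y) in D by lra.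
      assert (T : Rabs (RInt (fun x => H (y * x) * gauss x) (a / y) (b / y)
                   - int_pos (fun x => H (y * x) * gauss x)) <= 2 * (K * (1 + y) * exp 2)).
      { pose proof (int_pos_abs_le_K _ _ D) as T1.
        pose proof (exp_dominated_RInt_le _ _ _ _ D (Pos y Hy)) as T2.
        pose proof (exp_dominated_K_pos _ _ D).
        assert (exp (- (a / y)) <= 1)
          by (rewrite <- exp_0; apply exp_le_compat; pose proof (Pos y Hy); lra).
        pose proof (exp_pos (- (b / y))).
        assert (K * (1 + y) * exp 2 * (exp (- (a / y)) - exp (- (b / y))) <= K * (1 + y) * exp 2 * 1)
          by (apply Rmult_le_compat_l; lra).
        apply Rabs_le_between in T1. apply Rabs_le_between in T2. apply Rabs_le. lra. }
      apply Rle_trans with (2 * (K * (1 + y) * exp 2) * gauss y);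
        [apply Rmult_le_compat_r; auto; left; apply gauss_pos|].
      apply Rle_trans with (2 * (K * exp 2) * ((1 + y) * (1 + y) * gauss y)).
      + pose proof (gauss_pos y). pose proof (exp_pos 2).
        replace (2 * (K * (1 + y) * exp 2) * gauss y) with (2 * (K * exp 2) * ((1 + y) * gauss y * 1)) by ring.
        apply Rmult_le_compat_l; [nra|].
        replace ((1 + y) * (1 + y) * gauss y) with ((1 + y) * gauss y * (1 + y)) by ring.
        apply Rmult_le_compat_l; [nra|lra].
      + apply Rle_trans with (2 * (K * exp 2) * (exp 5 * exp (- y))).
        * apply Rmult_le_compat_l; [pose proof (exp_pos 2); nra | apply gauss_poly_le; lra].
        * pose proof (exp_pos (- y)). replace (2 * (K * exp 2) * (exp 5 * exp (- y)))
            with (2 * (exp 2 * exp 5 * K) * exp (- y)) by ring.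
          apply Rmult_le_compat_r; lra. }
  assert (Hsmall : Rabs (int_pos f) <= 2 * C * eta + C * (a / eta + / b)).
  { apply int_pos_small; auto.
    - apply Rmult_le_pos; [lra|]. pose proof (Rinv_0_lt_compat b ltac:(lra)).
      assert (0 < a / eta) by (apply Rdiv_lt_0_compat; lra). lra.
    - intros y Hye. assert (Hy : 0 < y) by lra.
      rewrite Ef, Rabs_mult, (Rabs_pos_eq (gauss y)) by (auto; left; apply gauss_pos).
      pose proof (inner_gauss_dominated K y H HH) as D. rewrite (Rabs_pos_eq y) in D by lra.
      pose proof (int_pos_close _ _ _ _ D (Pos y Hy)) as T.
      assert (e1 : exp (- (b / y)) <= y / b).
      { replace (y / b) with (/ (b / y)) by (field; lra). apply exp_neg_le_inv. pose proof (Pos y Hy); lra. }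
      assert (e2 : a / y <= a / eta) by (apply Rmult_le_compat_l; [lra|]; apply Rinv_le_contravar; lra).
      assert (Hib : 0 < / b) by (apply Rinv_0_lt_compat; lra).
      assert (Hae : 0 < a / eta) by (apply Rdiv_lt_0_compat; lra).
      pose proof (gauss_pos y) as Hg. pose proof (exp_pos 2) as H2.
      assert (S : a / y + exp (- (b / y)) <= (1 + y) * (a / eta + / b)).
      { replace (y / b) with (y * / b) in e1 by (unfold Rdiv; ring). nra. }
      apply Rle_trans with (K * (1 + y) * exp 2 * ((1 + y) * (a / eta + / b)) * gauss y).
      { apply Rmult_le_compat_r; [lra|]. eapply Rle_trans; [apply T|].
        apply Rmult_le_compat_l; auto. apply Rmult_le_pos; [nra|lra]. }
      replace (K * (1 + y) * exp 2 * ((1 + y) * (a / eta + / b)) * gauss y)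
        with (K * exp 2 * (a / eta + / b) * ((1 + y) * (1 + y) * gauss y)) by ring.
      apply Rle_trans with (K * exp 2 * (a / eta + / b) * (exp 5 * exp (- y))).
      { apply Rmult_le_compat_l; [|apply gauss_poly_le; lra].
        apply Rmult_le_pos; [apply Rmult_le_pos; lra | lra]. }
      replace (K * exp 2 * (a / eta + / b) * (exp 5 * exp (- y)))
        with (exp 2 * exp 5 * K * (a / eta + / b) * exp (- y)) by ring.
      apply Rmult_le_compat_r; [left; apply exp_pos|]. apply Rmult_le_compat_r; lra. }
  eapply Rle_lt_trans; [exact Hsmall|].
  assert (E1 : 2 * C * eta = eps / 4) by (unfold eta; field; lra).
  assert (E2 : C * (a / eta) <= eps / 8).
  { apply Rle_trans with (C * (d / eta)).
    - apply Rmult_le_compat_l; [lra|]. apply Rmult_le_compat_r; [left; now apply Rinv_0_lt_compat | lra].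
    - right. unfold d. field. lra. }
  assert (E3 : C * / b <= eps / 8).
  { apply Rle_trans with (C * / (8 * C / eps)).
    - apply Rmult_le_compat_l; [lra|]. apply Rinv_le_contravar; lra.
    - right. field. lra. }
  lra.
Qed.

Lemma normal_scale_eq (h : R -> R) (y : R) :
  normal_exp (fun x => h (y * x)) = (inner_gauss h y + inner_gauss h (- y)) / sqrt (2 * PI).
Proof.
  unfold normal_exp. f_equal. f_equal. apply int_pos_ext. intros x _. do 2 f_equal. ring.
Qed.

Lemma normal_scale_moderate (h : R -> R) : moderate h ->
  moderate (fun y => normal_exp (fun x => h (y * x))).
Proof.
  intros [K H]. pose proof (inner_gauss_lin_growth K h H) as G.
  assert (M : moderate (inner_gauss h)) by (eexists; eauto).
  apply (moderate_ext (fun y => / sqrt (2 * PI) * inner_gauss h y + / sqrt (2 * PI) * inner_gauss h (- y))).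
  - intro y. rewrite normal_scale_eq. unfold Rdiv. ring.
  - apply moderate_lin; auto. now apply moderate_opp.
Qed.

Definition normal_prod_exp (h : R -> R) : R := normal_exp (fun y => normal_exp (fun x => h (y * x))).

(** The four sign quadrants contribute each half twice, and 2/(2 pi) = 1/pi is the normalisation of
    the density. *)
Lemma normal_prod_half (h : R -> R) : moderate h ->
  normal_prod_exp h = (prod_half h + prod_half (fun u => h (- u))) / PI.
Proof.
  intros [K H]. pose proof (inner_gauss_lin_growth K h H) as G.
  assert (M : moderate (inner_gauss h)) by (eexists; eauto).
  assert (M' : moderate (fun y => inner_gauss h (- y))) by now apply moderate_opp.
  pose proof sqrt_2PI_pos as Hs. pose proof PI_RGT_0 as HP.
  unfold normal_prod_exp.
  rewrite (normal_exp_ext _ (fun y => / sqrt (2 * PI) * inner_gauss h y + / sqrt (2 * PI) * inner_gauss h (- y))).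
  2:{ intro y. rewrite normal_scale_eq. unfold Rdiv. ring. }
  rewrite normal_exp_lin, (normal_exp_opp (inner_gauss h)) by auto.
  unfold normal_exp.
  assert (E : int_pos (fun x => inner_gauss h (- x) * gauss x) = prod_half (fun u => h (- u))).
  { apply int_pos_ext. intros y _. f_equal. apply int_pos_ext. intros x _. do 2 f_equal. ring. }
  rewrite E. fold (prod_half h).
  assert (S : sqrt (2 * PI) * sqrt (2 * PI) = 2 * PI) by (apply sqrt_sqrt; lra).
  replace (/ sqrt (2 * PI) * ((prod_half h + prod_half (fun u => h (- u))) / sqrt (2 * PI)) +
    / sqrt (2 * PI) * ((prod_half h + prod_half (fun u => h (- u))) / sqrt (2 * PI)))
   with (2 * (prod_half h + prod_half (fun u => h (- u))) / (sqrt (2 * PI) * sqrt (2 * PI))) by (field; lra).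
  rewrite S. field. lra.
Qed.

(** * Transfer to the improper integrals of the SVG(1,1,0) density *)

Lemma svg_density_pos (u : R) : 0 < u -> svg_density u = K0 u / PI.
Proof. intro Hu. unfold svg_density. now rewrite Rabs_pos_eq by lra. Qed.

Lemma svg_density_opp (u : R) : svg_density (- u) = svg_density u.
Proof. unfold svg_density. now rewrite Rabs_Ropp. Qed.

Lemma svg_density_nonneg (u : R) : 0 < u -> 0 <= svg_density u.
Proof.
  intro Hu. rewrite svg_density_pos by auto.
  apply Rdiv_le_0_compat; [now apply K0_nonneg | apply PI_RGT_0].
Qed.

Lemma half_lim_svg (H : R -> R) : moderate H ->
  half_lim (fun u => H u * svg_density u) (prod_half H / PI).
Proof.
  intros HH eps Heps. pose proof PI_RGT_0 as HP.
  destruct (half_lim_K0 H HH (eps * PI)) as [d [M [Hd HM]]]; [nra|].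
  exists d, M. split; auto. intros a b Ha Hb. destruct (HM a b Ha Hb) as [E T].
  assert (Ex : forall x, Rmin a b < x < Rmax a b -> / PI * (H x * K0 x) = H x * svg_density x).
  { intros x Hx. rewrite Rmin_left in Hx by lra. rewrite svg_density_pos by lra. field. lra. }
  split.
  - apply (ex_RInt_ext (fun x => / PI * (H x * K0 x))); auto.
    apply (ex_RInt_scal (fun x => H x * K0 x)); auto.
  - rewrite <- (RInt_ext_R (fun x => / PI * (H x * K0 x))) by auto.
    rewrite RInt_scal_R by auto.
    replace (/ PI * RInt (fun x => H x * K0 x) a b - prod_half H / PI)
      with (/ PI * (RInt (fun x => H x * K0 x) a b - prod_half H)) by (field; lra).
    assert (Hi : 0 < / PI) by now apply Rinv_0_lt_compat.
    rewrite Rabs_mult, (Rabs_pos_eq (/ PI)) by lra.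
    replace eps with (/ PI * (eps * PI)) by (field; lra).
    now apply Rmult_lt_compat_l.
Qed.

Lemma RInt_reflect (f : R -> R) (a b : R) : ex_RInt (fun u => f (- u)) a b ->
  ex_RInt f (- b) (- a) /\ RInt f (- b) (- a) = RInt (fun u => f (- u)) a b.
Proof.
  intro E.
  assert (I : is_RInt f (- b) (- a) (RInt (fun u => f (- u)) a b)).
  { apply (RInt_correct (V := R_CompleteNormedModule)) in E.
    apply (is_RInt_swap (V := R_NormedModule)) in E.
    pose proof (is_RInt_comp_opp (V := R_NormedModule) (fun u => f (- u)) (- b) (- a)) as C.
    rewrite !Ropp_involutive in C. apply C in E. clear C.
    apply (is_RInt_opp (V := R_NormedModule)) in E. rewrite opp_opp in E.
    apply (is_RInt_ext (V := R_NormedModule) (fun x => opp (opp (f (- - x))))); auto.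
    intros x _. now rewrite opp_opp, Ropp_involutive. }
  split; [exists (RInt (fun u => f (- u)) a b); exact I | now apply is_RInt_unique].
Qed.

Lemma improper_int_R_halves (f : R -> R) (l l' : R) :
  half_lim f l -> half_lim (fun u => f (- u)) l' -> improper_int_R f (l + l').
Proof.
  intros H H' eps He.
  destruct (H (eps / 2) ltac:(lra)) as [d [M [Hd HM]]].
  destruct (H' (eps / 2) ltac:(lra)) as [d' [M' [Hd' HM']]].
  exists (Rmin d d'), (Rmax M M'). split; [apply Rmin_glb_lt; lra|].
  intros e1 e2 A1 A2 H1 H2 HA1 HA2.
  pose proof (Rmin_l d d'). pose proof (Rmin_r d d').
  pose proof (Rmax_l M M'). pose proof (Rmax_r M M').
  destruct (HM e2 A2 ltac:(lra) ltac:(lra)) as [E2 T2].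
  destruct (HM' e1 A1 ltac:(lra) ltac:(lra)) as [E1 T1].
  destruct (RInt_reflect f e1 A1 E1) as [E1' R1].
  exists (ex_RInt_Reals_0 _ _ _ E1'), (ex_RInt_Reals_0 _ _ _ E2).
  rewrite <- !RInt_Reals, R1.
  apply Rabs_lt_between in T1. apply Rabs_lt_between in T2. apply Rabs_lt_between. lra.
Qed.

Lemma svg_improper_int (h : R -> R) : moderate h ->
  improper_int_R (fun x => h x * svg_density x) (normal_prod_exp h).
Proof.
  intro Hh. rewrite normal_prod_half by auto.
  replace ((prod_half h + prod_half (fun u => h (- u))) / PI)
    with (prod_half h / PI + prod_half (fun u => h (- u)) / PI) by (field; pose proof PI_RGT_0; lra).
  apply improper_int_R_halves; [now apply half_lim_svg|].
  intros eps He. destruct (half_lim_svg _ (moderate_opp h Hh) eps He) as [d [M [Hd HM]]].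
  exists d, M. split; auto. intros a b Ha Hb. destruct (HM a b Ha Hb) as [E T].
  assert (Ex : forall x, h (- x) * svg_density x = h (- x) * svg_density (- x))
    by (intro; now rewrite svg_density_opp).
  split.
  - apply (ex_RInt_ext (fun u => h (- u) * svg_density u)); auto.
  - rewrite <- (RInt_ext_R (fun u => h (- u) * svg_density u)); auto.
Qed.

Lemma RInt_mono_domain (f : R -> R) (a b a' b' : R) :
  0 < a' <= a -> a <= b -> b <= b' -> (forall p q, 0 < p <= q -> ex_RInt f p q) ->
  (forall x, 0 < x -> 0 <= f x) ->
  RInt f a' b' = RInt f a' a + RInt f a b + RInt f b b' /\ 0 <= RInt f a' a /\ 0 <= RInt f b b'.
Proof.
  intros Ha Hab Hb Ex Hp. split; [|split].
  - rewrite <- (RInt_Chasles f a' a b'), <- (RInt_Chasles f a b b') by (apply Ex; lra).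
    unfold plus; simpl. as_R. ring.
  - apply RInt_ge_0; [lra | apply Ex; lra | intros x Hx; apply Hp; lra].
  - apply RInt_ge_0; [lra | apply Ex; lra | intros x Hx; apply Hp; lra].
Qed.

(* On [(0, +oo)], the increments of the integral of [f] under an enlargement of the
   domain are dominated by those of the integral of [g]. *)
Lemma half_lim_dominated (f g : R -> R) (L : R) : half_lim g L ->
  (forall p q, 0 < p <= q -> ex_RInt f p q) -> (forall p q, 0 < p <= q -> ex_RInt g p q) ->
  (forall x, 0 < x -> 0 <= f x <= g x) -> exists l, half_lim f l.
Proof.
  intros HL Ef Eg Hfg.
  assert (inc : forall a b a' b', 0 < a' <= a -> a <= b -> b <= b' ->
     0 <= RInt f a' b' - RInt f a b <= RInt g a' b' - RInt g a b).
  { intros a b a' b' Ha Hab Hb.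
    destruct (RInt_mono_domain f a b a' b') as [F0 [F1 F2]]; auto; [apply Hfg|].
    destruct (RInt_mono_domain g a b a' b') as [G0 [G1 G2]]; auto.
    { intros x Hx. specialize (Hfg x Hx). lra. }
    assert (RInt f a' a <= RInt g a' a)
      by (apply RInt_le; [lra | apply Ef; lra | apply Eg; lra | intros x Hx; apply Hfg; lra]).
    assert (RInt f b b' <= RInt g b b')
      by (apply RInt_le; [lra | apply Ef; lra | apply Eg; lra | intros x Hx; apply Hfg; lra]).
    rewrite F0, G0. lra. }
  assert (near : forall eps, 0 < eps -> exists d M, 0 < d <= M /\
     forall a b a' b', 0 < a' <= a -> a < d -> M <= b -> b <= b' -> Rabs (RInt f a' b' - RInt f a b) <= eps).
  { intros eps He. destruct (HL (eps / 2) ltac:(lra)) as [d [M [Hd HM]]].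
    exists d, M. split; auto. intros a b a' b' Ha Had Hb Hbb.
    destruct (HM a b ltac:(lra) ltac:(lra)) as [_ T1].
    destruct (HM a' b' ltac:(lra) ltac:(lra)) as [_ T2].
    assert (I := inc a b a' b' ltac:(lra) ltac:(lra) ltac:(lra)).
    apply Rabs_lt_between in T1. apply Rabs_lt_between in T2.
    rewrite Rabs_pos_eq by lra. lra. }
  assert (ev : forall a b, 0 < a -> 0 < b -> exists N, forall n, (N <= n)%nat ->
     / (INR n + 1) <= a /\ b <= INR n + 1).
  { intros a b Ha Hb.
    destruct (cut_eventually a Ha) as [N1 H1].
    destruct (cut_eventually (/ b) (Rinv_0_lt_compat _ Hb)) as [N2 H2]. rewrite Rinv_inv in H2.
    exists (N1 + N2)%nat. intros n Hn. split; [apply H1; lia | apply H2; lia]. }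
  assert (C : ex_finite_lim_seq (cut_int f)).
  { apply ex_lim_seq_cauchy_corr. intro eps. pose proof (cond_pos eps) as He.
    destruct (near (eps / 2) ltac:(lra)) as [d [M [Hd HM]]].
    destruct (ev (d / 2) M ltac:(lra) ltac:(lra)) as [N HN].
    assert (key : forall n k, (N <= n)%nat -> (n <= k)%nat -> Rabs (cut_int f k - cut_int f n) < eps).
    { intros n k Hn Hk. destruct (HN n Hn) as [N1 N2]. apply le_INR in Hk.
      pose proof (cut_bounds n). pose proof (cut_bounds k). pose proof (pos_INR n).
      apply Rle_lt_trans with (eps / 2); [|lra]. apply HM; try lra.
      split; [lra|]. apply Rinv_le_contravar; lra. }
    exists N. intros n k Hn Hk. destruct (Nat.le_ge_cases n k) as [O|O].
    - rewrite Rabs_minus_sym. now apply key.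
    - now apply key. }
  apply Lim_seq_correct' in C. exists (real (Lim_seq (cut_int f))).
  set (l := real (Lim_seq (cut_int f))) in *.
  intros eps He. destruct (near (eps / 2) ltac:(lra)) as [d [M [Hd HM]]].
  exists d, M. split; auto. intros a b Ha Hb. split; [apply Ef; lra|].
  destruct (ev a b ltac:(lra) ltac:(lra)) as [N HN].
  apply is_lim_seq_spec in C. destruct (C (mkposreal (eps / 2) ltac:(lra))) as [N' HN']. simpl in HN'.
  specialize (HN (N + N')%nat ltac:(lia)). specialize (HN' (N + N')%nat ltac:(lia)).
  pose proof (cut_bounds (N + N')).
  assert (T := HM a b (/ (INR (N + N') + 1)) (INR (N + N') + 1) ltac:(lra) ltac:(lra) ltac:(lra) ltac:(lra)).
  unfold cut_int in HN'. apply Rabs_le_between in T. apply Rabs_lt_between in HN'.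
  apply Rabs_lt_between. lra.
Qed.

Lemma half_lim_le (f g : R -> R) (l l' : R) : half_lim f l -> half_lim g l' ->
  (forall x, 0 < x -> f x <= g x) -> l <= l'.
Proof.
  intros H H' Hfg. apply le_epsilon. intros eps He.
  destruct (H (eps / 2) ltac:(lra)) as [d [M [Hd HM]]].
  destruct (H' (eps / 2) ltac:(lra)) as [d' [M' [Hd' HM']]].
  pose proof (Rmin_l d d'). pose proof (Rmin_r d d').
  pose proof (Rmax_l M M'). pose proof (Rmax_r M M').
  assert (0 < Rmin d d') by (apply Rmin_glb_lt; lra).
  destruct (HM (Rmin d d' / 2) (Rmax M M') ltac:(lra) ltac:(lra)) as [E T].
  destruct (HM' (Rmin d d' / 2) (Rmax M M') ltac:(lra) ltac:(lra)) as [E' T'].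
  assert (RInt f (Rmin d d' / 2) (Rmax M M') <= RInt g (Rmin d d' / 2) (Rmax M M')).
  { apply RInt_le; auto; [lra|]. intros x Hx. apply Hfg. lra. }
  apply Rabs_lt_between in T. apply Rabs_lt_between in T'. lra.
Qed.

Lemma ex_RInt_step (f g1 g2 : R -> R) (z a b : R) : a <= b ->
  ex_RInt g1 a b -> ex_RInt g2 a b ->
  (forall x, a < x < b -> x < z -> f x = g1 x) -> (forall x, a < x < b -> z < x -> f x = g2 x) ->
  ex_RInt f a b.
Proof.
  intros Hab E1 E2 H1 H2.
  destruct (Rle_or_lt z a) as [L|L].
  { apply (ex_RInt_ext g2); auto. intros x Hx. rewrite Rmin_left, Rmax_right in Hx by auto.
    symmetry. apply H2; lra. }
  destruct (Rle_or_lt b z) as [L'|L'].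
  { apply (ex_RInt_ext g1); auto. intros x Hx. rewrite Rmin_left, Rmax_right in Hx by auto.
    symmetry. apply H1; lra. }
  apply (ex_RInt_Chasles f a z b).
  - apply (ex_RInt_ext g1).
    + intros x Hx. rewrite Rmin_left, Rmax_right in Hx by lra. symmetry. apply H1; lra.
    + apply (ex_RInt_Chasles_1 (V := R_CompleteNormedModule) g1 a z b); auto. lra.
  - apply (ex_RInt_ext g2).
    + intros x Hx. rewrite Rmin_left, Rmax_right in Hx by lra. symmetry. apply H2; lra.
    + apply (ex_RInt_Chasles_2 (V := R_CompleteNormedModule) g2 a z b); auto. lra.
Qed.

Lemma svg_ex_RInt (a b : R) : 0 < a <= b -> ex_RInt svg_density a b.
Proof.
  intro Hab. apply (ex_RInt_ext (fun u => / PI * (1 * K0 u))).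
  - intros x Hx. rewrite Rmin_left in Hx by lra. rewrite svg_density_pos by lra.
    as_R. field. pose proof PI_RGT_0; lra.
  - apply (ex_RInt_scal (fun u => 1 * K0 u)). apply (weighted_K0_ex_RInt (fun _ => 1)); auto.
    intro; apply continuous_const.
Qed.

Definition ind_le (z x : R) : R := if Rle_dec x z then 1 else 0.

Lemma ind_le_unit (z x : R) : 0 <= ind_le z x <= 1.
Proof. unfold ind_le. destruct (Rle_dec x z); lra. Qed.

Lemma ind_half_ex_RInt (z : R) (a b : R) : 0 < a <= b ->
  ex_RInt (fun x => ind_le z x * svg_density x) a b
  /\ ex_RInt (fun x => ind_le z (- x) * svg_density (- x)) a b.
Proof.
  intro Hab. pose proof (svg_ex_RInt a b Hab) as E.
  assert (E0 : ex_RInt (fun _ => 0) a b) by apply ex_RInt_const.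
  split.
  - apply (ex_RInt_step _ svg_density (fun _ => 0) z); auto; try lra.
    + intros x _ Hx. unfold ind_le. destruct (Rle_dec x z); lra.
    + intros x _ Hx. unfold ind_le. destruct (Rle_dec x z); lra.
  - apply (ex_RInt_step _ (fun _ => 0) svg_density (- z)); auto; try lra.
    + intros x _ Hx. unfold ind_le. rewrite svg_density_opp. destruct (Rle_dec (- x) z); lra.
    + intros x _ Hx. unfold ind_le. rewrite svg_density_opp. destruct (Rle_dec (- x) z); lra.
Qed.

(** The indicator is discontinuous, so [svg_improper_int] does not apply. The integral exists by
    domination by the density itself, and its value is known only through comparison with continuous
    h from either side. *)
Lemma svg_cdf_exists (z : R) : exists P,
  improper_int_R (fun x => ind_le z x * svg_density x) P /\
  forall h, moderate h ->
    ((forall x, h x <= ind_le z x) -> normal_prod_exp h <= P) /\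
    ((forall x, ind_le z x <= h x) -> P <= normal_prod_exp h).
Proof.
  pose proof (half_lim_svg _ (moderate_const 1)) as H1.
  assert (E1 : forall p q, 0 < p <= q -> ex_RInt (fun u => 1 * svg_density u) p q).
  { intros p q Hpq. apply (ex_RInt_ext svg_density); [intros; as_R; ring | now apply svg_ex_RInt]. }
  destruct (half_lim_dominated (fun x => ind_le z x * svg_density x) _ _ H1) as [l Hl]; auto.
  { intros p q Hpq. exact (proj1 (ind_half_ex_RInt z p q Hpq)). }
  { intros x Hx. pose proof (svg_density_nonneg x Hx). pose proof (ind_le_unit z x). nra. }
  destruct (half_lim_dominated (fun x => ind_le z (- x) * svg_density (- x)) _ _ H1) as [l' Hl']; auto.
  { intros p q Hpq. exact (proj2 (ind_half_ex_RInt z p q Hpq)). }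
  { intros x Hx. rewrite svg_density_opp. pose proof (svg_density_nonneg x Hx).
    pose proof (ind_le_unit z (- x)). nra. }
  exists (l + l'). split; [now apply improper_int_R_halves|].
  intros h Hh. rewrite normal_prod_half by auto.
  replace ((prod_half h + prod_half (fun u => h (- u))) / PI)
    with (prod_half h / PI + prod_half (fun u => h (- u)) / PI) by (field; pose proof PI_RGT_0; lra).
  pose proof (half_lim_svg h Hh) as A. pose proof (half_lim_svg _ (moderate_opp h Hh)) as B.
  split; intro H; apply Rplus_le_compat.
  - apply (half_lim_le _ _ _ _ A Hl). intros x Hx.
    apply Rmult_le_compat_r; [now apply svg_density_nonneg | apply H].
  - apply (half_lim_le _ _ _ _ B Hl'). intros x Hx. rewrite svg_density_opp.
    apply Rmult_le_compat_r; [now apply svg_density_nonneg | apply H].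
  - apply (half_lim_le _ _ _ _ Hl A). intros x Hx.
    apply Rmult_le_compat_r; [now apply svg_density_nonneg | apply H].
  - apply (half_lim_le _ _ _ _ Hl' B). intros x Hx. rewrite svg_density_opp.
    apply Rmult_le_compat_r; [now apply svg_density_nonneg | apply H].
Qed.

(** * The two bounds *)

(* Replace the second factor for each value of the first, then the first factor for
   each value [y] of the normal variable: both steps only see the functions [h (a .)]. *)
Lemma EW_normal_prod (m n : nat) (h : R -> R) (al be : R) : (0 < m)%nat -> (0 < n)%nat ->
  moderate h -> 0 <= al -> 0 <= be ->
  (forall k a, (0 < k)%nat ->
     Rabs (bexp k (fun i => h (a * std_point k i)) - normal_exp (fun x => h (a * x)))
     <= (al + be * Rabs a) * / sqrt (INR k)) ->
  Rabs (EW m n h - normal_prod_exp h) <= (al + be) * (/ sqrt (INR m) + / sqrt (INR n)).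
Proof.
  intros Hm Hn Hh Hal Hbe H.
  assert (Hsm : 0 < / sqrt (INR m)) by (apply Rinv_0_lt_compat, sqrt_lt_R0, lt_0_INR; auto).
  assert (Hsn : 0 < / sqrt (INR n)) by (apply Rinv_0_lt_compat, sqrt_lt_R0, lt_0_INR; auto).
  rewrite EW_bexp by auto.
  set (mid := bexp m (fun i => normal_exp (fun y => h (std_point m i * y)))).
  assert (S1 : Rabs (bexp m (fun i => bexp n (fun j => h (std_point m i * std_point n j))) - mid)
               <= (al + be) * / sqrt (INR n)).
  { unfold mid. rewrite <- bexp_minus.
    apply Rle_trans with (bexp m (fun i => (al * / sqrt (INR n)) * 1 + (be * / sqrt (INR n)) * Rabs (std_point m i))).
    - apply bexp_abs_le. intro i. eapply Rle_trans; [apply H; auto|]. right; ring.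
    - rewrite bexp_lin, bexp_const. pose proof (bexp_std_abs_le m Hm) as B.
      apply (Rmult_le_compat_l (be * / sqrt (INR n))) in B; [lra|nra]. }
  assert (Mi : forall i, moderate (fun y => h (std_point m i * y))) by (intro; now apply moderate_scale).
  pose proof (normal_scale_moderate h Hh) as Mn.
  assert (S2 : Rabs (mid - normal_prod_exp h) <= (al + be) * / sqrt (INR m)).
  { unfold mid, normal_prod_exp.
    rewrite <- (normal_exp_bexp m (fun i y => h (std_point m i * y))) by auto.
    rewrite <- normal_exp_minus by (auto; now apply (moderate_bexp m (fun i y => h (std_point m i * y)))).
    apply Rle_trans with (normal_exp (fun y => (al * / sqrt (INR m)) * 1 + (be * / sqrt (INR m)) * Rabs y)).
    - apply normal_exp_abs_le.
      + apply moderate_minus; auto. now apply (moderate_bexp m (fun i y => h (std_point m i * y))).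
      + apply (moderate_lin _ _ (fun _ => 1) Rabs); [apply moderate_const | apply moderate_abs].
      + intro y. rewrite (bexp_ext m _ (fun i => h (y * std_point m i))) by (intro; f_equal; ring).
        eapply Rle_trans; [apply H; auto|]. right; ring.
    - rewrite (normal_exp_lin _ _ (fun _ => 1) Rabs) by (auto using moderate_const, moderate_abs).
      rewrite normal_exp_const. pose proof normal_exp_abs as B.
      apply (Rmult_le_compat_l (be * / sqrt (INR m))) in B; [lra|nra]. }
  apply Rabs_le_between in S1. apply Rabs_le_between in S2. apply Rabs_le. lra.
Qed.

Lemma lipschitz_EW (m n : nat) (h : R -> R) : (0 < m)%nat -> (0 < n)%nat -> lipschitz1 h ->
  Rabs (EW m n h - normal_prod_exp h) <= 17 * (/ sqrt (INR m) + / sqrt (INR n)).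
Proof.
  intros Hm Hn H.
  assert (Hh : lipschitz 1 h) by (intros x y; rewrite Rmult_1_l; apply H).
  replace 17 with (0 + 17) by ring.
  apply EW_normal_prod; auto; try lra; [eapply lipschitz_moderate; eauto|].
  intros k a Hk.
  assert (La : lipschitz (Rabs a) (fun x => h (a * x))).
  { intros x y. eapply Rle_trans; [apply H|].
    rewrite <- Rabs_mult. right. f_equal. ring. }
  eapply Rle_trans; [apply (bexp_normal_lipschitz k (Rabs a) _ Hk La)|]. right; ring.
Qed.

Lemma unit_monotone_scale (h : R -> R) (a : R) : unit_monotone h -> unit_monotone (fun x => h (a * x)).
Proof.
  intros [H1 [H2 H3]]. split; [now apply moderate_scale|]. split; [intro; apply H2|].
  destruct (Rle_or_lt 0 a) as [L|L].
  - destruct H3 as [M|M]; [left|right]; intros x y Hxy; apply M; apply Rmult_le_compat_l; lra.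
  - destruct H3 as [M|M]; [right|left]; intros x y Hxy; apply M; nra.
Qed.

(** Stability of the class under every scaling makes the factor estimate uniform in a, so the
    coefficient of |a| is 0. *)
Lemma monotone_EW (m n : nat) (h : R -> R) : (0 < m)%nat -> (0 < n)%nat -> unit_monotone h ->
  Rabs (EW m n h - normal_prod_exp h) <= 33/2 * (/ sqrt (INR m) + / sqrt (INR n)).
Proof.
  intros Hm Hn H. replace (33/2) with (33/2 + 0) by ring.
  apply EW_normal_prod; auto; try lra; [apply H|].
  intros k a Hk. rewrite Rmult_0_l, Rplus_0_r.
  apply (bexp_normal_monotone k (fun x => h (a * x)) Hk). now apply unit_monotone_scale.
Qed.

(** * Continuous approximation of the indicator of a half-line *)

Definition ramp (t : R) : R := Rmax 0 (Rmin 1 t).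

Lemma ramp_unit (t : R) : 0 <= ramp t <= 1.
Proof. unfold ramp, Rmax, Rmin. repeat destruct Rle_dec; lra. Qed.

Lemma ramp_mono (s t : R) : s <= t -> ramp s <= ramp t.
Proof. unfold ramp, Rmax, Rmin. repeat destruct Rle_dec; lra. Qed.

Lemma ramp_lipschitz (s t : R) : Rabs (ramp s - ramp t) <= Rabs (s - t).
Proof.
  unfold ramp, Rmax, Rmin, Rabs.
  repeat destruct Rle_dec; repeat destruct Rcase_abs; lra.
Qed.

(** Equal to 1 up to z and to 0 from z+e on, linear in between; with z-e in place of z it lies below
    the indicator. *)
Definition smooth_step (z e x : R) : R := ramp ((z - x) / e + 1).

Lemma smooth_step_monotone (z e : R) : 0 < e -> unit_monotone (smooth_step z e).
Proof.
  intro He. assert (Hi : 0 < / e) by now apply Rinv_0_lt_compat. split; [|split].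
  - apply (lipschitz_moderate (/ e)). intros x y. eapply Rle_trans; [apply ramp_lipschitz|].
    replace ((z - x) / e + 1 - ((z - y) / e + 1)) with (- (/ e * (x - y))) by (field; lra).
    rewrite Rabs_Ropp, Rabs_mult, (Rabs_pos_eq (/ e)) by lra. lra.
  - intro x. apply ramp_unit.
  - left. intros x y Hxy. apply ramp_mono. unfold Rdiv. nra.
Qed.

Lemma smooth_step_upper (z e x : R) : 0 < e -> ind_le z x <= smooth_step z e x.
Proof.
  intro He. unfold ind_le. destruct (Rle_dec x z) as [H|H]; [|apply ramp_unit].
  unfold smooth_step. assert (0 <= (z - x) / e) by (apply Rdiv_le_0_compat; lra).
  unfold ramp, Rmax, Rmin. repeat destruct Rle_dec; lra.
Qed.

Lemma smooth_step_lower (z e x : R) : 0 < e -> smooth_step (z - e) e x <= ind_le z x.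
Proof.
  intro He. unfold ind_le. destruct (Rle_dec x z) as [H|H]; [apply ramp_unit|].
  unfold smooth_step. replace ((z - e - x) / e + 1) with ((z - x) / e) by (field; lra).
  assert ((z - x) / e <= 0) by (apply Rle_div_l; lra).
  unfold ramp, Rmax, Rmin. repeat destruct Rle_dec; lra.
Qed.

Definition smooth_gap (z e x : R) : R := smooth_step z e x - smooth_step (z - e) e x.

Lemma smooth_gap_unit (z e x : R) : 0 < e -> 0 <= smooth_gap z e x <= 1.
Proof.
  intro He. pose proof (smooth_step_upper z e x He). pose proof (smooth_step_lower z e x He).
  pose proof (ramp_unit ((z - x) / e + 1)). pose proof (ramp_unit ((z - e - x) / e + 1)).
  unfold smooth_gap in *. unfold smooth_step in *. lra.
Qed.

Lemma smooth_gap_moderate (z e : R) : 0 < e -> moderate (smooth_gap z e).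
Proof. intro He. apply moderate_minus; apply smooth_step_monotone; auto. Qed.

(* The lower step is the upper one translated by [e], so the integral telescopes. *)
Lemma smooth_gap_integral (z e p r : R) : 0 < e -> p <= r -> RInt (smooth_gap z e) p r <= e.
Proof.
  intros He Hpr. destruct (smooth_step_monotone z e He) as [[K M] [U _]].
  set (h := smooth_step z e) in *.
  assert (Ex : forall a b, ex_RInt h a b).
  { intros a b. apply (ex_RInt_continuous (V := R_CompleteNormedModule)). intros; apply M. }
  assert (E : RInt (smooth_gap z e) p r = RInt h p r - RInt h (p + e) (r + e) :> R).
  { replace (p + e) with (1 * p + e) by ring. replace (r + e) with (1 * r + e) by ring.
    rewrite <- (RInt_comp_affine h 1 e p r) by auto.
    assert (E2 : ex_RInt (fun y => 1 * h (1 * y + e)) p r).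
    { apply (ex_RInt_comp_lin h 1 e p r); auto. }
    rewrite (RInt_ext_R _ (fun x => h x - 1 * h (1 * x + e))).
    - apply (RInt_minus (V := R_CompleteNormedModule) h (fun x => 1 * h (1 * x + e))); auto.
    - intros x _. unfold smooth_gap, h. rewrite !Rmult_1_l. f_equal. unfold smooth_step.
      f_equal. field. lra. }
  rewrite E.
  pose proof (RInt_Chasles h p (p + e) r (Ex _ _) (Ex _ _)) as C1.
  pose proof (RInt_Chasles h (p + e) r (r + e) (Ex _ _) (Ex _ _)) as C2.
  unfold plus in C1, C2; simpl in C1, C2.
  assert (B1 : 0 <= RInt h r (r + e)) by (apply RInt_ge_0; auto; [lra | intros; apply U]).
  assert (B2 : RInt h p (p + e) <= e).
  { eapply Rle_trans; [apply RRle_abs|].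
    eapply Rle_trans; [apply (abs_RInt_le_const h p (p + e) 1); auto; [lra|]|lra].
    intros t _. rewrite Rabs_pos_eq; apply U. }
  lra.
Qed.

(** As [K0] is unbounded near 0, a small integral of q does not bound the expectation directly. For
    fixed y, substituting in the inner integral gives at most e/y, used for y >= eta; below eta only
    q <= 1 is used. The constants come from [gauss s] <= 2 exp(-s), applied to each factor. *)
Lemma prod_half_small (q : R -> R) (e eta : R) : moderate q -> (forall x, 0 <= q x <= 1) ->
  0 < eta -> 0 <= e -> (forall p r, p <= r -> RInt q p r <= e) ->
  Rabs (prod_half q) <= 4 * eta + 2 * (e / eta).
Proof.
  intros [K M] U Heta He H.
  pose proof (inner_gauss_lin_growth K q M) as G.
  assert (Bx : forall y x, 0 <= q (y * x) * gauss x <= gauss x).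
  { intros y x. pose proof (U (y * x)). pose proof (gauss_pos x). nra. }
  assert (Dx : forall y, exp_dominated 2 (fun x => q (y * x) * gauss x)).
  { intros y x Hx. split; [now apply (inner_gauss_dominated K y q M)|].
    rewrite Rabs_pos_eq by apply Bx. eapply Rle_trans; [apply Bx | apply gauss_le]. }
  assert (I1 : forall y, Rabs (inner_gauss q y) <= 2) by (intro y; apply int_pos_abs_le_K, Dx).
  assert (I2 : forall y, 0 < y -> Rabs (inner_gauss q y) <= e / y).
  { intros y Hy. apply (int_pos_bound 2); [apply Dx|]. intros a b Hab.
    assert (Eq : forall p r, ex_RInt q p r).
    { intros p r. apply (ex_RInt_continuous (V := R_CompleteNormedModule)). intros; apply M. }
    assert (Ea : ex_RInt (fun x => y * q (y * x + 0)) a b) by (apply (ex_RInt_comp_lin q y 0 a b); auto).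
    assert (Eb : ex_RInt (fun x => q (y * x) * gauss x) a b)
      by (apply (exp_dominated_ex_RInt 2); auto; lra).
    rewrite Rabs_pos_eq by (apply RInt_ge_0; [lra | auto | intros; apply Bx]).
    apply Rle_trans with (RInt (fun x => / y * (y * q (y * x + 0))) a b).
    - apply RInt_le; auto; [lra | apply (ex_RInt_scal (fun x => y * q (y * x + 0))); auto |].
      intros x _. rewrite Rplus_0_r, <- Rmult_assoc, Rinv_l, Rmult_1_l by lra.
      assert (gauss x <= 1) by (unfold gauss; rewrite <- exp_0; apply exp_le_compat; nra).
      pose proof (U (y * x)). pose proof (gauss_pos x). nra.
    - rewrite RInt_scal_R, RInt_comp_affine by auto.
      replace (e / y) with (/ y * e) by (field; lra).
      apply Rmult_le_compat_l; [left; now apply Rinv_0_lt_compat|]. apply H. nra. }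
  unfold prod_half. apply int_pos_small; auto.
  - apply Rmult_le_pos; [lra|]. apply Rdiv_le_0_compat; auto.
  - intros y Hy. split.
    + now apply (half_dominated_exp _ _ (lin_growth_gauss _ _ G)).
    + rewrite Rabs_mult, (Rabs_pos_eq (gauss y)) by (left; apply gauss_pos).
      replace (4 * exp (- y)) with (2 * (2 * exp (- y))) by ring.
      apply Rmult_le_compat; auto; [apply Rabs_pos | left; apply gauss_pos | apply gauss_le].
  - intros y Hy. rewrite Rabs_mult, (Rabs_pos_eq (gauss y)) by (left; apply gauss_pos).
    replace (2 * (e / eta) * exp (- y)) with (e / eta * (2 * exp (- y))) by ring.
    apply Rmult_le_compat; [apply Rabs_pos | left; apply gauss_pos | | apply gauss_le].
    eapply Rle_trans; [apply I2; lra|].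
    apply Rmult_le_compat_l; auto. apply Rinv_le_contravar; lra.
Qed.

Lemma normal_prod_minus (h g : R -> R) : moderate h -> moderate g ->
  normal_prod_exp (fun x => h x - g x) = normal_prod_exp h - normal_prod_exp g.
Proof.
  intros Hh Hg. unfold normal_prod_exp.
  rewrite <- normal_exp_minus by (now apply normal_scale_moderate).
  apply normal_exp_ext. intro y. apply normal_exp_minus; now apply moderate_scale.
Qed.

Lemma smooth_gap_small (z t : R) : 0 < t -> exists e, 0 < e /\
  normal_prod_exp (smooth_step z e) - normal_prod_exp (smooth_step (z - e) e) <= t.
Proof.
  (* 4 eta and 2 e/eta are t/4 each, so each half is at most t/2, and dividing the sum by PI >= 1
     keeps it below t. *)
  intro Ht. set (eta := t / 16). set (e := eta * t / 8).
  assert (Heta : 0 < eta) by (unfold eta; lra).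
  assert (He : 0 < e) by (unfold e; apply Rdiv_lt_0_compat; nra).
  exists e. split; auto.
  rewrite <- normal_prod_minus by (now apply smooth_step_monotone).
  change (normal_prod_exp (smooth_gap z e) <= t).
  pose proof (smooth_gap_moderate z e He) as Hq.
  rewrite normal_prod_half by auto.
  assert (Ex : forall a b, ex_RInt (fun u => smooth_gap z e (- u)) a b).
  { intros a b. destruct (moderate_opp _ Hq) as [K M].
    apply (ex_RInt_continuous (V := R_CompleteNormedModule)). intros; apply M. }
  assert (P1 : Rabs (prod_half (smooth_gap z e)) <= 4 * eta + 2 * (e / eta)).
  { apply prod_half_small; auto; [intro; now apply smooth_gap_unit | lra |].
    intros; now apply smooth_gap_integral. }
  assert (P2 : Rabs (prod_half (fun u => smooth_gap z e (- u))) <= 4 * eta + 2 * (e / eta)).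
  { apply prod_half_small; auto; [now apply moderate_opp | intro; now apply smooth_gap_unit | lra |].
    intros p r Hpr. destruct (RInt_reflect (smooth_gap z e) p r (Ex p r)) as [_ E].
    rewrite <- E. apply smooth_gap_integral; auto. lra. }
  assert (E : 4 * eta + 2 * (e / eta) = t / 2) by (unfold e; replace t with (16 * eta) by (unfold eta; field); field; lra).
  rewrite E in P1, P2. apply Rabs_le_between in P1. apply Rabs_le_between in P2.
  assert (1 <= PI) by (pose proof PI2_1; lra).
  apply Rle_div_l; [lra|]. nra.
Qed.

Lemma EW_le (m n : nat) (h g : R -> R) : (0 < m)%nat -> (0 < n)%nat ->
  (forall x, h x <= g x) -> EW m n h <= EW m n g.
Proof.
  intros Hm Hn H. rewrite !EW_bexp by auto. apply bexp_le. intro i. apply bexp_le. intro j. apply H.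
Qed.

(** With r = 1/m + 1/n the logarithm is -ln r. Since r <= 2 < e, it is at least -1, so the braces
    are at least 42.31. The left side is at most 33 sqrt r = 33 r^(1/6) r^(1/3), and r^(1/6) <=
    e^(1/6) <= 6/5 yields 39.6 r^(1/3). *)
Lemma kolmogorov_rate (m n : nat) : (0 < m)%nat -> (0 < n)%nat ->
  33/2 * (/ sqrt (INR m) + / sqrt (INR n))
  <= (44.33 + 2.02 * ln (INR m * INR n / (INR m + INR n))) * Rpower (/ INR m + / INR n) (1/3).
Proof.
  intros Hm Hn.
  assert (Hm1 : 1 <= INR m) by (apply (le_INR 1); lia).
  assert (Hn1 : 1 <= INR n) by (apply (le_INR 1); lia).
  set (r := / INR m + / INR n).
  assert (Im : 0 < / INR m <= 1).
  { split; [apply Rinv_0_lt_compat; lra | rewrite <- Rinv_1; apply Rinv_le_contravar; lra]. }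
  assert (In : 0 < / INR n <= 1).
  { split; [apply Rinv_0_lt_compat; lra | rewrite <- Rinv_1; apply Rinv_le_contravar; lra]. }
  assert (Hr : 0 < r <= 2) by (unfold r; lra).
  replace (INR m * INR n / (INR m + INR n)) with (/ r) by (unfold r; field; lra).
  rewrite ln_Rinv by lra.
  assert (Hl : ln r <= 1).
  { rewrite <- (ln_exp 1). apply ln_le; [lra|]. pose proof (exp_ineq1_le 1). lra. }
  assert (S : / sqrt (INR m) + / sqrt (INR n) <= 2 * sqrt r).
  { rewrite <- !sqrt_inv.
    assert (sqrt (/ INR m) <= sqrt r) by (apply sqrt_le_1_alt; unfold r; lra).
    assert (sqrt (/ INR n) <= sqrt r) by (apply sqrt_le_1_alt; unfold r; lra).
    lra. }
  assert (E : sqrt r = Rpower r (1/3) * Rpower r (1/6)).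
  { rewrite <- Rpower_plus, <- Rpower_sqrt by lra. f_equal. field. }
  assert (P6 : Rpower r (1/6) <= 6/5).
  { unfold Rpower. apply Rle_trans with (exp (1/6)); [apply exp_le_compat; lra|].
    pose proof (exp_ineq1_le (- (1/6))) as X. rewrite exp_Ropp in X.
    pose proof (exp_pos (1/6)) as Y.
    apply (Rmult_le_compat_r (exp (1/6))) in X; [|lra]. rewrite Rinv_l in X by lra. lra. }
  assert (P3 : 0 < Rpower r (1/3)) by apply exp_pos.
  apply Rle_trans with (33/2 * (2 * (Rpower r (1/3) * (6/5)))).
  - apply Rmult_le_compat_l; [lra|]. eapply Rle_trans; [exact S|]. rewrite E.
    apply Rmult_le_compat_l; [lra|]. apply Rmult_le_compat_l; lra.
  - replace (33/2 * (2 * (Rpower r (1/3) * (6/5)))) with (198/5 * Rpower r (1/3)) by field.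
    apply Rmult_le_compat_r; lra.
Qed.

Theorem theorem5p8 (m n : nat) (hm : (0 < m)%nat) (hn : (0 < n)%nat) :
  (* Wasserstein bound: sup over 1-Lipschitz h of |E h(W) - E h(Z)| *)
  (forall h : R -> R, lipschitz1 h ->
     exists EZh, improper_int_R (fun x => h x * svg_density x) EZh /\
       Rabs (EW m n h - EZh) <= 20.11 * (/ sqrt (INR m) + / sqrt (INR n)))
  /\
  (* Kolmogorov bound: sup over z of |P(W <= z) - P(Z <= z)| *)
  (forall z : R,
     exists PZz, improper_int_R (fun x => (if Rle_dec x z then 1 else 0) * svg_density x) PZz /\
       Rabs (PW_le m n z - PZz) <=
         (44.33 + 2.02 * ln (INR m * INR n / (INR m + INR n)))
         * Rpower (/ INR m + / INR n) (1/3)).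
Proof.
  split.
  - intros h Hh. exists (normal_prod_exp h). split.
    + apply svg_improper_int. apply (lipschitz_moderate 1). intros x y. rewrite Rmult_1_l. apply Hh.
    + eapply Rle_trans; [now apply lipschitz_EW|].
      apply Rmult_le_compat_r; [|lra].
      assert (0 < / sqrt (INR m)) by (apply Rinv_0_lt_compat, sqrt_lt_R0, lt_0_INR; auto).
      assert (0 < / sqrt (INR n)) by (apply Rinv_0_lt_compat, sqrt_lt_R0, lt_0_INR; auto).
      lra.
  - intro z. destruct (svg_cdf_exists z) as [P [HP Hsand]]. exists P. split; [exact HP|].
    eapply Rle_trans; [|now apply kolmogorov_rate].
    (* The width e is chosen after m and n; [monotone_EW] does not involve it, so only the arbitrary
       slack t remains. *)
    apply le_epsilon. intros t Ht. destruct (smooth_gap_small z t Ht) as [e [He Hgap]].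
    pose proof (smooth_step_monotone z e He) as Mu.
    pose proof (smooth_step_monotone (z - e) e He) as Ml.
    pose proof (monotone_EW m n _ hm hn Mu) as Bu.
    pose proof (monotone_EW m n _ hm hn Ml) as Bl.
    assert (Pu := proj2 (Hsand _ (proj1 Mu)) (fun x => smooth_step_upper z e x He)).
    assert (Pl := proj1 (Hsand _ (proj1 Ml)) (fun x => smooth_step_lower z e x He)).
    assert (Wu : PW_le m n z <= EW m n (smooth_step z e)).
    { apply (EW_le m n (ind_le z)); auto. intro x. now apply smooth_step_upper. }
    assert (Wl : EW m n (smooth_step (z - e) e) <= PW_le m n z).
    { apply (EW_le m n _ (ind_le z)); auto. intro x. now apply smooth_step_lower. }
    apply Rabs_le_between in Bu. apply Rabs_le_between in Bl. apply Rabs_le. lra.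
Qed.
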